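(* Let $d\ge 2$, let $K\subset\mathbb R^d$ be a nondegenerate $d$-simplex, and let $k\ge d+1$ be an integer. Then the degrees of freedom $$\boldsymbol\tau(\delta)\quad\forall\,\delta\in\mathcal V(K),\tag{1}$$ $$(\boldsymbol n_i^{\intercal}\boldsymbol\tau\boldsymbol n_j,q)_F\quad\forall\,q\in\mathbb P_{k+r-d-1}(F),\ F\in\mathcal F^r(K),\ i,j=1,\dots,r,\ r=1,\dots,d-1,\tag{2}$$ $$(\Pi_F\boldsymbol\tau\boldsymbol n,\boldsymbol q)_F\quad\forall\,\boldsymbol q\in \mathrm{ND}_{k-2}(F),\ F\in\mathcal F^1(K),\tag{3}$$ $$(\boldsymbol\tau,\boldsymbol q)_K\quad\forall\,\boldsymbol q\in\mathbb P_{k-2}(K;\mathbb S)\tag{4}$$ are uni-solvent for $\mathbb P_k(K;\mathbb S)$. Moreover, (4) can be replaced by the two families $$(\operatorname{div}\boldsymbol\tau,\boldsymbol q)_K\quad\forall\,\boldsymbol q\in\mathbb P_{k-1}(K;\mathbb R^d)/\boldsymbol{RM},\tag{5}$$ $$(\boldsymbol\tau,\boldsymbol q)_K\quad\forall\,\boldsymbol q\in\ker(\cdot\boldsymbol x)\cap\mathbb P_{k-2}(K;\mathbb S),\tag{6}$$ that is, (1), (2), (3), (5), (6) are also uni-solvent for $\mathbb P_k(K;\mathbb S)$.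
   Context: Coordinates $\boldsymbol x$ on $\mathbb R^d$ are chosen with the origin in $K$. $\mathcal F^r(K)$ is the set of $(d-r)$-dimensional faces of $K$, and $\mathcal V(K)=\mathcal F^d(K)$ is the set of vertices. For $F\in\mathcal F^r(K)$ with $1\le r\le d-1$, $\boldsymbol n_1,\dots,\boldsymbol n_r$ (depending on $F$) are mutually orthogonal unit vectors spanning the orthogonal complement of the tangent space of $F$; for $r=1$ write $\boldsymbol n=\boldsymbol n_1$ and $\Pi_F\boldsymbol v=(\boldsymbol I-\boldsymbol n\boldsymbol n^{\intercal})\boldsymbol v$. $(\cdot,\cdot)_F$, $(\cdot,\cdot)_K$ are $L^2$ inner products. $\mathbb S$ (resp. $\mathbb K$) is the space of symmetric (resp. skew-symmetric) real matrices of the appropriate size ($d\times d$ on $K$). $\mathbb P_m(D)$ is the space of polynomials on $D$ of total degree $\le m$ ($\{0\}$ if $m<0$), $\mathbb H_m(D)$ is the space of homogeneous polynomials of degree $m$, and $\mathbb P_m(D;X)$, $\mathbb H_m(D;X)$ are the $X$-valued versions. For a simplex $D$ of dimension $s$ (a face being identified with a simplex in $\mathbb R^{s}$ through Cartesian coordinates $\boldsymbol x$ of its affine hull, tangential vectors being identified with $\mathbb R^s$), $\mathrm{ND}_m(D)=\mathbb P_m(D;\mathbb R^s)\oplus\mathbb H_m(D;\mathbb K)\boldsymbol x$ (first-kind Nédélec space; $\{\boldsymbol 0\}$ if $m<0$). $\boldsymbol{RM}=\{\boldsymbol c+\boldsymbol N\boldsymbol x:\boldsymbol c\in\mathbb R^d,\boldsymbol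 N\in\mathbb K\}$. $\operatorname{div}$ of a matrix field is taken row-wise. $\ker(\cdot\boldsymbol x)$ denotes matrix fields $\boldsymbol\tau$ with $\boldsymbol\tau\boldsymbol x=\boldsymbol 0$. For $W\subseteq U$, $U/W$ denotes the $L^2(K)$-orthogonal complement of $W$ in $U$. Uni-solvent for a finite-dimensional space $V$ means: (a) the only $\boldsymbol\tau\in V$ for which all listed quantities vanish is $\boldsymbol\tau=\boldsymbol 0$; and (b) the number of degrees of freedom equals $\dim V$, where one counts $d(d+1)/2$ for each vertex value $\boldsymbol\tau(\delta)$, only pairs $i\le j$ in the families with $\boldsymbol n_i^{\intercal}\boldsymbol\tau\boldsymbol n_j$ (by symmetry), and for each family tested against $q$ in a space $Q$ the number $\dim Q$. *)

(* Defs.v *)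
From HB Require Import structures.
From mathcomp Require Import all_boot all_order all_algebra.
From mathcomp Require Import all_classical all_reals all_analysis.

Set Implicit Arguments.
Unset Strict Implicit.
Unset Printing Implicit Defensive.

Import Order.TTheory GRing.Theory Num.Theory.

Local Open Scope classical_set_scope.
Local Open Scope ring_scope.

Section LebesgueMeasureRn.
Variable R : realType.
Local Notation RR := (measurableTypeR R).

Definition tuple_cons n (z : RR * n.-tuple RR) : n.+1.-tuple RR :=
  [the n.+1.-tuple RR of z.1 :: z.2].

Lemma measurable_tuple_cons n : measurable_fun setT (@tuple_cons n).
Proof.
by apply: measurable_cons; [exact: measurable_fst|exact: measurable_snd].
Qed.

Section Step.
Variables (n : nat) (mu : {sigma_finite_measure set (n.-tuple RR) -> \bar R}).

Definition lebesgue_step : set (n.+1.-tuple RR) -> \bar R :=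
  pushforward (lebesgue_measure \x mu)%E (@tuple_cons n).

HB.instance Definition _ := Measure.copy lebesgue_step
  (measure_function_pushforward__canonical__measure_function_Measure
    (lebesgue_measure \x mu)%E (@measurable_tuple_cons n)).

Lemma sigma_finite_lebesgue_step : sigma_finite setT lebesgue_step.
Proof.
have /sigma_finiteP[F [FT ndF Foo]] :=
  sigma_finiteT (@lebesgue_measure R : {sigma_finite_measure set RR -> \bar R}).
have /sigma_finiteP[G [GT ndG Goo]] := sigma_finiteT mu.
pose h (t : n.+1.-tuple RR) : RR * n.-tuple RR :=
  (thead t, [tuple of behead t]).
have hK : cancel (@tuple_cons n) h.
  by move=> [x t]; congr pair; apply/val_inj.
have mh : measurable_fun setT h.
  apply/measurable_fun_pair => /=.
    exact: measurable_tnth.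
  exact: measurable_behead.
exists (fun i => h @^-1` (F i `*` G i)).
  rewrite -preimage_bigcup -(preimage_setT h); congr (_ @^-1` _).
  rewrite -setXTT FT GT predeqE => -[x y]; split.
    move=> [/= [i _ Fx] [j _ Gy]]; exists (maxn i j) => //; split.
    - by move: x Fx; exact/subsetPset/ndF/leq_maxl.
    - by move: y Gy; exact/subsetPset/ndG/leq_maxr.
  by move=> [i _ []/= ? ?]; split; exists i.
move=> i; have [mF Fi] := Foo i; have [mG Gi] := Goo i.
have mFG : measurable (F i `*` G i) by exact: measurableX.
split; first by rewrite -[X in measurable X]setTI; exact: mh.
rewrite /lebesgue_step /pushforward.
have -> : @tuple_cons n @^-1` (h @^-1` (F i `*` G i)) = F i `*` G i.
  by rewrite -comp_preimage (_ : h \o _ = id) //; apply/funext => z; exact: hK.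
by rewrite product_measure1E// lte_mul_pinfty// ge0_fin_numE.
Qed.

HB.instance Definition _ := Measure_isSigmaFinite.Build _ _ _ lebesgue_step
  sigma_finite_lebesgue_step.

End Step.

(* The n-fold product of the Lebesgue measure of the line, on n.-tuple R. *)
Fixpoint lebesgue_Rn n : {sigma_finite_measure set (n.-tuple RR) -> \bar R} :=
  if n is m.+1 return {sigma_finite_measure set (n.-tuple RR) -> \bar R}
  then lebesgue_step (lebesgue_Rn m)
  else \d_([tuple] : 0.-tuple RR).

Lemma lebesgue_Rn_box n (A : 'I_n -> set RR) :
  (forall i, measurable (A i)) ->
  lebesgue_Rn n [set t | forall i, A i (tnth t i)] =
  (\prod_(i < n) lebesgue_measure (A i))%E.
Proof.
elim: n A => [|n IH] A mA.
  rewrite big_ord0 /= diracE.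
  by rewrite mem_set// => -[].
rewrite big_ord_recl -IH// /= /lebesgue_step /pushforward /=.
rewrite -product_measure1E//.
  congr (_ _); apply/seteqP; split=> -[x t] /=.
    move=> H; split; first exact: (H ord0).
    by move=> i; have := H (lift ord0 i); rewrite tnthS.
  by case=> Hx Ht i; case: (unliftP ord0 i) => [j ->|->]; rewrite ?tnthS.
have -> : [set t : n.-tuple RR | forall i, A (lift ord0 i) (tnth t i)] =
    \bigcap_(i in [set: 'I_n]) ((fun t => tnth t i) @^-1` A (lift ord0 i)).
  by apply/seteqP; split=> t /= H i => [_|]; apply: H.
apply: fin_bigcap_measurable => // i _.
by rewrite -[X in measurable X]setTI; exact: measurable_tnth.
Qed.

Definition int_Rn n (D : set 'cV[R]_n) (f : 'cV[R]_n -> R) : R :=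
  let vec (t : n.-tuple RR) : 'cV[R]_n := \col_i tnth t i in
  Rintegral (lebesgue_Rn n) (vec @^-1` D) (f \o vec).

End LebesgueMeasureRn.

(* The notations of multinomials clash with those of mathcomp-analysis, and its
   module Measure shadows the one used above. *)
From mathcomp Require Import -(notations) mpoly.

Section PolynomialFields.
Variables (R : realType) (n : nat).
Implicit Types (m a b : nat) (x : 'cV[R]_n).

Definition mx_eval a b x (A : 'M[mpoly n R]_(a, b)) : 'M[R]_(a, b) :=
  map_mx (meval (fun i => x i 0)) A.

Definition mx_const a b (A : 'M[R]_(a, b)) : 'M[mpoly n R]_(a, b) :=
  map_mx (@mpolyC n R) A.

Definition coord_vec : 'cV[mpoly n R]_n := \col_i mpolyX R (mnm1 i).

Definition mx_div (A : 'M[mpoly n R]_n) : 'cV[mpoly n R]_n :=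
  \col_i \sum_j mderiv j (A i j).

(* msize p is the total degree plus one, and msize 0 = 0. *)
Definition Ppoly m : set (mpoly n R)^o := [set p | (msize p <= m.+1)%N].

Definition Pmx m a b : set 'M[mpoly n R]_(a, b) :=
  [set A | forall i j, Ppoly m (A i j)].

Definition Psym m : set 'M[mpoly n R]_n := [set A | Pmx m A /\ A^T = A].

Definition Hskew m : set 'M[mpoly n R]_n :=
  [set N : 'M[mpoly n R]_n |
     (forall i j, N i j \is ishomog1 m mdeg) /\ N^T = - N].

Definition NDspace m : set 'cV[mpoly n R]_n :=
  [set v | exists p N, [/\ Pmx m p, Hskew m N & v = p + N *m coord_vec]].

Definition RMspace : set 'cV[mpoly n R]_n :=
  [set v | exists (c : 'cV[R]_n) (N : 'M[R]_n),
    N^T = - N /\ v = mx_const c + mx_const N *m coord_vec].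

(* Dimension over R; V is a module over the polynomial ring only in order to
   cover scalar, vector and matrix fields at once.  The combinations have
   constant coefficients. *)
Definition has_dim (V : lmodType (mpoly n R)) (S : set V) (N : nat) : Prop :=
  exists b : 'I_N -> V,
    (forall c : 'I_N -> R,
       \sum_i mpolyC n (c i) *: b i = 0 -> forall i, c i = 0) /\
    (forall v, S v <-> exists c : 'I_N -> R, v = \sum_i mpolyC n (c i) *: b i).

(* A junk value when S is not a finite-dimensional subspace. *)
Definition poly_dim (V : lmodType (mpoly n R)) (S : set V) : nat :=
  get (has_dim S).

End PolynomialFields.

(* The Euclidean inner product of vectors, the Frobenius one of matrices. *)
Definition mxdot (R : realType) a b (A B : 'M[R]_(a, b)) : R := \tr (A^T *m B).

Section Simplex.
Variables (R : realType) (d : nat) (a : 'I_d.+1 -> 'cV[R]_d).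
Implicit Types (r : nat) (F : {set 'I_d.+1}).

Definition nondegenerate_simplex : Prop :=
  forall l : 'I_d.+1 -> R, \sum_i l i = 0 -> \sum_i l i *: a i = 0 ->
  forall i, l i = 0.

(* A face is given by the set F of its vertices. *)
Definition face_hull F : set 'cV[R]_d :=
  [set x | exists l : 'I_d.+1 -> R, [/\ forall i, 0 <= l i,
     \sum_(i in F) l i = 1 & x = \sum_(i in F) l i *: a i]].

Definition face_aff F : set 'cV[R]_d :=
  [set x | exists l : 'I_d.+1 -> R,
     \sum_(i in F) l i = 1 /\ x = \sum_(i in F) l i *: a i].

Definition face_tangent F : set 'cV[R]_d :=
  [set x | exists l : 'I_d.+1 -> R,
     \sum_(i in F) l i = 0 /\ x = \sum_(i in F) l i *: a i].

Definition simplex : set 'cV[R]_d := face_hull [set: 'I_d.+1]%SET.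

(* Faces of codimension r. *)
Definition is_face r F : bool := #|F| == (d - r).+1.

(* The columns of [normals] are n_1, ..., n_r; [origin] and the columns of
   [tangents] give Cartesian coordinates on the affine hull of the face. *)
Record face_frame r := FaceFrame {
  normals : 'M[R]_(d, r);
  origin : 'cV[R]_d;
  tangents : 'M[R]_(d, d - r) }.

Definition frame_point r (f : face_frame r) (xi : 'cV[R]_(d - r)) : 'cV[R]_d :=
  origin f + tangents f *m xi.

Definition frame_of r F (f : face_frame r) : Prop :=
  [/\ (normals f)^T *m normals f = 1%:M,
      forall v : 'cV[R]_d, (forall t, face_tangent F t -> v^T *m t = 0) <->
        exists c : 'cV[R]_r, v = normals f *m c,
      (tangents f)^T *m tangents f = 1%:M &
      forall x, face_aff F x <-> exists xi, x = frame_point f xi].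

(* The frame is an isometry, so this is the integral over F with respect to
   the surface measure; g takes a point of F and its coordinates. *)
Definition int_face r F (f : face_frame r)
    (g : 'cV[R]_d -> 'cV[R]_(d - r) -> R) : R :=
  int_Rn [set xi | face_hull F (frame_point f xi)]
    (fun xi => g (frame_point f xi) xi).

Definition ip_simplex b c (A B : 'M[mpoly d R]_(b, c)) : R :=
  int_Rn simplex (fun x => mxdot (mx_eval x A) (mx_eval x B)).

Definition L2_compl b c (U W : set 'M[mpoly d R]_(b, c)) :
    set 'M[mpoly d R]_(b, c) :=
  [set A | U A /\ forall B, W B -> ip_simplex A B = 0].

Definition ker_coord : set 'M[mpoly d R]_d :=
  [set A | A *m coord_vec R d = 0].

Definition proj_face (n v : 'cV[R]_d) : 'cV[R]_d := (1%:M - n *m n^T) *m v.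

(* A family of degrees of freedom on T: whether all of its members vanish at
   an element of T, and how many of them are counted. *)
Record dof_family (T : Type) := DofFamily {
  dof_vanish : T -> Prop;
  dof_count : nat }.

Definition unisolvent (V : set 'M[mpoly d R]_d)
    (L : seq (dof_family 'M[mpoly d R]_d)) : Prop :=
  (forall tau, V tau ->
     foldr (fun D P => dof_vanish D tau /\ P) True L -> tau = 0) /\
  (\sum_(D <- L) dof_count D)%N = poly_dim V.

Variables (k : nat) (fr : forall r, {set 'I_d.+1} -> face_frame r).

Definition dof_vertex := DofFamily
  (fun tau : 'M[mpoly d R]_d => forall i, mx_eval (a i) tau = 0)
  (\sum_(i < d.+1) (d * d.+1)./2)%N.

Definition dof_normal := DofFamily
  (fun tau : 'M[mpoly d R]_d =>
     forall r, (1 <= r <= d.-1)%N -> forall F, is_face r F ->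
     forall (i j : 'I_r) (q : mpoly (d - r) R),
       Ppoly (k + r - d - 1) q ->
       int_face F (fr r F) (fun x xi =>
         ((col i (normals (fr r F)))^T *m mx_eval x tau
            *m col j (normals (fr r F))) 0 0 * meval (fun l => xi l 0) q) = 0)
  (\sum_(1 <= r < d) \sum_(F | is_face r F)
     #|[pred ij : 'I_r * 'I_r | (ij.1 <= ij.2)%N]|
       * poly_dim (@Ppoly R (d - r) (k + r - d - 1)))%N.

Definition dof_tangential := DofFamily
  (fun tau : 'M[mpoly d R]_d =>
     forall F, is_face 1 F ->
     forall q : 'cV[mpoly (d - 1) R]_(d - 1), NDspace (k - 2) q ->
       int_face F (fr 1 F) (fun x xi =>
         let n := normals (fr 1 F) in
         mxdot (proj_face n (mx_eval x tau *m n))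
               (tangents (fr 1 F) *m mx_eval xi q)) = 0)
  (\sum_(F | is_face 1 F) poly_dim (@NDspace R (d - 1) (k - 2)))%N.

Definition dof_against b c (f : 'M[mpoly d R]_d -> 'M[mpoly d R]_(b, c))
    (Q : set 'M[mpoly d R]_(b, c)) := DofFamily
  (fun tau => forall q, Q q -> ip_simplex (f tau) q = 0) (poly_dim Q).

Definition dof_interior := dof_against id (@Psym R d (k - 2)).

Definition dof_div := dof_against (@mx_div R d)
  (L2_compl (@Pmx R d (k - 1) d 1) (@RMspace R d)).

Definition dof_ker := dof_against id (ker_coord `&` @Psym R d (k - 2)).

End Simplex.

(* Main.v *)
(** Let [l_i] be the barycentric coordinates, [g_i] their gradients and
    [t_ij = a_j - a_i].  Going up in the dimension of the faces, a normal-normal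
    component of [tau] on a face [F] vanishes on the boundary of [F], hence is
    [q] times the product of the [l_i] over [F], and testing (2) against [q]
    kills it.  On a facet, [v = Pi_F tau n] then satisfies
    [v . grad l_i = l_i psi_i]; since [sum_i l_i psi_i = 0], the field
    [q = sum_i psi_i grad l_i] lies in ND_{k-2}, and
    [v . q = sum_i l_i psi_i^2], so (3) gives [v = 0].  In the interior,
    [g_i^T tau g_j = l_i l_j psi_ij] for [i <> j], and (4) tested against
    [sum_ij psi_ij sym(g_i g_j^T)] gives [tau = 0].

    For the second set, [-2 tau = sum_ij (l_i l_j psi_ij) t_ij t_ij^T], so Green's
    formula without boundary term reduces to: the integral of the derivative of
    [l_i l_j p] along [t_ij] is zero, a consequence of the translation invariance
    of the Lebesgue measure.  Then (5) gives [div tau = 0], and (4) follows from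
    (6) because P_{k-2}(S) is the direct sum of the symmetric gradients of
    P_{k-1} and of the kernel of [q |-> q x].  That splitting also equates the
    number of degrees of freedom in (5) and (6) with that in (4); the remaining
    count is two Vandermonde convolutions. *)

From HB Require Import structures.
Require Import Defs.
From mathcomp Require Import all_boot all_order all_algebra.
From mathcomp Require Import all_classical all_reals all_analysis.
From mathcomp Require Import measurable_realfun ring lra zify.
From mathcomp Require Import -(notations) mpoly.

Set Implicit Arguments.
Unset Strict Implicit.
Unset Printing Implicit Defensive.

(** * Translation invariance of the Lebesgue measure *)

(** The degrees in (2) and (4) are those left after division: a face of codimension r has d - r + 1
    vertices, so taking its barycentric coordinates out of a polynomial of degree k leaves degree k
    + r - d - 1, and taking out l_i l_j leaves k - 2. The quotients thus supply admissible test
    fields, and every integrand becomes a sum of squares with nonnegative weights.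

    The expansion of -2 tau is what makes integration by parts elementary: only derivatives along
    edges occur, and along t_ij only l_i decreases and only l_j increases. A point can therefore
    leave or enter K through two facets alone, and l_i l_j vanishes on both.

    The splitting of P_{k-2}(S) comes from the Euler operator x . grad, which multiplies each
    homogeneous component by its degree. On homogeneous fields it turns the equation (symmetric
    gradient of u) x = q x into a linear system for u and u . x that is solved by hand. *)

Section Translation.
Import Order.TTheory GRing.Theory Num.Theory.
Local Open Scope classical_set_scope.
Local Open Scope ring_scope.
Variable R : realType.
Local Notation RR := (measurableTypeR R).

(** The pushforward under the translation agrees with the Lebesgue measure on half-open intervals,
    and these determine the measure. *)
Lemma lebesgue_measure_translate (c : R) (A : set RR) : measurable A ->
  lebesgue_measure ((fun x : RR => x + c : RR) @^-1` A) = lebesgue_measure A.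
Proof.
move=> mA.
have mf : measurable_fun setT (fun x : RR => x + c : RR).
  by apply: measurable_funD => //; exact: measurable_id.
pose mu := [the {measure set RR -> \bar R} of
  pushforward (@lebesgue_measure R) (fun x : RR => x + c : RR)].
rewrite [RHS](@lebesgue_measure_unique _ (mu mf))// => _ [[a b]] _ <-.
rewrite /mu/= /pushforward.
have -> : (fun x : RR => x + c : RR) @^-1` `]a, b] = `]a - c, b - c]%classic.
  by apply/seteqP; split=> x /=; rewrite !in_itv/=; lra.
rewrite !lebesgue_measure_itv/= !lte_fin ltrD2r.
by case: ifP => // _; rewrite -!EFinB; congr EFin; lra.
Qed.

Definition tuple_shift n (c : 'I_n -> R) (t : n.-tuple RR) : n.-tuple RR :=
  [tuple tnth t i + c i | i < n].

Lemma measurable_tuple_shift n (c : 'I_n -> R) :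
  measurable_fun setT (tuple_shift c).
Proof.
apply/measurable_fun_tnthP => i.
rewrite (_ : _ \o _ = (fun t : n.-tuple RR => tnth t i + c i : RR)); last first.
  by apply/funext => t /=; rewrite tnth_mktuple.
by apply: measurable_funD => //; exact: measurable_tnth.
Qed.

(** Through [tuple_cons] the shift is the product of a shift of the first coordinate and one of the
    tail; a measure with the right values on rectangles is the product measure. *)
Lemma lebesgue_Rn_translate n (c : 'I_n -> R) (A : set (n.-tuple RR)) :
  measurable A -> lebesgue_Rn R n (tuple_shift c @^-1` A) = lebesgue_Rn R n A.
Proof.
elim: n c A => [|n IH] c A mA.
  congr (lebesgue_Rn _ _ _); apply/seteqP.
  by split=> t; rewrite /= (tuple0 t) (tuple0 (tuple_shift _ _)).
rewrite /= /lebesgue_step /pushforward.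
pose sh (z : RR * n.-tuple RR) : RR * n.-tuple RR :=
  (z.1 + c ord0, tuple_shift (c \o lift ord0) z.2).
have msh : measurable_fun setT sh.
  apply/measurable_fun_pair => /=.
    by apply: measurable_funD => //; exact: measurable_fst.
  by apply: measurableT_comp; [exact: measurable_tuple_shift|exact: measurable_snd].
have shE z : tuple_shift c (tuple_cons z) = tuple_cons (sh z).
  apply: eq_from_tnth => i; rewrite tnth_mktuple.
  by case: (unliftP ord0 i) => [j ->|->]; rewrite ?tnthS ?tnth0 ?tnth_mktuple.
have -> : @tuple_cons R n @^-1` (tuple_shift c @^-1` A) =
    sh @^-1` (@tuple_cons R n @^-1` A).
  by apply/seteqP; split=> z; rewrite /preimage/= shE.
have mB : measurable (@tuple_cons R n @^-1` A).
  by rewrite -[X in measurable X]setTI; exact: measurable_tuple_cons.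
pose m' := [the {measure set (RR * n.-tuple RR) -> \bar R} of
  pushforward (lebesgue_measure \x lebesgue_Rn R n)%E sh].
have H := @product_measure_unique _ _ _ _ _ (@lebesgue_measure R)
  (lebesgue_Rn R n) (m' msh).
apply/esym/H => // X Y mX mY.
rewrite (_ : m' msh (X `*` Y) = (lebesgue_measure \x lebesgue_Rn R n)%E
   (sh @^-1` (X `*` Y)))//.
have -> : sh @^-1` (X `*` Y) = ((fun x : RR => x + c ord0 : RR) @^-1` X) `*`
   (tuple_shift (c \o lift ord0) @^-1` Y).
  by apply/seteqP; split=> -[x t].
rewrite product_measure1E//.
- congr (_ * _)%E; [exact: lebesgue_measure_translate|exact: IH].
- rewrite -[X in measurable X]setTI.
  have := @measurable_funD _ _ _ setT (fun x : RR => x) (fun=> c ord0).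
  by apply => //; exact: measurable_id.
- rewrite -[X in measurable X]setTI; exact: measurable_tuple_shift.
Qed.

End Translation.

(** * Integration of bounded measurable functions with bounded support *)

Section TameFunctions.
Import Order.TTheory GRing.Theory Num.Theory.
Local Open Scope classical_set_scope.
Local Open Scope ring_scope.
Variables (R : realType) (n : nat).
Local Notation RR := (measurableTypeR R).
Implicit Types (f g : 'cV[R]_n -> R) (D : set 'cV[R]_n).

Definition vec_of_tuple (t : n.-tuple RR) : 'cV[R]_n := \col_i tnth t i.

Definition box (c : 'cV[R]_n) (e : R) : set 'cV[R]_n :=
  [set x | forall i, `|x i 0 - c i 0| <= e].

(** The class in which integrals are added, compared and translated. A single [M] bounds both the
    values and the support, so each closure property has to produce one constant only. *)
Definition tame f : Prop :=
  measurable_fun setT (f \o vec_of_tuple : n.-tuple RR -> RR) /\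
  exists M, forall x, `|f x| <= M /\ (f x != 0 -> box 0 M x).

Definition tame_set D : Prop := tame (\1_D : 'cV[R]_n -> R).

Lemma box_measure (c : 'cV[R]_n) (e : R) : 0 < e ->
  measurable (vec_of_tuple @^-1` box c e) /\
  lebesgue_Rn R n (vec_of_tuple @^-1` box c e) = ((2 * e) ^+ n)%:E.
Proof.
move=> e0.
have E : vec_of_tuple @^-1` box c e =
   [set t | forall i, `[c i 0 - e, c i 0 + e]%classic (tnth t i)].
  apply/seteqP; split=> t /= H i; have := H i; rewrite ?mxE in_itv/= ler_norml;
  by move=> /andP[? ?]; apply/andP; split; lra.
split.
  have -> : vec_of_tuple @^-1` box c e = \bigcap_(i in [set: 'I_n])
     ((fun t : n.-tuple RR => tnth t i) @^-1` `[c i 0 - e, c i 0 + e]%classic).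
    by rewrite E; apply/seteqP; split=> t /= H i => [_|]; apply: H.
  apply: fin_bigcap_measurable => // i _.
  by rewrite -[X in measurable X]setTI; exact: measurable_tnth.
rewrite E (@lebesgue_Rn_box _ n (fun i => `[c i 0 - e, c i 0 + e]%classic))//.
rewrite (eq_bigr (fun=> (2 * e)%:E)) ?prodEFin ?prodr_const ?card_ord// => i _.
rewrite lebesgue_measure_itv/= lte_fin ifT; last by lra.
by rewrite -EFinB; congr EFin; lra.
Qed.

Lemma tame_integrable f : tame f ->
  (lebesgue_Rn R n).-integrable setT (EFin \o (f \o vec_of_tuple)).
Proof.
(* Adding 1 makes the dominating box nondegenerate, as [box_measure] requires. *)
move=> [mf [M HM]]; pose M' := `|M| + 1.
have M'0 : 0 < M' by rewrite /M'; have := normr_ge0 M; lra.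
have MM' : M <= M' by rewrite /M'; have := ler_norm M; lra.
have [mB muB] := box_measure 0 M'0.
set B := vec_of_tuple @^-1` _ in mB muB.
apply: (@le_integrable _ _ _ _ _ measurableT _ (fun t => (M' * \1_B t)%:E)) => //=.
- exact/measurable_EFinP.
- move=> t _ /=; rewrite lee_fin.
  have [H1 H2] := HM (vec_of_tuple t).
  have [->|/H2 Hb] := eqVneq (f (vec_of_tuple t)) 0.
    by rewrite normr0.
  rewrite indicE mem_set /= ?mulr1; first by have := ler_norm M'; lra.
  by move=> i; have := Hb i; lra.
- under eq_fun do rewrite EFinM.
  apply: integrableZl => //.
  apply/integrableP; split; first exact/measurable_EFinP/measurable_indic.
  under eq_integral => t _ do rewrite gee0_abs ?lee_fin//.
  rewrite integral_indic// setIT. exact: (eq_ind_r (fun u => (u < +oo)%E) (ltry _) muB).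
Qed.

Local Notation I := (int_Rn (@setT 'cV[R]_n)).

Lemma int_RnE f : I f = Rintegral (lebesgue_Rn R n) setT (f \o vec_of_tuple).
Proof. by rewrite /int_Rn preimage_setT. Qed.

Lemma int_Rn_mkcond D f : int_Rn D f = I (fun x => \1_D x * f x).
Proof.
rewrite int_RnE /int_Rn Rintegral_mkcond; apply: eq_Rintegral => t _.
rewrite /patch /= indicE.
have -> : (t \in ((fun t : n.-tuple RR => \col_i tnth t i) @^-1` D)) =
   (vec_of_tuple t \in D) by apply/idP/idP; rewrite !inE.
by case: ifP; rewrite ?mul1r ?mul0r.
Qed.

Lemma tameD f g : tame f -> tame g -> tame (fun x => f x + g x).
Proof.
move=> [mf [M HM]] [mg [N HN]]; split.
  by have := measurable_funD mf mg.
have M0 : 0 <= M by apply: le_trans (HM 0).1.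
have N0 : 0 <= N by apply: le_trans (HN 0).1.
exists (M + N) => x; have [A1 A2] := HM x; have [B1 B2] := HN x; split.
  by apply: le_trans (ler_normD _ _) _; lra.
move=> fg i; have [f0|/A2/(_ i)] := eqVneq (f x) 0; last by lra.
have [g0|/B2/(_ i)] := eqVneq (g x) 0; last by lra.
by move: fg; rewrite f0 g0 addr0 eqxx.
Qed.

(** Polynomials are unbounded on the whole space, so [g] is bounded only where [f] is nonzero. *)
Lemma tameM f g : tame f ->
  measurable_fun setT (g \o vec_of_tuple : n.-tuple RR -> RR) ->
  (exists M, forall x, f x != 0 -> `|g x| <= M) -> tame (fun x => f x * g x).
Proof.
move=> [mf [M HM]] mg [N HN]; split.
  by have := measurable_funM mf mg.
have M0 : 0 <= M by apply: le_trans (HM 0).1.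
exists (M + M * `|N|) => x; have [A1 A2] := HM x; split.
  have [->|/HN gN] := eqVneq (f x) 0.
    by rewrite mul0r normr0 addr_ge0// mulr_ge0.
  rewrite normrM -[leLHS]add0r lerD//.
  by apply: ler_pM => //; apply: le_trans gN (ler_norm _).
rewrite mulf_eq0 negb_or => /andP[/A2 Hb _] i; apply: le_trans (Hb i) _.
by rewrite lerDl mulr_ge0.
Qed.

Lemma tameZ c f : tame f -> tame (fun x => c * f x).
Proof.
move=> tf; under eq_fun do rewrite mulrC.
apply: tameM => //; last by exists `|c|.
by apply: measurable_cst.
Qed.

Lemma tame0 : tame (fun=> 0).
Proof.
split; first exact: measurable_cst.
by exists 0 => x; rewrite normr0 eqxx.
Qed.

Lemma tame_sum (J : finType) (F : J -> 'cV[R]_n -> R) :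
  (forall j, tame (F j)) -> tame (fun x => \sum_j F j x).
Proof.
move=> tF; elim: (index_enum J) => [|j s IH].
  by under eq_fun do rewrite big_nil; exact: tame0.
by under eq_fun do rewrite big_cons; exact: tameD.
Qed.

Definition translate (c : 'cV[R]_n) f : 'cV[R]_n -> R := fun x => f (x + c).

Lemma translateE (c : 'cV[R]_n) f :
  translate c f \o vec_of_tuple = (f \o vec_of_tuple) \o tuple_shift (c^~ 0).
Proof.
apply/funext => t /=; congr f; apply/matrixP => i j.
by rewrite !mxE tnth_mktuple (ord1 j).
Qed.

Lemma tame_translate (c : 'cV[R]_n) f : tame f -> tame (translate c f).
Proof.
move=> [mf [M HM]]; split.
  rewrite translateE; apply: measurableT_comp => //.
  exact: measurable_tuple_shift.
have M0 : 0 <= M by apply: le_trans (HM 0).1.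
exists (M + \sum_i `|c i 0|) => x; have [A1 A2] := HM (x + c).
have S i : `|c i 0| <= \sum_i `|c i 0|.
  by rewrite (bigD1 i)//= lerDl sumr_ge0.
split; first by apply: le_trans A1 _; rewrite lerDl sumr_ge0.
move=> /A2 /[swap] i /(_ i); rewrite !mxE => H; have := S i.
rewrite -[x i 0](addrK (c i 0)) => Si; rewrite addrAC.
apply: le_trans (ler_normB _ _) _; lra.
Qed.

(** Change of variables: the integral of the translate is an integral against the pushforward
    measure, which is the original one. *)
Lemma int_translate (c : 'cV[R]_n) f : tame f -> I (translate c f) = I f.
Proof.
move=> tf; rewrite !int_RnE translateE /Rintegral; congr fine.
have tif := tame_integrable (tame_translate c tf).
rewrite translateE in tif.
have mf : measurable_fun setT (EFin \o (f \o vec_of_tuple) : n.-tuple RR -> _).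
  by apply/measurable_EFinP; exact: tf.1.
have := @integral_pushforward _ _ _ _ R _ (measurable_tuple_shift (c^~ 0))
  (lebesgue_Rn R n) setT _ mf.
rewrite preimage_setT => /(_ tif measurableT) <-.
apply: (@eq_measure_integral _ _ R setT _
  (pushforward (lebesgue_Rn R n) (tuple_shift (c^~ 0)))) => [|mshift A mA _].
  exact: measurable_tuple_shift.
exact: lebesgue_Rn_translate.
Qed.

Lemma int_RnD f g : tame f -> tame g -> I (fun x => f x + g x) = I f + I g.
Proof.
move=> tf tg; rewrite !int_RnE.
by rewrite -RintegralD//; exact: tame_integrable.
Qed.

Lemma int_RnZ c f : tame f -> I (fun x => c * f x) = c * I f.
Proof.
move=> tf; rewrite !int_RnE.
by rewrite -RintegralZl//; exact: tame_integrable.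
Qed.

Lemma int_Rn_sum (J : finType) (F : J -> 'cV[R]_n -> R) :
  (forall j, tame (F j)) -> I (fun x => \sum_j F j x) = \sum_j I (F j).
Proof.
move=> tF; elim: (index_enum J) => [|j s IH].
  rewrite big_nil; under eq_fun do rewrite big_nil.
  by have := int_RnZ 0 tame0; under eq_fun do rewrite mul0r; rewrite mul0r.
rewrite big_cons -IH -int_RnD//; last first.
  elim: s {IH} => [|a s IH].
    by under eq_fun do rewrite big_nil; exact: tame0.
  by under eq_fun do rewrite big_cons; exact: tameD.
by congr (int_Rn _ _); apply/funext => x; rewrite big_cons.
Qed.

Lemma int_Rn_le f g : tame f -> tame g -> (forall x, f x <= g x) -> I f <= I g.
Proof.
by move=> tf tg fg; rewrite !int_RnE; apply: le_Rintegral => //;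
  exact: tame_integrable.
Qed.

Lemma tame_box c e : 0 < e -> tame_set (box c e).
Proof.
move=> e0; split.
  apply: measurable_indic; exact: (box_measure c e0).1.
exists (1 + \sum_i `|c i 0| + e) => x.
have S i : `|c i 0| <= \sum_i `|c i 0|.
  by rewrite (bigD1 i)//= lerDl sumr_ge0.
have S0 : 0 <= \sum_i `|c i 0| by rewrite sumr_ge0.
rewrite indicE; case: (boolP (x \in _)); rewrite ?normr0 ?normr1 ?eqxx.
  rewrite inE => xB; split; first by lra.
  move=> _ i; rewrite mxE subr0 -[x i 0](subrK (c i 0)).
  apply: le_trans (ler_normD _ _) _; have := S i; have := xB i; lra.
by move=> _; split => //; lra.
Qed.

Lemma int_box_gt0 c e : 0 < e -> 0 < I (\1_(box c e)).
Proof.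
move=> e0; rewrite int_RnE; have [mB muB] := box_measure c e0.
rewrite /Rintegral; have -> : (\int[lebesgue_Rn R n]_t
    ((\1_(box c e) \o vec_of_tuple) t)%:E =
    \int[lebesgue_Rn R n]_t (\1_(vec_of_tuple @^-1` box c e) t)%:E)%E by [].
rewrite integral_indic// setIT.
have -> : fine (lebesgue_Rn R n (vec_of_tuple @^-1` box c e)) = (2 * e) ^+ n.
  exact: (congr1 (@fine R) muB).
by rewrite exprn_gt0// mulr_gt0.
Qed.

End TameFunctions.

Local Notation ev x p := (meval (fun i => @fun_of_matrix _ _ 1 x i 0%R) p).
Local Notation mono i := (mpolyX _ (mnm1 i)).

(** * Polynomials and affine coordinates *)

Section Polynomials.
Import Order.TTheory GRing.Theory Num.Theory.
Local Open Scope ring_scope.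
Variable R : realType.
Implicit Types (n k N : nat).

Lemma mpoly_alg_ind n (P : mpoly n R -> Prop) :
  (forall c, P (mpolyC n c)) -> (forall i, P (mono i)) ->
  (forall p q, P p -> P q -> P (p + q)) ->
  (forall p q, P p -> P q -> P (p * q)) -> forall p, P p.
Proof.
move=> PC PX PD PM p; rewrite (mpolyE p).
apply: (big_ind P) => [|p' q'|m _]; [by rewrite -mpolyC0|exact: (PD)|].
rewrite -mul_mpolyC mpolyXE_id; apply: (PM) => //.
apply: (big_ind P) => [|p' q'|i _]; [by rewrite -mpolyC1|exact: (PM)|].
elim: (m i) => [|a IH]; first by rewrite expr0 -mpolyC1.
by rewrite exprS; exact: PM.
Qed.

Lemma mpoly_morph_eq n (S : comNzRingType) (f g : {rmorphism mpoly n R -> S}) :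
  (forall c, f (mpolyC n c) = g (mpolyC n c)) ->
  (forall i, f (mono i) = g (mono i)) -> f =1 g.
Proof.
move=> fgC fgX; elim/mpoly_alg_ind => // p q fgp fgq.
  by rewrite !rmorphD fgp fgq.
by rewrite !rmorphM fgp fgq.
Qed.

Lemma msizeM_leq n a b (p q : mpoly n R) :
  (msize p <= a.+1)%N -> (msize q <= b.+1)%N -> (msize (p * q) <= (a + b).+1)%N.
Proof.
have [->|p0] := eqVneq p 0; first by rewrite mul0r msize0.
have [->|q0] := eqVneq q 0; first by rewrite mulr0 msize0.
by rewrite msizeM//; move: (msize p) (msize q) => A B; lia.
Qed.

Lemma msizeD_leq n N (p q : mpoly n R) :
  (msize p <= N)%N -> (msize q <= N)%N -> (msize (p + q) <= N)%N.
Proof. by move=> pN qN; apply: leq_trans (msizeD_le p q) _; rewrite geq_max pN. Qed.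

Lemma msizeB_leq n N (p q : mpoly n R) :
  (msize p <= N)%N -> (msize q <= N)%N -> (msize (p - q) <= N)%N.
Proof. by move=> pN qN; apply: msizeD_leq; rewrite ?msizeN. Qed.

Lemma msize_sum_leq n N (J : Type) (r : seq J) (P : pred J) (F : J -> mpoly n R) :
  (forall j, P j -> (msize (F j) <= N)%N) -> (msize (\sum_(j <- r | P j) F j) <= N)%N.
Proof.
move=> FN; elim/big_ind : _ => //; first by rewrite msize0.
by move=> p q; exact: msizeD_leq.
Qed.

Lemma msize_coeffP n N (p : mpoly n R) :
  reflect (forall m, (N <= mdeg m)%N -> mcoeff m p = 0) (msize p <= N)%N.
Proof.
apply: (iffP idP) => [pN m Nm|H].
  by apply: memN_msupp_eq0; apply: msize_mdeg_ge; exact: leq_trans Nm.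
rewrite leqNgt; apply/negP => Np.
have p0 : p != 0 by apply: contraTneq Np => ->; rewrite msize0.
have := H (mlead p); rewrite -ltnS mlead_deg// => /(_ Np)/eqP.
by rewrite mleadc_eq0 (negbTE p0).
Qed.

Lemma msize_mderiv n N (i : 'I_n) (p : mpoly n R) :
  (msize p <= N.+1)%N -> (msize (mderiv i p) <= N)%N.
Proof.
move=> /msize_coeffP H; apply/msize_coeffP => m Nm.
by rewrite mcoeff_deriv H ?mul0rn// mdegD mdeg1 addn1.
Qed.

(** Both the projection onto a hyperplane ([slide]) and the restriction to a face ([frame_sub]) are
    substitutions of this kind. *)
Definition psub n k (h : 'I_n -> mpoly k R) : mpoly n R -> mpoly k R :=
  mmap (@mpolyC k R) h.

HB.instance Definition _ n k (h : 'I_n -> mpoly k R) :=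
  GRing.RMorphism.copy (psub h) (mmap (@mpolyC k R) h).

Lemma psubC n k (h : 'I_n -> mpoly k R) c : psub h (mpolyC n c) = mpolyC k c.
Proof. exact: mmapC. Qed.

Lemma psubX n k (h : 'I_n -> mpoly k R) i : psub h (mono i) = h i.
Proof. by rewrite /psub mmapX mmap1U. Qed.

Lemma psubZ n k (h : 'I_n -> mpoly k R) c p : psub h (c *: p) = c *: psub h p.
Proof. by rewrite -mul_mpolyC rmorphM /= psubC mul_mpolyC. Qed.

Lemma ev_psub n k (h : 'I_n -> mpoly k R) (x : 'cV[R]_k) p :
  ev x (psub h p) = meval (fun i => ev x (h i)) p.
Proof.
apply: (mpoly_morph_eq (f := meval (fun i => x i 0) \o psub h)) => [c|i] /=.
  by rewrite psubC !mevalC.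
by rewrite psubX mevalXU.
Qed.

Lemma msize_psub n k (h : 'I_n -> mpoly k R) (p : mpoly n R) :
  (forall i, msize (h i) <= 2)%N -> (msize (psub h p) <= msize p)%N.
Proof.
move=> h2; rewrite {1}(mpolyE p) rmorph_sum /= big_seq.
apply: msize_sum_leq => m /msize_mdeg_lt; apply: leq_trans.
rewrite psubZ; apply: leq_trans (msizeZ_le _ _) _.
rewrite mpolyXE_id rmorph_prod mdegE /=.
elim: (index_enum _) => [|i r IH]; first by rewrite !big_nil msize1.
rewrite !big_cons; apply: msizeM_leq => //; rewrite rmorphXn /= psubX.
elim: (m i) => [|a IHa]; first by rewrite expr0 msize1.
by rewrite exprS; have := msizeM_leq (h2 i) IHa; rewrite add1n.
Qed.

(** The restriction of a polynomial to t |-> x + t h, which reduces questions about zero sets to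
    univariate polynomials. *)
Definition line n (x h : 'cV[R]_n) : mpoly n R -> {poly R} :=
  mmap (@polyC R) (fun i => (x i 0)%:P + (h i 0) *: 'X).

HB.instance Definition _ n (x h : 'cV[R]_n) :=
  GRing.RMorphism.copy (line x h)
   (mmap (@polyC R) (fun i => (x i 0)%:P + (h i 0) *: 'X)).

Lemma lineC n (x h : 'cV[R]_n) c : line x h (mpolyC n c) = c%:P.
Proof. exact: mmapC. Qed.

Lemma lineX n (x h : 'cV[R]_n) i : line x h (mono i) = (x i 0)%:P + (h i 0) *: 'X.
Proof. by rewrite /line mmapX mmap1U. Qed.

Lemma horner_line n (x h : 'cV[R]_n) p t : (line x h p).[t] = ev (x + t *: h) p.
Proof.
apply: (mpoly_morph_eq (f := horner_eval t \o line x h)) => [c|i] /=.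
  by rewrite lineC /horner_eval hornerC mevalC.
by rewrite lineX /horner_eval !hornerE mevalXU !mxE mulrC.
Qed.

Lemma deriv_line n (x h : 'cV[R]_n) p :
  (line x h p)^`() = \sum_i (h i 0) *: line x h (mderiv i p).
Proof.
elim/mpoly_alg_ind : p => [c|i|p q IHp IHq|p q IHp IHq].
- rewrite lineC derivC big1// => i _; by rewrite mderivC rmorph0 scaler0.
- rewrite lineX derivD derivC add0r derivZ derivX (bigD1 i)//= big1 ?addr0.
    rewrite mderivX mnm1E eqxx scale1r (_ : mnm_sub _ _ = @mnm0 n).
      by rewrite mpolyX0 rmorph1.
    by apply/mnmP => j; rewrite mnmBE mnm0E subnn.
  by move=> j ji; rewrite mderivX mnm1E eq_sym (negbTE ji) scale0r rmorph0 scaler0.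
- rewrite rmorphD derivD /= IHp IHq -big_split; apply: eq_bigr => i _ /=.
  by rewrite mderivD rmorphD scalerDr.
- rewrite rmorphM derivM /= IHp IHq mulr_suml mulr_sumr -big_split.
  apply: eq_bigr => i _ /=.
  by rewrite mderivM rmorphD !rmorphM scalerDr /= scalerAl scalerAr.
Qed.

Lemma poly_eq0_near (p : {poly R}) (e : R) : 0 < e ->
  (forall t, 0 < t < e -> p.[t] = 0) -> p = 0.
Proof.
move=> e0 H; apply/eqP; apply: contraT => p0.
(* As many distinct roots as the size of [p]; starting the denominators at 2 keeps them strictly
   below [e]. *)
pose rs := [seq e / (i.+2)%:R | i <- iota 0 (size p)].
have : (size rs < size p)%N.
  apply: max_poly_roots => //.
    apply/allP => _ /mapP[i _ ->]; apply/rootP/H.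
    rewrite divr_gt0//= ltr_pdivrMr// ltr_pMr//.
    by rewrite -[1]/(1%:R) ltr_nat.
  rewrite map_inj_uniq ?iota_uniq// => i j.
  by move/(mulfI (lt0r_neq0 e0))/invr_inj/eqP; rewrite eqr_nat => /eqP[].
by rewrite size_map size_iota ltnn.
Qed.

(* A vanishing polynomial has vanishing derivatives, so by induction on the
   degree all its nonconstant coefficients are zero. *)
Lemma ev_eq0 n (p : mpoly n R) : (forall x : 'cV[R]_n, ev x p = 0) -> p = 0.
Proof.
have [N] := ubnP (msize p); elim: N p => // N IH p pN H.
have dp0 i : mderiv i p = 0.
  have [p0|p0] := eqVneq p 0; first by rewrite p0 mderiv0.
  apply: IH => [|x].
    have : (msize p <= N.-1.+1)%N.
      by move: pN p0; rewrite -msize_poly_eq0; case: (N) => //; lia.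
    move=> /(msize_mderiv i) => h; apply: leq_ltn_trans h _.
    by move: pN p0; rewrite -msize_poly_eq0; case: (N) => //; lia.
  have L0 : line x (delta_mx i 0) p = 0.
    by apply: (@poly_eq0_near _ 1) => // t _; rewrite horner_line.
  have := deriv_line x (delta_mx i 0) p.
  rewrite L0 linear0 (bigD1 i)//= big1 ?addr0 => [|j ji]; last first.
    by rewrite mxE (negbTE ji) scale0r.
  rewrite mxE !eqxx scale1r => /(congr1 (horner^~ 0)).
  by rewrite horner0 horner_line scale0r addr0.
have pC : p = mpolyC n (mcoeff (@mnm0 n) p).
  apply/mpolyP => m; rewrite mcoeffC.
  have [->|m0] := eqVneq m (@mnm0 n); first by rewrite mulr1.
  have /existsP[i mi] : [exists i, m i != 0%N].
    apply: contraNT m0; rewrite negb_exists => /forallP m0.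
    by apply/eqP/mnmP => i; rewrite mnm0E; have := m0 i; rewrite negbK => /eqP.
  have := mcoeff_deriv i (mnm_sub m (mnm1 i)) p.
  rewrite dp0 mcoeff0 submK ?lep1mP// => /esym/eqP.
  by rewrite mulrn_eq0 /= mulr0 => /eqP.
by have := H 0; rewrite pC mevalC => ->; rewrite mpolyC0.
Qed.

(** The line from the centre [c] to any point [x] stays in the box for small parameters, so the
    restriction of [p] to it is the zero polynomial; its value at 1 is the value of [p] at [x]. *)
Lemma ev_eq0_box n (p : mpoly n R) (c : 'cV[R]_n) (e : R) : 0 < e ->
  (forall x, box c e x -> ev x p = 0) -> p = 0.
Proof.
move=> e0 H; apply: ev_eq0 => x; pose M := 1 + \sum_i `|x i 0 - c i 0|.
have S i : `|x i 0 - c i 0| <= \sum_i `|x i 0 - c i 0|.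
  by rewrite (bigD1 i)//= lerDl sumr_ge0.
have M0 : 0 < M by rewrite /M ltr_pwDl// sumr_ge0.
have : line c (x - c) p = 0.
  apply: (@poly_eq0_near _ (e / M)); first by rewrite divr_gt0.
  move=> t /andP[t0 te]; rewrite horner_line; apply: H => i.
  rewrite !mxE.
  have -> : c i 0 + t * (x i 0 - c i 0) - c i 0 = t * (x i 0 - c i 0) by ring.
  rewrite normrM (gtr0_norm t0).
  apply: (@le_trans _ _ (t * M)); last by rewrite -ler_pdivlMr// ltW.
  by rewrite ler_pM2l// /M; apply: le_trans (S i) _; rewrite lerDr.
move=> /(congr1 (horner^~ 1)); rewrite horner_line horner0 scale1r.
by rewrite addrC subrK.
Qed.

Lemma ev_near n (p : mpoly n R) (c : 'cV[R]_n) (e : R) : 0 < e ->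
  exists2 r, 0 < r & forall x, box c r x -> `|ev x p - ev c p| < e.
Proof.
elim/mpoly_alg_ind : p e => [a|i|p q IHp IHq|p q IHp IHq] e e0.
- by exists 1 => // x _; rewrite !mevalC subrr normr0.
- exists (e / 2); first by rewrite divr_gt0.
  by move=> x /(_ i); rewrite !mevalXU; lra.
- have e2 : 0 < e / 2 by rewrite divr_gt0.
  have [r1 r10 H1] := IHp _ e2; have [r2 r20 H2] := IHq _ e2.
  exists (Num.min r1 r2); first by rewrite lt_min r10.
  move=> x xb; have := H1 x; have := H2 x; rewrite !mevalD.
  have h1 : box c r1 x by move=> i; have := xb i; rewrite le_min => /andP[].
  have h2 : box c r2 x by move=> i; have := xb i; rewrite le_min => /andP[].
  move=> /(_ h2) A /(_ h1) B.
  have -> : ev x p + ev x q - (ev c p + ev c q) =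
     (ev x p - ev c p) + (ev x q - ev c q) by ring.
  by apply: le_lt_trans (ler_normD _ _) _; lra.
- pose M := 1 + `|ev c p| + `|ev c q|.
  have M1 : 1 <= M by rewrite /M -addrA lerDl addr_ge0.
  (* The three terms of the product rule below are at most a, a |q(c)| and a |p(c)|, hence at most a
     M <= e / 2 together; the bound a <= 1 serves the quadratic one. *)
  pose a := Num.min 1 (e / (2 * M)).
  have M0 : 0 < M by lra.
  have a0 : 0 < a by rewrite lt_min ltr01 divr_gt0// mulr_gt0.
  have a1 : a <= 1 by rewrite ge_min lexx.
  have aM : a * M <= e / 2.
    rewrite -ler_pdivlMr//; apply: (@le_trans _ _ (e / (2 * M))).
      by rewrite ge_min lexx orbT.
    by rewrite invfM mulrA.
  have [r1 r10 H1] := IHp _ a0; have [r2 r20 H2] := IHq _ a0.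
  exists (Num.min r1 r2); first by rewrite lt_min r10.
  move=> x xb; have := H1 x; have := H2 x; rewrite !mevalM.
  have h1 : box c r1 x by move=> i; have := xb i; rewrite le_min => /andP[].
  have h2 : box c r2 x by move=> i; have := xb i; rewrite le_min => /andP[].
  move=> /(_ h2) A /(_ h1) B.
  have -> : ev x p * ev x q - ev c p * ev c q =
     (ev x p - ev c p) * (ev x q - ev c q) + (ev x p - ev c p) * ev c q
     + ev c p * (ev x q - ev c q) by ring.
  apply: le_lt_trans (ler_normD _ _) _.
  apply: le_lt_trans (lerD (ler_normD _ _) (lexx _)) _; rewrite !normrM.
  have X0 := normr_ge0 (ev x p - ev c p); have Y0 := normr_ge0 (ev x q - ev c q).
  have P0 := normr_ge0 (ev c p); have Q0 := normr_ge0 (ev c q).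
  move: A B X0 Y0 P0 Q0 aM; rewrite /M.
  move: `|ev x p - _| `|ev x q - _| `|ev c p| `|ev c q| => X Y P Q A B *.
  have h3 : X * Y <= a * 1 by apply: ler_pM => //; lra.
  have h4 : X * Q <= a * Q by apply: ler_wpM2r => //; lra.
  have h5 : P * Y <= P * a by apply: ler_wpM2l => //; lra.
  nra.
Qed.

End Polynomials.

(** * Affine forms and division by them *)

Section Affine.
Import Order.TTheory GRing.Theory Num.Theory.
Local Open Scope ring_scope.
Variable R : realType.
Implicit Types (n k N : nat).

(** Over an arbitrary commutative ring, since it pairs real vectors as well as polynomial vector
    fields. *)
Definition vdot (S : comNzRingType) n (u w : 'cV[S]_n) : S :=
  \sum_j u j 0 * w j 0.

Lemma vdotC (S : comNzRingType) n (u w : 'cV[S]_n) : vdot u w = vdot w u.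
Proof. by apply: eq_bigr => j _; rewrite mulrC. Qed.

Lemma vdotDr (S : comNzRingType) n (u w z : 'cV[S]_n) :
  vdot u (w + z) = vdot u w + vdot u z.
Proof. by rewrite -big_split; apply: eq_bigr => j _; rewrite !mxE mulrDr. Qed.

Lemma vdotZr (S : comNzRingType) n (u w : 'cV[S]_n) c :
  vdot u (c *: w) = c * vdot u w.
Proof. by rewrite mulr_sumr; apply: eq_bigr => j _; rewrite !mxE mulrCA. Qed.

Lemma vdot0r (S : comNzRingType) n (u : 'cV[S]_n) : vdot u 0 = 0.
Proof. by rewrite /vdot big1// => j _; rewrite mxE mulr0. Qed.

Lemma vdotNr (S : comNzRingType) n (u w : 'cV[S]_n) : vdot u (- w) = - vdot u w.
Proof. by rewrite -scaleN1r vdotZr mulN1r. Qed.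

Lemma vdot_sumr (S : comNzRingType) n (u : 'cV[S]_n) (J : Type) (r : seq J)
    (P : pred J) (F : J -> 'cV[S]_n) :
  vdot u (\sum_(j <- r | P j) F j) = \sum_(j <- r | P j) vdot u (F j).
Proof.
elim/big_rec2 : _ => [|j a b _ <-]; first by rewrite vdot0r.
by rewrite vdotDr.
Qed.

Definition aff n (c : R) (g : 'cV[R]_n) : mpoly n R :=
  mpolyC n c + \sum_j g j 0 *: mono j.

Lemma ev_aff n c (g x : 'cV[R]_n) : ev x (aff c g) = c + vdot g x.
Proof.
rewrite mevalD mevalC raddf_sum /=; congr (_ + _); apply: eq_bigr => j _.
by rewrite mevalZ mevalXU.
Qed.

Lemma ev_affD n c (g x h : 'cV[R]_n) :
  ev (x + h) (aff c g) = ev x (aff c g) + vdot g h.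
Proof. by rewrite !ev_aff vdotDr addrA. Qed.

Lemma msize_aff n c (g : 'cV[R]_n) : (msize (aff c g) <= 2)%N.
Proof.
apply: msizeD_leq; first by rewrite msizeC; case: (_ == _).
apply: msize_sum_leq => j _; apply: leq_trans (msizeZ_le _ _) _.
by rewrite msizeX mdeg1.
Qed.

Definition slide n (l : mpoly n R) (e : 'cV[R]_n) : mpoly n R -> mpoly n R :=
  psub (fun i => mono i - e i 0 *: l).

HB.instance Definition _ n (l : mpoly n R) (e : 'cV[R]_n) :=
  GRing.RMorphism.copy (slide l e) (psub (fun i => mono i - e i 0 *: l)).

Lemma ev_slide n (l : mpoly n R) (e x : 'cV[R]_n) p :
  ev x (slide l e p) = ev (x - ev x l *: e) p.
Proof.
rewrite ev_psub; apply: meval_eq => i /=.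
by rewrite mevalB mevalZ mevalXU !mxE mulrC.
Qed.

(* [slide l e p] is [p] composed with the projection [x |-> x - l(x) e], which
   fixes the hyperplane [l = 0] pointwise. *)
Lemma slide_div n (l : mpoly n R) (e : 'cV[R]_n) p : (msize l <= 2)%N ->
  exists q, p - slide l e p = l * q /\ (msize q <= (msize p).-1)%N.
Proof.
move=> l2.
have h2 i : (msize (mono i - e i 0 *: l)%R <= 2)%N.
  apply: msizeB_leq; first by rewrite msizeX mdeg1.
  exact: leq_trans (msizeZ_le _ _) _.
have monoP m : exists q, mpolyX R m - slide l e (mpolyX R m) = l * q /\
    (msize q <= mdeg m)%N.
  have [N] := ubnP (mdeg m); elim: N m => // N IH m mN.
  have [m0|m0] := eqVneq m (@mnm0 n).
    by exists 0; rewrite m0 mpolyX0 rmorph1 subrr mulr0 msize0.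
  have /existsP[i mi] : [exists i, m i != 0%N].
    apply: contraNT m0; rewrite negb_exists => /forallP m0.
    by apply/eqP/mnmP => i; rewrite mnm0E; have := m0 i; rewrite negbK => /eqP.
  have mE : m = mnm_add (mnm_sub m (mnm1 i)) (mnm1 i) by rewrite submK ?lep1mP.
  set m' := mnm_sub _ _ in mE.
  have dm : mdeg m = (mdeg m').+1 by rewrite mE mdegD mdeg1 addn1.
  have [|q [qE qs]] := IH m'; first by rewrite -ltnS -dm.
  (* Writing s for [slide l e], x_i m' - s(x_i) s(m') = x_i (m' - s(m')) + e_i l s(m'), because
     s(x_i) = x_i - e_i l. *)
  exists (mono i * q + e i 0 *: slide l e (mpolyX R m')); split.
    rewrite mE mpolyXD rmorphM /= [in X in _ - _ * X]/slide psubX.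
    rewrite -mul_mpolyC in qE *; rewrite -mul_mpolyC.
    have -> : mpolyX R m' = l * q + slide l e (mpolyX R m') by rewrite -qE subrK.
    rewrite !rmorphD /=.
    set z := slide l e (mpolyX R m').
    have -> : slide l e (l * q) + slide l e z = z.
      by rewrite -rmorphD /= /z -qE subrK.
    ring.
  rewrite dm; apply: msizeD_leq.
    have [->|q0] := eqVneq q 0; first by rewrite mulr0 msize0.
    have : (msize q <= (mdeg m').-1.+1)%N.
      by move: qs q0; rewrite -msize_poly_eq0; case: (mdeg m') => //; lia.
    have X2 : (msize (mono i : mpoly n R) <= 2)%N by rewrite msizeX mdeg1.
    move=> /(msizeM_leq X2); move/leq_trans; apply.
    by move: qs q0; rewrite -msize_poly_eq0; case: (mdeg m') => //; lia.
  apply: leq_trans (msizeZ_le _ _) _; apply: leq_trans (msize_psub _ h2) _.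
  by rewrite msizeX.
have [F HF] := choice monoP.
exists (\sum_(m <- msupp p) mcoeff m p *: F m); split.
  rewrite [in LHS](mpolyE p) rmorph_sum /= -sumrB mulr_sumr.
  apply: eq_bigr => m _.
  by rewrite /slide psubZ -scalerBr (HF m).1 scalerAr.
rewrite big_seq; apply: msize_sum_leq => m /msize_mdeg_lt mp.
apply: leq_trans (msizeZ_le _ _) _; apply: leq_trans (HF m).2 _.
by rewrite -ltnS prednK//; apply: leq_ltn_trans mp.
Qed.

(** Since [vdot g e = 1], the projection behind [slide] takes its values in the hyperplane where [p]
    vanishes. So the slide of [p] is zero, and [slide_div] exhibits [p] itself as a multiple. *)
Lemma vanish_div n N c (g e : 'cV[R]_n) (p : mpoly n R) :
  vdot g e = 1 -> (forall x : 'cV[R]_n, ev x (aff c g) = 0 -> ev x p = 0) ->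
  (msize p <= N.+1)%N -> exists q, p = aff c g * q /\ (msize q <= N)%N.
Proof.
move=> ge H pN; have [q [qE qs]] := slide_div e p (msize_aff c g).
exists q; split; last by apply: leq_trans qs _; move: (msize p) pN => P; lia.
rewrite -qE (_ : slide _ _ _ = 0) ?subr0//.
apply: ev_eq0 => x; rewrite ev_slide; apply: H.
by rewrite ev_affD -scaleNr vdotZr ge mulr1 subrr.
Qed.

End Affine.

Section Barycentric.
Import Order.TTheory GRing.Theory Num.Theory.
Local Open Scope ring_scope.
Local Open Scope classical_set_scope.
Variables (R : realType) (n : nat) (I : finType).

(* [aff (c i) (g i)], for [i \in F], are the barycentric coordinates with
   respect to the affine basis [v i]. *)
Record barycentric (F : {set I}) (c : I -> R) (g v : I -> 'cV[R]_n) : Prop :=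
  Barycentric {
    bary_sum : \sum_(i in F) aff (c i) (g i) = 1;
    bary_delta : forall i j, i \in F -> j \in F ->
      ev (v j) (aff (c i) (g i)) = (i == j)%:R;
    bary_point : forall x : 'cV[R]_n, x = \sum_(i in F) ev x (aff (c i) (g i)) *: v i }.

Definition bary_simplex (F : {set I}) (c : I -> R) (g : I -> 'cV[R]_n) :
    set 'cV[R]_n :=
  [set x | forall i, i \in F -> 0 <= ev x (aff (c i) (g i))].

Variables (F : {set I}) (c : I -> R) (g v : I -> 'cV[R]_n).
Hypothesis bF : barycentric F c g v.
Local Notation l i := (aff (c i) (g i)).
Local Notation D := (bary_simplex F c g).

Lemma bary_grad i j k : i \in F -> j \in F -> k \in F ->
  vdot (g i) (v j - v k) = (i == j)%:R - (i == k)%:R.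
Proof.
move=> iF jF kF; rewrite -!(bary_delta bF)//.
have := ev_affD (c i) (g i) (v k) (v j - v k).
by rewrite addrC subrK => ->; rewrite [RHS]addrC addKr.
Qed.

Lemma bary_dir i : (1 < #|F|)%N -> i \in F -> exists e, vdot (g i) e = 1.
Proof.
move=> F1 iF; have /card_gt0P[j] : (0 < #|F :\ i|)%N.
  by move: F1; rewrite (cardsD1 i) iF; case: #|F :\ i|.
rewrite !inE => /andP[ji jF]; exists (v i - v j).
by rewrite bary_grad// eqxx eq_sym (negbTE ji) subr0.
Qed.

Lemma bary_coord_uniq (m : I -> R) j : \sum_(i in F) m i = 1 -> j \in F ->
  ev (\sum_(i in F) m i *: v i) (l j) = m j.
Proof.
move=> m1 jF; rewrite ev_aff vdot_sumr.
have cj : c j = \sum_(i in F) c j * m i by rewrite -mulr_sumr m1 mulr1.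
rewrite [X in X + _]cj -big_split /= (eq_bigr (fun i => m i * (j == i)%:R)).
  rewrite (bigD1 j)//= eqxx mulr1 big1 ?addr0// => i /andP[_ /negbTE ij].
  by rewrite eq_sym ij mulr0.
by move=> i iF; rewrite -(bary_delta bF jF iF) ev_aff vdotZr; ring.
Qed.

Lemma bary_vdot_vertex i j : i \in F -> j \in F ->
  vdot (g i) (v j) = (i == j)%:R - c i.
Proof. by move=> iF jF; rewrite -(bary_delta bF)// ev_aff addrC addKr. Qed.

Lemma bary_neq0 i : i \in F -> l i != 0.
Proof.
move=> iF; apply: contraTneq (oner_neq0 R) => l0.
by have := bary_delta bF iF iF; rewrite l0 meval0 eqxx => /esym/eqP ->.
Qed.

(** Compare the coefficients of degree one in [bary_sum]. *)
Lemma bary_sum_grad : \sum_(i in F) g i = 0.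
Proof.
apply/matrixP => j j0; rewrite (ord1 j0) summxE mxE.
have := congr1 (mcoeff (mnm1 j)) (bary_sum bF).
rewrite raddf_sum /= mcoeff1 mnm1_eq0 => H0.
rewrite [RHS](_ : _ = false%:R)// -H0; apply: eq_bigr => i _.
rewrite mcoeffD mcoeffC mnm1_eq0 mulr0 add0r raddf_sum (bigD1 j)//= big1 => [|k kj].
  by rewrite mcoeffZ mcoeffXU eqxx mulr1 addr0.
by rewrite mcoeffZ mcoeffXU (negbTE kj) mulr0.
Qed.

(** Subtract [bary_point] at 0 from [bary_point] at [h]. *)
Lemma bary_vec h : h = \sum_(i in F) vdot (g i) h *: v i.
Proof.
transitivity (h - 0); first by rewrite subr0.
rewrite [in LHS](bary_point bF h) [X in _ - X](bary_point bF 0) -sumrB.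
by apply: eq_bigr => i _; rewrite !ev_aff vdot0r -scalerBl addr0 addrC addKr.
Qed.

(** The factors are divided out one by one. After division by l_i, the quotient must still vanish
    where l_j = 0: [slide] along l_j is a ring morphism into an integral domain, and it does not
    kill l_i, whose slide takes the value 1 at the vertex [v i]. *)
Lemma bary_prod_div (r : seq I) N (p : mpoly n R) : uniq r ->
  {subset r <= F} -> (1 < #|F|)%N ->
  (forall i (x : 'cV[R]_n), i \in r -> ev x (l i) = 0 -> ev x p = 0) ->
  (msize p <= N + size r)%N ->
  exists q, p = \prod_(i <- r) l i * q /\ (msize q <= N)%N.
Proof.
move=> + + F1; elim: r p => [|i r IH] p /=.
  by rewrite addn0 => _ _ _ pN; exists p; rewrite big_nil mul1r.
move=> /andP[ir ur] irF H; rewrite addnS => pN.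
have iF : i \in F by apply: irF; rewrite mem_head.
have [e ge] := bary_dir F1 iF.
have pi0 (x : 'cV[R]_n) : ev x (l i) = 0 -> ev x p = 0.
  by apply: H; rewrite mem_head.
have [q [pq qs]] := vanish_div ge pi0 pN.
have rF : {subset r <= F} by move=> j jr; apply: irF; rewrite inE jr orbT.
have qr j (x : 'cV[R]_n) : j \in r -> ev x (l j) = 0 -> ev x q = 0.
  move=> jr lx.
  have jF := rF j jr.
  have [e' ge'] := bary_dir F1 jF.
  have sp0 : slide (l j) e' p = 0.
    apply: ev_eq0 => y; rewrite ev_slide (H j)//.
      by rewrite inE jr orbT.
    by rewrite ev_affD -scaleNr vdotZr ge' mulr1 subrr.
  have : slide (l j) e' q = 0.
    apply/eqP; move: sp0; rewrite pq rmorphM /= => /eqP; rewrite mulf_eq0.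
    case/orP => // /eqP /(congr1 (meval (fun k => v i k 0))).
    rewrite ev_slide meval0 (bary_delta bF)// (_ : (j == i) = false).
      rewrite scale0r subr0 (bary_delta bF)// eqxx => /eqP.
      by rewrite oner_eq0.
    by apply: contraNF ir => /eqP <-.
  move=> /(congr1 (meval (fun k => x k 0))).
  by rewrite ev_slide lx scale0r subr0 meval0.
have [q' [qE q's]] := IH q ur rF qr qs.
by exists q'; rewrite big_cons -mulrA -qE.
Qed.

End Barycentric.

(** * Integration of polynomials over a simplex *)

Section SimplexIntegral.
Import Order.TTheory GRing.Theory Num.Theory.
Local Open Scope ring_scope.
Local Open Scope classical_set_scope.
Variables (R : realType) (n : nat).
Local Notation RR := (measurableTypeR R).

Lemma measurable_ev (p : mpoly n R) :
  measurable_fun setT ((fun x : 'cV[R]_n => ev x p) \o @vec_of_tuple R n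
    : n.-tuple RR -> RR).
Proof.
elim/mpoly_alg_ind : p => [a|i|p q mp mq|p q mp mq].
- rewrite (_ : _ \o _ = fun=> a); first exact: measurable_cst.
  by apply/funext => t /=; rewrite mevalC.
- rewrite (_ : _ \o _ = (fun t : n.-tuple RR => tnth t i)); first exact: measurable_tnth.
  by apply/funext => t /=; rewrite mevalXU mxE.
- rewrite (_ : _ \o _ = ((fun x => ev x p) \o @vec_of_tuple R n)
    \+ ((fun x => ev x q) \o @vec_of_tuple R n)).
    exact: measurable_funD.
  by apply/funext => t /=; rewrite mevalD.
- rewrite (_ : _ \o _ = ((fun x => ev x p) \o @vec_of_tuple R n)
    \* ((fun x => ev x q) \o @vec_of_tuple R n)).
    exact: measurable_funM.
  by apply/funext => t /=; rewrite mevalM.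
Qed.

Lemma ev_bounded (p : mpoly n R) (M : R) :
  exists2 B, 0 < B & forall x : 'cV[R]_n, box 0 M x -> `|ev x p| <= B.
Proof.
elim/mpoly_alg_ind : p => [a|i|p q [B B0 HB] [C C0 HC]|p q [B B0 HB] [C C0 HC]].
- by exists (1 + `|a|) => [|x _]; rewrite ?mevalC ?ltr_pwDl// lerDr.
- exists (1 + `|M|) => [|x /(_ i)]; first by rewrite ltr_pwDl.
  rewrite mevalXU mxE subr0 => /le_trans; apply.
  by apply: le_trans (ler_norm M) _; rewrite lerDr.
- exists (B + C) => [|x xM]; first exact: addr_gt0.
  by rewrite mevalD; apply: le_trans (ler_normD _ _) _; rewrite lerD ?HB ?HC.
- exists (B * C) => [|x xM]; first exact: mulr_gt0.
  by rewrite mevalM normrM; apply: ler_pM => //; [exact: HB|exact: HC].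
Qed.

Lemma box_le (c : 'cV[R]_n) (e e' : R) x : e <= e' -> box c e x -> box c e' x.
Proof. by move=> ee H i; apply: le_trans (H i) ee. Qed.

Definition ddir (t : 'cV[R]_n) (p : mpoly n R) : mpoly n R :=
  \sum_i t i 0 *: mderiv i p.

Lemma ddirM t p q : ddir t (p * q) = ddir t p * q + p * ddir t q.
Proof.
rewrite /ddir mulr_suml mulr_sumr -big_split; apply: eq_bigr => i _ /=.
by rewrite mderivM scalerDr scalerAl scalerAr.
Qed.

Lemma taylor_bound (t : 'cV[R]_n) (M : R) (p : mpoly n R) :
  exists2 C, 0 < C & forall x s, box 0 M x -> `|s| <= 1 ->
    `|ev (x + s *: t) p - ev x p - s * ev x (ddir t p)| <= C * s ^+ 2.
Proof.
elim/mpoly_alg_ind : p => [a|i|p q [B B0 HB] [C C0 HC]|p q [B B0 HB] [C C0 HC]].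
- exists 1 => // x s _ _; rewrite !mevalC (_ : ddir _ _ = 0).
    by rewrite meval0 mulr0 subr0 subrr normr0 mul1r sqr_ge0.
  by rewrite /ddir big1// => i _; rewrite mderivC scaler0.
- exists 1 => // x s _ _; rewrite !mevalXU /ddir raddf_sum (bigD1 i)//= big1.
    rewrite mevalZ mderivX mnm1E eqxx scale1r (_ : mnm_sub _ _ = @mnm0 n); last first.
      by apply/mnmP => j; rewrite mnmBE mnm0E subnn.
    rewrite mpolyX0 meval1 !mxE addr0 mulr1.
    rewrite (_ : _ - _ = 0) ?normr0 ?mul1r ?sqr_ge0//; ring.
  by move=> j ji; rewrite mevalZ mderivX mnm1E eq_sym (negbTE ji) scale0r meval0 mulr0.
- exists (B + C) => [|x s xM s1]; first exact: addr_gt0.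
  rewrite !mevalD (_ : ddir t (p + q) = ddir t p + ddir t q); last first.
    by rewrite -big_split; apply: eq_bigr => i _; rewrite mderivD scalerDr.
  rewrite mevalD mulrDl; apply: le_trans (lerD (HB x s xM s1) (HC x s xM s1)).
  apply: le_trans (ler_normD _ _); rewrite le_eqVlt; apply/orP; left; apply/eqP.
  by congr `|_|; ring.
(* The larger box contains x + s t for all |s| <= 1, so that the shifted factor [q1] is bounded as
   well. *)
- pose M' := `|M| + \sum_i `|t i 0|.
  have inb x s : box 0 M x -> `|s| <= 1 -> box 0 M' (x + s *: t).
    move=> xM s1 i; rewrite !mxE subr0; apply: le_trans (ler_normD _ _) _.
    have := xM i; rewrite mxE subr0 => xi.
    have S : `|t i 0| <= \sum_i `|t i 0| by rewrite (bigD1 i)//= lerDl sumr_ge0.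
    rewrite /M' lerD//; first exact: le_trans xi (ler_norm _).
    by rewrite normrM; apply: le_trans S; rewrite ler_piMl.
  have [Q Q0 HQ] := ev_bounded q M'.
  have [P P0 HP] := ev_bounded p M.
  have [P' P'0 HP'] := ev_bounded (ddir t p) M.
  have [Q' Q'0 HQ'] := ev_bounded (ddir t q) M.
  exists (B * Q + P * C + P' * C + P' * Q').
    by rewrite !addr_gt0// mulr_gt0.
  move=> x s xM s1; have := HB x s xM s1; have := HC x s xM s1.
  have := HQ _ (inb x s xM s1); have := HP x xM; have := HP' x xM; have := HQ' x xM.
  rewrite ddirM mevalD !mevalM.
  set q1 := ev (x + _) q; set p1 := ev (x + _) p.
  move: q1 p1 (ev x p) (ev x q) (ev x (ddir t p)) (ev x (ddir t q)).
  move=> q1 p1 p0 q0 p' q' hq' hp' hp hq hc hb.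
  have -> : p1 * q1 - p0 * q0 - s * (p' * q0 + p0 * q') =
    (p1 - p0 - s * p') * q1 + p0 * (q1 - q0 - s * q') +
    (s * p' * (q1 - q0 - s * q') + s ^+ 2 * (p' * q')) by ring.
  have s20 : 0 <= s ^+ 2 := sqr_ge0 s.
  have h1 : `|(p1 - p0 - s * p') * q1| <= (B * s ^+ 2) * Q.
    by rewrite normrM; apply: ler_pM.
  have h2 : `|p0 * (q1 - q0 - s * q')| <= P * (C * s ^+ 2).
    by rewrite normrM; apply: ler_pM.
  have h3 : `|s * p' * (q1 - q0 - s * q')| <= 1 * P' * (C * s ^+ 2).
    by rewrite !normrM; apply: ler_pM => //; apply: ler_pM.
  have h4 : `|s ^+ 2 * (p' * q')| <= s ^+ 2 * (P' * Q').
    by rewrite normrM (ger0_norm s20) normrM; apply: ler_wpM2l => //; apply: ler_pM.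
  apply: le_trans (ler_normD _ _) _.
  apply: le_trans (lerD (ler_normD _ _) (ler_normD _ _)) _; lra.
Qed.

Variable I : finType.
Variables (F : {set I}) (c : I -> R) (g v : I -> 'cV[R]_n).
Hypothesis bF : barycentric F c g v.
Local Notation l i := (aff (c i) (g i)).
Local Notation D := (bary_simplex F c g).

Lemma ev_bary_sum x : \sum_(i in F) ev x (l i) = 1.
Proof. by rewrite -raddf_sum /= (bary_sum bF) meval1. Qed.

Lemma bary_le1 i x : i \in F -> D x -> ev x (l i) <= 1.
Proof.
move=> iF Dx; rewrite -(ev_bary_sum x) (bigD1 i)//= lerDl sumr_ge0// => j /andP[jF _].
exact: Dx.
Qed.

(** A point is the combination of the vertices with coefficients in [0, 1]. *)
Lemma bary_simplex_bounded : exists2 M, 0 < M & D `<=` box 0 M.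
Proof.
exists (1 + \sum_(i in F) \sum_j `|v i j 0|).
  by rewrite ltr_pwDl// sumr_ge0// => i _; rewrite sumr_ge0.
move=> x Dx j; rewrite mxE subr0 (bary_point bF x) summxE.
apply: le_trans (ler_norm_sum _ _ _) _.
rewrite -[leLHS]add0r lerD//; apply: ler_sum => i iF.
rewrite mxE normrM ger0_norm; last exact: Dx.
rewrite -[leRHS]mul1r; apply: ler_pM => //; first exact: Dx.
  exact: bary_le1.
by rewrite (bigD1 j)//= lerDl sumr_ge0.
Qed.

Lemma tame_half (p : mpoly n R) (A : set 'cV[R]_n) : tame_set A ->
  tame_set (A `&` [set x | 0 <= ev x p]).
Proof.
move=> tA; rewrite /tame_set.
have -> : \1_(A `&` [set x | 0 <= ev x p]) =
    (fun x => \1_A x * \1_[set x | 0 <= ev x p] x) :> ('cV[R]_n -> R).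
  by apply/funext => x; rewrite indicI.
apply: tameM => //.
  apply: measurable_indic.
  suff: measurable (@vec_of_tuple R n @^-1` [set x | 0 <= ev x p]) by [].
  have -> : @vec_of_tuple R n @^-1` [set x | 0 <= ev x p] =
     ((fun x => ev x p) \o @vec_of_tuple R n) @^-1` `[0, +oo[%classic.
    by apply/seteqP; split=> t /=; rewrite in_itv/= andbT.
  by rewrite -[X in measurable X]setTI; apply: measurable_ev.
exists 1 => x _; rewrite indicE; case: (_ \in _); rewrite ?normr1 ?normr0//.
Qed.

Lemma tame_simplex : tame_set D.
Proof.
have [M M0 HM] := bary_simplex_bounded.
(* The half-spaces alone are unbounded; with the box put first, every partial intersection of the
   induction is tame. *)
have -> : D = box 0 M `&` [set x | forall i, i \in enum F -> 0 <= ev x (l i)].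
  apply/seteqP; split=> x.
    by move=> Dx; split => [|i]; [exact: HM|rewrite mem_enum; exact: Dx].
  by move=> [_ H] i iF; apply: H; rewrite mem_enum.
elim: (enum F) => [|i s IH].
  rewrite (_ : _ `&` _ = box 0 M); first exact: tame_box.
  by apply/seteqP; split=> x // [].
rewrite (_ : _ `&` _ = (box 0 M `&` [set x | forall i, i \in s -> 0 <= ev x (l i)])
   `&` [set x | 0 <= ev x (l i)]); first exact: tame_half.
apply/seteqP; split=> x.
  move=> [bx H]; split; last by apply: H; rewrite mem_head.
  by split => // j js; apply: H; rewrite inE js orbT.
move=> [[bx H] H'] ; split => // j; rewrite inE => /orP[/eqP -> //|]; exact: H.
Qed.

Lemma tame_set_ev (A : set 'cV[R]_n) (p : mpoly n R) : A `<=` D -> tame_set A ->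
  tame (fun x => \1_A x * ev x p).
Proof.
move=> AD tA; apply: tameM => //; first exact: measurable_ev.
have [M M0 HM] := bary_simplex_bounded; have [B B0 HB] := ev_bounded p M.
exists B => x; rewrite indicE; case: (boolP (x \in A)); rewrite ?eqxx//.
by rewrite inE => /AD /HM /HB.
Qed.

Definition poly_int (A : set 'cV[R]_n) (p : mpoly n R) : R :=
  int_Rn A (fun x => ev x p).

Lemma poly_intE A p :
  poly_int A p = int_Rn setT (fun x => \1_A x * ev x p).
Proof. exact: int_Rn_mkcond. Qed.

Lemma tame_ev p : tame (fun x => \1_D x * ev x p).
Proof. exact: tame_set_ev tame_simplex. Qed.

Lemma poly_intD p q : poly_int D (p + q) = poly_int D p + poly_int D q.
Proof.
rewrite !poly_intE -int_RnD; [|exact: tame_ev..].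
by congr int_Rn; apply/funext => x; rewrite mevalD mulrDr.
Qed.

Lemma poly_intZ a p : poly_int D (a *: p) = a * poly_int D p.
Proof.
rewrite !poly_intE -int_RnZ; last exact: tame_ev.
by congr int_Rn; apply/funext => x; rewrite mevalZ mulrCA.
Qed.

Lemma poly_int0 : poly_int D 0 = 0.
Proof. by rewrite -[X in poly_int _ X](scale0r 0) poly_intZ mul0r. Qed.

Lemma poly_int_sum (J : Type) (r : seq J) (P : pred J) (f : J -> mpoly n R) :
  poly_int D (\sum_(j <- r | P j) f j) = \sum_(j <- r | P j) poly_int D (f j).
Proof.
elim/big_rec2 : _ => [|j a b _ <-]; first exact: poly_int0.
by rewrite poly_intD.
Qed.

(** At the barycentre all coordinates equal the positive number 1 / #|F|, so they stay nonnegative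
    nearby. *)
Lemma bary_interior : exists x r, 0 < r /\ box x r `<=` D.
Proof.
have F0 : (0 < #|F|)%N.
  rewrite lt0n cards_eq0; apply/eqP => F0.
  by have := ev_bary_sum 0; rewrite F0 big_set0 => /esym/eqP; rewrite oner_eq0.
pose x0 := \sum_(j in F) (#|F|%:R^-1 : R) *: v j.
have lx0 i : i \in F -> ev x0 (l i) = #|F|%:R^-1.
  move=> iF; apply: (bary_coord_uniq bF (m := fun=> #|F|%:R^-1)) => //.
  by rewrite sumr_const -[LHS]mulr_natr mulVf// pnatr_eq0 -lt0n.
have near i : exists r, 0 < r /\
    forall x, box x0 r x -> i \in F -> 0 <= ev x (l i).
  have Fi : 0 < (#|F|%:R^-1 : R) by rewrite invr_gt0 ltr0n.
  have [r r0 H] := ev_near (l i) x0 Fi.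
  exists r; split => // x /H /[swap] iF; rewrite lx0// ltr_norml => /andP[]; lra.
have [r rP] := choice near.
exists x0, (\big[Num.min/1]_(i in F) r i); split.
  by elim/big_ind : _ => // [a b a0 b0|i _]; [rewrite lt_min a0|exact: (rP i).1].
move=> x bx i iF; apply: (rP i).2 => // j; apply: le_trans (bx j) _.
by rewrite (bigD1 i)//= ge_min lexx.
Qed.

Lemma ev_eq0_simplex (p : mpoly n R) : (forall x, D x -> ev x p = 0) -> p = 0.
Proof.
move=> H; have [x [r [r0 xr]]] := bary_interior.
by apply: (ev_eq0_box r0) => y /xr; exact: H.
Qed.

Lemma poly_int_eq0 (p : mpoly n R) : (forall x, D x -> 0 <= ev x p) ->
  poly_int D p = 0 -> p = 0.
Proof.
move=> p0 Ip; have [x0 [r [r0 x0r]]] := bary_interior.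
(* Halving the radius leaves room: a box of radius at most r / 2 around a point of this one stays in
   [D]. If [p] were positive at [y], it would exceed half that value on such a box, and its integral
   would be positive. *)
apply: (ev_eq0_box (c := x0) (e := r / 2)); first by rewrite divr_gt0.
move=> y yb; apply/eqP; rewrite eq_le p0 ?andbT; last first.
  by apply/x0r/(box_le _ yb); lra.
rewrite leNgt; apply/negP => py.
have [e e0 He] := ev_near p y (divr_gt0 py (ltr0n R 2)).
pose s := Num.min e (r / 2).
have s0 : 0 < s by rewrite lt_min e0 divr_gt0.
have : ev y p / 2 * int_Rn setT (\1_(box y s)) <= poly_int D p.
  rewrite poly_intE -int_RnZ; last exact: tame_box.
  apply: int_Rn_le; [exact/tameZ/tame_box|exact: tame_ev|].
  move=> x; rewrite indicE; case: (boolP (x \in box y s)); last first.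
    rewrite mulr0 indicE => _; case: (boolP (x \in D)); rewrite ?mul0r//.
    by rewrite inE mul1r => /p0.
  rewrite inE => xb; rewrite mulr1 indicE mem_set ?mul1r.
    have /He : box y e x by apply: box_le xb; rewrite ge_min lexx.
    by rewrite ltr_norml => /andP[]; lra.
  apply: x0r => i.
  have -> : x i 0 - x0 i 0 = (x i 0 - y i 0) + (y i 0 - x0 i 0) by ring.
  apply: le_trans (ler_normD _ _) _; have := yb i.
  have /(_ i) : box y (r / 2) x by apply: box_le xb; rewrite ge_min lexx orbT.
  lra.
rewrite Ip leNgt => /negP; apply; apply: mulr_gt0; first by rewrite divr_gt0.
exact: int_box_gt0.
Qed.

(** The common end of all vanishing arguments: test functions are chosen so that the integrand has
    this shape, the weights being products of barycentric coordinates or 1. *)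
Lemma poly_int_sqr (J : finType) (w u : J -> mpoly n R) :
  (forall j x, D x -> 0 <= ev x (w j)) -> (forall j, w j != 0) ->
  poly_int D (\sum_j w j * u j ^+ 2) = 0 -> forall j, u j = 0.
Proof.
move=> w0 wn0 H.
have t0 j x : D x -> 0 <= ev x (w j * u j ^+ 2).
  by move=> Dx; rewrite mevalM rmorphXn mulr_ge0 ?sqr_ge0 ?w0.
have S0 : \sum_j w j * u j ^+ 2 = 0.
  apply: poly_int_eq0 => // x Dx; rewrite raddf_sum sumr_ge0// => j _; exact: t0.
move=> j; have : w j * u j ^+ 2 = 0.
  apply: ev_eq0_simplex => x Dx; apply/eqP.
  have /eqP := congr1 (meval (fun i => x i 0)) S0.
  rewrite raddf_sum meval0 psumr_eq0 => [/allP|i _]; last exact: t0.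
  by apply; rewrite mem_index_enum.
by move/eqP; rewrite mulf_eq0 (negbTE (wn0 j)) sqrf_eq0 => /eqP.
Qed.

End SimplexIntegral.

(** * Integration by parts along an edge *)

Section Green.
Import Order.TTheory GRing.Theory Num.Theory.
Local Open Scope ring_scope.
Local Open Scope classical_set_scope.
Variables (R : realType) (n : nat) (I : finType).
Variables (F : {set I}) (c : I -> R) (g v : I -> 'cV[R]_n).
Hypothesis bF : barycentric F c g v.
Local Notation l i := (aff (c i) (g i)).
Local Notation D := (bary_simplex F c g).

Definition slab (i : I) (s : R) : set 'cV[R]_n :=
  D `&` [set x | 0 <= ev x (mpolyC n s - l i)].

Lemma slabP i s x : slab i s x <-> D x /\ ev x (l i) <= s.
Proof. by rewrite /slab /= mevalB mevalC subr_ge0. Qed.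

Lemma tame_slab i s : tame_set (slab i s).
Proof. by apply: tame_half; exact: (tame_simplex bF). Qed.

Lemma indic1 (S : set 'cV[R]_n) x : S x -> \1_S x = 1 :> R.
Proof. by move=> Sx; rewrite indicE mem_set. Qed.

Lemma indic0 (S : set 'cV[R]_n) x : ~ S x -> \1_S x = 0 :> R.
Proof. by move=> Sx; rewrite indicE memNset. Qed.

Lemma sum_indicator_le1 (J : finType) (P : pred J) :
  (forall a b, P a -> P b -> a = b) -> \sum_a (P a)%:R <= 1 :> R.
Proof.
move=> H; have [a Pa|P0] := pickP P; last by rewrite big1// => a _; rewrite P0.
rewrite (bigD1 a)//= Pa big1 ?addr0// => b ba.
by case: (boolP (P b)) => // /(H _ _ Pa) ab; rewrite ab eqxx in ba.
Qed.

(* The translates of the slab by multiples of [2 / N] along an edge are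
   disjoint and stay in a fixed box. *)
Lemma slab_small i j : i \in F -> j \in F -> i != j ->
  exists W, forall N, (0 < N)%N -> int_Rn setT (\1_(slab i N%:R^-1)) <= W / N%:R.
Proof.
move=> iF jF ij; pose e := v i - v j.
have ge : vdot (g i) e = 1 by rewrite (bary_grad bF)// eqxx (negbTE ij) subr0.
have [M M0 HM] := bary_simplex_bounded bF.
(* The shifts [2 * k / N] with [k < N] are below 2, so a translated slab moves by at most [2 * |e|]
   in each coordinate. *)
pose M' := M + 2 * \sum_k `|e k 0|.
have M'0 : 0 < M' by rewrite /M' ltr_pwDl// mulr_ge0// sumr_ge0.
exists (int_Rn setT (\1_(box (0 : 'cV[R]_n) M'))) => N N0.
have N0' : 0 < (N%:R : R) by rewrite ltr0n.
rewrite ler_pdivlMr// mulrC.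
pose sh (k : 'I_N) : 'cV[R]_n := - ((2 * k%:R / N%:R) *: e).
have tS := tame_slab i N%:R^-1.
have -> : N%:R * int_Rn setT (\1_(slab i N%:R^-1)) =
    \sum_(k < N) int_Rn setT (translate (sh k) (\1_(slab i N%:R^-1))).
  under eq_bigr do rewrite int_translate//.
  by rewrite sumr_const card_ord mulr_natl.
rewrite -int_Rn_sum => [|k]; last exact: tame_translate.
apply: int_Rn_le => [||x].
- by apply: tame_sum => k; exact: tame_translate.
- exact: tame_box.
rewrite indicE; case: (boolP (x \in _)) => [_|xb].
  apply: (sum_indicator_le1 (P := fun k : 'I_N => x + sh k \in slab i N%:R^-1)).
  (* With L = l_i(x), the number L N lies in both [2a, 2a + 1] and [2b, 2b + 1]; for integers this
     forces a = b. *)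
  move=> a b; rewrite !inE => /slabP[Da la] /slabP[Db lb].
  have := Da i iF; have := Db i iF; move: la lb.
  rewrite !ev_affD !vdotNr !vdotZr ge !mulr1.
  move: (ev x (l i)) => L la lb ha hb; apply: val_inj => /=; apply/eqP.
  have NN : N%:R^-1 * N%:R = 1 :> R by rewrite mulVf// gt_eqF.
  have {}la : L * N%:R - 2 * a%:R <= 1.
    have := ler_wpM2r (ltW N0') la; rewrite mulrBl NN.
    by rewrite -!mulrA mulVf ?gt_eqF// mulr1.
  have {}lb : L * N%:R - 2 * b%:R <= 1.
    have := ler_wpM2r (ltW N0') lb; rewrite mulrBl NN.
    by rewrite -!mulrA mulVf ?gt_eqF// mulr1.
  have {}ha : 0 <= L * N%:R - 2 * b%:R.
    have := mulr_ge0 ha (ltW N0'); rewrite mulrBl.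
    by rewrite -!mulrA mulVf ?gt_eqF// mulr1.
  have {}hb : 0 <= L * N%:R - 2 * a%:R.
    have := mulr_ge0 hb (ltW N0'); rewrite mulrBl.
    by rewrite -!mulrA mulVf ?gt_eqF// mulr1.
  have h1 : (2 * a)%:R <= (2 * b + 1)%:R :> R.
    by rewrite natrD !natrM; lra.
  have h2 : (2 * b)%:R <= (2 * a + 1)%:R :> R.
    by rewrite natrD !natrM; lra.
  by move: h1 h2; rewrite !ler_nat; lia.
rewrite big1// => k _; rewrite /translate indicE.
case: (boolP (_ \in _)) => // /[!inE] /slabP[/HM Mx _].
case/negP: xb; rewrite inE => m; rewrite mxE subr0.
have := Mx m; rewrite !mxE subr0 => h.
have -> : x m 0 = (x m 0 - 2 * k%:R / N%:R * e m 0) + 2 * k%:R / N%:R * e m 0.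
  by rewrite subrK.
apply: le_trans (ler_normD _ _) _; rewrite /M' lerD//.
  by move: h; rewrite !mxE.
rewrite normrM ger0_norm; last by rewrite divr_ge0// mulr_ge0.
have -> : 2 * k%:R / N%:R * `|e m 0| = 2 * (k%:R / N%:R * `|e m 0|) by ring.
rewrite ler_pM2l//.
have S : `|e m 0| <= \sum_k `|e k 0| by rewrite (bigD1 m)//= lerDl sumr_ge0.
apply: le_trans S; rewrite ler_piMl// ler_pdivrMr// mul1r ler_nat.
exact: ltnW.
Qed.

Lemma eq0_of_le_inv (a C : R) :
  (forall N, (0 < N)%N -> `|a| <= C / N%:R) -> a = 0.
Proof.
move=> H; apply/eqP; apply: contraT => a0.
have a0' : 0 < `|a| by rewrite normr_gt0.
pose N := (Num.truncn (`|C| / `|a|)).+1.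
have := H N isT; rewrite leNgt => /negP; case.
rewrite ltr_pdivrMr ?ltr0n//.
apply: le_lt_trans (ler_norm C) _; rewrite mulrC -ltr_pdivrMr//.
exact: truncnS_gt.
Qed.

(* Extend [f = l_i l_j p] by zero outside the simplex.  Translating by [s t] does
   not change its integral, and on the part of the simplex that leaves or enters
   [f] is of order [s] on a set of measure of order [s]. *)
Lemma bary_edge_green i j (p : mpoly n R) : i \in F -> j \in F -> i != j ->
  poly_int D (ddir (v j - v i) (l i * l j * p)) = 0.
Proof.
move=> iF jF ij; set t := v j - v i; set f := l i * l j * p.
have gt k : k \in F -> vdot (g k) t = (k == j)%:R - (k == i)%:R.
  by move=> kF; rewrite (bary_grad bF).
have [M M0 HM] := bary_simplex_bounded bF.
have [C C0 HC] := taylor_bound t M f.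
have [B1 B10 HB1] := ev_bounded (l j * p) M.
have [B2 B20 HB2] := ev_bounded (l i * p) M.
have [B3 B30 HB3] := ev_bounded (ddir t f) M.
have [W1 HW1] := slab_small iF jF ij.
have [W2 HW2] : exists W, forall N, (0 < N)%N ->
    int_Rn setT (\1_(slab j N%:R^-1)) <= W / N%:R.
  by apply: (slab_small jF iF); rewrite eq_sym.
set L := poly_int _ _.
pose V := int_Rn setT (\1_D : 'cV[R]_n -> R).
apply: (@eq0_of_le_inv _ (C * V + (B1 + B3) * W1 + B2 * W2)) => N N0.
pose s : R := N%:R^-1.
have s0 : 0 < s by rewrite invr_gt0 ltr0n.
have s1 : s <= 1 by rewrite invf_le1 ?ltr0n// ler1n.
pose G x := \1_D x * ev x f.
pose Gd x := \1_D x * ev x (ddir t f).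
have tG : tame G := tame_ev bF f.
have tGd : tame Gd := tame_ev bF (ddir t f).
pose st := s *: t.
(* The first-order Taylor remainder of the extension by zero. Translation invariance cancels the
   first two integrals and leaves -s L. *)
pose h x := translate st G x + (- 1 * G x + - s * Gd x).
have th : tame h.
  by apply: tameD; [exact: tame_translate|apply: tameD; exact: tameZ].
have Ih : int_Rn setT h = - s * L.
  rewrite int_RnD; [|exact: tame_translate|by apply: tameD; exact: tameZ].
  rewrite int_RnD; [|exact: tameZ..]; rewrite !int_RnZ// int_translate//.
  by rewrite mulN1r addrA subrr add0r /L poly_intE.
pose A1 := slab i s; pose A2 := slab j s.
(* One term for each position of the segment: if both ends are inside, the Taylor bound applies; if
   x + s t is outside, then l_i(x) <= s and |f(x)| <= s B1; if x is outside, then l_j(x + s t) <= s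
   and |f(x + s t)| <= s B2. The slabs have measure of order s, so the integral of [b] is of order
   s^2. *)
pose b x := C * s ^+ 2 * \1_D x + ((B1 + B3) * s * \1_A1 x +
   B2 * s * translate st \1_A2 x).
have tA2 : tame (translate st \1_A2) by apply/tame_translate/tame_slab.
have tA1 : tame (\1_A1 : 'cV[R]_n -> R) := tame_slab i s.
have tD : tame (\1_D : 'cV[R]_n -> R) := tame_simplex bF.
have tb : tame b.
  by apply: tameD; [exact: tameZ|apply: tameD; exact: tameZ].
have Ib : int_Rn setT b <= s * ((C * V + (B1 + B3) * W1 + B2 * W2) / N%:R).
  rewrite int_RnD; [|exact: tameZ|by apply: tameD; exact: tameZ].
  rewrite int_RnD; [|exact: tameZ..]; rewrite !int_RnZ// int_translate; last first.
    exact: tame_slab.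
  rewrite -/V -/s; have := HW1 N N0; have := HW2 N N0; rewrite -/s -/A1 -/A2.
  set I1 := int_Rn _ _; set I2 := int_Rn _ _ => h2 h1.
  have k1 : (B1 + B3) * s * I2 <= (B1 + B3) * s * (W1 * s).
    by apply: ler_wpM2l h1; rewrite mulr_ge0 ?ltW// addr_gt0.
  have k2 : B2 * s * I1 <= B2 * s * (W2 * s).
    by apply: ler_wpM2l h2; rewrite mulr_ge0 ?ltW.
  apply: le_trans (lerD (lexx _) (lerD k1 k2)) _.
  by rewrite le_eqVlt; apply/orP; left; apply/eqP; ring.
have ind01 (S : set 'cV[R]_n) x : 0 <= \1_S x :> R by rewrite indicE.
have hb x : `|h x| <= b x.
  rewrite /h /b /G /Gd /translate -/st.
  have b1 : 0 <= C * s ^+ 2 * \1_D x.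
    by apply: mulr_ge0 => //; apply: mulr_ge0; [exact: ltW|exact: sqr_ge0].
  have b2 : 0 <= (B1 + B3) * s * \1_A1 x.
    by apply: mulr_ge0 => //; apply/ltW/mulr_gt0 => //; exact: addr_gt0.
  have b3 : 0 <= B2 * s * \1_A2 (x + st).
    by apply: mulr_ge0 => //; exact/ltW/mulr_gt0.
  have [Dx|nDx] := pselect (D x); have [Dy|nDy] := pselect (D (x + st)).
  - have s1' : `|s| <= 1 by rewrite gtr0_norm.
    have := HC x s (HM x Dx) s1'; move: b1.
    rewrite (indic1 Dx) (indic1 Dy) !mul1r !mulr1 => _ k1.
    rewrite -[leLHS]addr0; apply: lerD; last exact: addr_ge0.
    apply: le_trans k1; rewrite le_eqVlt; apply/orP; left; apply/eqP.
    by congr `|_|; ring.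
  - have lis : ev x (l i) <= s.
      rewrite leNgt; apply/negP => lis; apply: nDy => k kF.
      rewrite ev_affD vdotZr gt//; have := Dx k kF.
      have [->|ki] := eqVneq k i; first by rewrite (negbTE ij) mulr0n mulr1n; lra.
      by case: (k == j); rewrite ?mulr1n ?mulr0n; lra.
    have A1x : A1 x by apply/slabP.
    move: b1 b3; rewrite (indic1 A1x) (indic1 Dx) (indic0 nDy).
    rewrite !mul0r add0r !mul1r !mulr1 => b1 b3.
    have k1 : `|ev x f| <= s * B1.
      rewrite /f -mulrA mevalM normrM; apply: ler_pM => //; last exact/HB1/HM.
      by rewrite ger0_norm//; exact: Dx.
    have k2 := HB3 x (HM x Dx).
    apply: le_trans (ler_normD _ _) _; rewrite !normrM normrN1 normrN (gtr0_norm s0).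
    have k3 : s * `|ev x (ddir t f)| <= s * B3 by rewrite ler_pM2l.
    lra.
  - have lis : ev (x + st) (l j) <= s.
      rewrite leNgt; apply/negP => ljs; apply: nDx => k kF.
      have -> : x = (x + st) - st by rewrite addrK.
      rewrite ev_affD vdotNr vdotZr gt//; have := Dy k kF.
      have [->|kj] := eqVneq k j.
        by rewrite eq_sym (negbTE ij) mulr0n mulr1n; lra.
      by case: (k == i); rewrite ?mulr1n ?mulr0n; lra.
    have A2x : A2 (x + st) by apply/slabP.
    move: b1 b2; rewrite (indic1 A2x) (indic1 Dy) (indic0 nDx).
    rewrite !mul0r !mulr0 !mul1r !addr0 !mulr1 => b1 b2.
    have k1 : `|ev (x + st) f| <= s * B2.
      rewrite /f [l i * _]mulrC -mulrA mevalM normrM.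
      apply: ler_pM => //; last exact/HB2/HM.
      by rewrite ger0_norm//; exact: Dy.
    lra.
  - move: b1 b2 b3; rewrite (indic0 nDx) (indic0 nDy) !mul0r !mulr0 !addr0 normr0.
    by move=> b1 b2 b3; rewrite !addr_ge0.
have Lb : s * `|L| <= s * ((C * V + (B1 + B3) * W1 + B2 * W2) / N%:R).
  apply: le_trans Ib; rewrite -{1}(gtr0_norm s0) -normrM -normrN -mulNr -Ih.
  rewrite ler_norml; apply/andP; split.
    rewrite -mulN1r -int_RnZ//; apply: int_Rn_le => //; first exact: tameZ.
    by move=> x; have := hb x; rewrite ler_norml mulN1r => /andP[].
  by apply: int_Rn_le => // x; have := hb x; rewrite ler_norml => /andP[].
by rewrite ler_pM2l in Lb.
Qed.

End Green.

(** * Dimensions of polynomial spaces *)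

Section Dimension.
Import GRing.Theory.
Local Open Scope ring_scope.
Local Open Scope classical_set_scope.
Variables (R : realType) (n : nat).
Implicit Types (V W : lmodType (mpoly n R)).

Definition lcomb V (I : finType) (b : I -> V) (c : I -> R) : V :=
  \sum_i mpolyC n (c i) *: b i.

Definition lin_indep V (I : finType) (b : I -> V) : Prop :=
  forall c, lcomb b c = 0 -> forall i, c i = 0.

Definition spanned V (I : finType) (b : I -> V) : set V :=
  [set v | exists c, v = lcomb b c].

Lemma lcombD V (I : finType) (b : I -> V) c c' :
  lcomb b (fun i => c i + c' i) = lcomb b c + lcomb b c'.
Proof. by rewrite -big_split; apply: eq_bigr => i _; rewrite mpolyCD scalerDl. Qed.

Lemma lcombZ V (I : finType) (b : I -> V) a c :
  lcomb b (fun i => a * c i) = mpolyC n a *: lcomb b c.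
Proof. by rewrite scaler_sumr; apply: eq_bigr => i _ /=; rewrite scalerA -mpolyCM. Qed.

Lemma lcomb_comp V (I J : finType) (b : J -> V) (A : I -> J -> R) c :
  lcomb (fun i => lcomb b (A i)) c = lcomb b (fun j => \sum_i c i * A i j).
Proof.
rewrite /lcomb; under eq_bigr do rewrite scaler_sumr.
rewrite exchange_big; apply: eq_bigr => j _ /=.
by rewrite raddf_sum scaler_suml; apply: eq_bigr => i _; rewrite scalerA -mpolyCM.
Qed.

Lemma has_dimP V (S : set V) N : has_dim S N <->
  exists2 b : 'I_N -> V, lin_indep b & S = spanned b.
Proof.
split=> [[b [b1 b2]]|[b b1 b2]]; exists b => //.
  by apply/seteqP; split=> v /b2.
by split => // v; rewrite b2.
Qed.

Lemma has_dim_fin V (I : finType) (b : I -> V) (S : set V) :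
  lin_indep b -> S = spanned b -> has_dim S #|I|.
Proof.
move=> b1 ->; apply/has_dimP; exists (b \o enum_val).
  move=> c; rewrite /lcomb /= => H i.
  have := b1 (c \o enum_rank); rewrite /lcomb (reindex _ (onW_bij _ (enum_val_bij I))) /=.
  under eq_bigr do rewrite enum_valK.
  by move=> /(_ H (enum_val i)); rewrite /= enum_valK.
apply/seteqP; split=> v [c ->].
  exists (c \o enum_val); rewrite /lcomb (reindex _ (onW_bij _ (enum_val_bij I))) /=.
  by [].
exists (c \o enum_rank); rewrite /lcomb [RHS](reindex _ (onW_bij _ (enum_val_bij I))) /=.
by apply: eq_bigr => i _; rewrite enum_valK.
Qed.

(** A vector in the left kernel of the coordinate matrix is a linear relation among the [b i]; the
    matrix is therefore row free, and its rank is at most the number of columns. *)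
Lemma lin_indep_leq V N N' (b : 'I_N -> V) (b' : 'I_N' -> V) :
  lin_indep b -> (forall i, spanned b' (b i)) -> (N <= N')%N.
Proof.
move=> b1 /choice[A HA].
pose M : 'M[R]_(N, N') := \matrix_(i < N, j < N') A i j.
have rM : row_free M; last by rewrite -(eqP rM) rank_leq_col.
rewrite -kermx_eq0; apply/eqP/matrixP => i0 k; rewrite [RHS]mxE.
have /b1/(_ k) // : lcomb b (fun i => kermx M i0 i) = 0.
rewrite (_ : b = fun i => lcomb b' (A i)); last by apply/funext.
rewrite lcomb_comp /lcomb big1// => j _.
have : (kermx M *m M) i0 j = 0 by rewrite mulmx_ker mxE.
rewrite mxE (eq_bigr (fun i => kermx M i0 i * A i j)) => [->|i _].
  by rewrite mpolyC0 scale0r.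
by rewrite [M i j]mxE.
Qed.

Lemma spanned_id V (I : finType) (b : I -> V) i : spanned b (b i).
Proof.
exists (fun j => (j == i)%:R); rewrite /lcomb (bigD1 i)//= eqxx mpolyC1 scale1r.
by rewrite big1 ?addr0// => j /negbTE ->; rewrite mpolyC0 scale0r.
Qed.

Lemma has_dim_inj V (S : set V) N N' : has_dim S N -> has_dim S N' -> N = N'.
Proof.
move=> /has_dimP[b b1 ->] /has_dimP[b' b'1 S'].
apply/eqP; rewrite eqn_leq; apply/andP; split.
  by apply: (lin_indep_leq b1 (b' := b')) => i; rewrite -S'; exact: spanned_id.
by apply: (lin_indep_leq b'1 (b' := b)) => i; rewrite S'; exact: spanned_id.
Qed.

Lemma poly_dimE V (S : set V) N : has_dim S N -> poly_dim S = N.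
Proof.
move=> SN; apply: (has_dim_inj _ SN); rewrite /poly_dim.
by apply: (getPex (P := has_dim S)); exists N.
Qed.

(** The first vector is added to a basis of the span of the others unless it already lies there. *)
Lemma has_dim_spanned V N (w : 'I_N -> V) : exists p, has_dim (spanned w) p.
Proof.
elim: N w => [|N IH] w.
  by exists 0%N; apply/has_dimP; exists w => // c _ [].
have [p] := IH (w \o lift ord0); move=> /has_dimP[b b1 bS].
have spE : spanned w = [set v | exists a u, spanned b u /\ v = mpolyC n a *: w ord0 + u].
  apply/seteqP; split=> v /=.
    move=> [c ->]; exists (c ord0), (lcomb (w \o lift ord0) (c \o lift ord0)).
    split; first by rewrite -bS; exists (c \o lift ord0).
    by rewrite /lcomb big_ord_recl.
  move=> [a [u []]]; rewrite -bS => -[c ->] ->.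
  exists (fun i => if unlift ord0 i is Some j then c j else a).
  rewrite /lcomb big_ord_recl unlift_none; congr (_ + _).
  by apply: eq_bigr => i _; rewrite liftK.
have [[c wE]|nw] := pselect (spanned b (w ord0)).
  exists p; apply/has_dimP; exists b => //; rewrite spE.
  apply/seteqP; split=> v /=.
    move=> [a [_ [[c' ->] ->]]].
    by exists (fun i => a * c i + c' i); rewrite lcombD lcombZ -wE.
  by move=> bv; exists 0, v; rewrite mpolyC0 scale0r add0r.
pose b' (i : 'I_p.+1) := if unlift ord0 i is Some j then b j else w ord0.
have b'E c : lcomb b' c = mpolyC n (c ord0) *: w ord0 + lcomb b (c \o lift ord0).
  rewrite /lcomb big_ord_recl /b' unlift_none; congr (_ + _).
  by apply: eq_bigr => i _; rewrite liftK.
exists p.+1; apply/has_dimP; exists b'.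
  move=> c; rewrite b'E => H.
  have c0 : c ord0 = 0.
    apply/eqP; apply: contraT => c0; case: nw.
    exists (fun i => - (c ord0)^-1 * (c \o lift ord0) i); rewrite lcombZ.
    move/eqP: H; rewrite addrC addr_eq0 => /eqP ->.
    by rewrite scalerN mpolyCN scaleNr opprK scalerA -mpolyCM mulVf// mpolyC1 scale1r.
  move: H; rewrite c0 mpolyC0 scale0r add0r => /b1 H i.
  by case: (unliftP ord0 i) => [j ->|->//]; exact: H.
rewrite spE; apply/seteqP; split=> v /=.
  move=> [a [_ [[c ->] ->]]].
  exists (fun i => if unlift ord0 i is Some j then c j else a).
  rewrite b'E unlift_none; congr (_ + lcomb _ _).
  by apply/funext => i /=; rewrite liftK.
move=> [c ->]; exists (c ord0), (lcomb b (c \o lift ord0)); rewrite b'E.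
by split => //; exists (c \o lift ord0).
Qed.

(** Linearity over [R] only: taking a homogeneous component or a symmetric gradient does not commute
    with multiplication by polynomials. *)
Definition const_linear V W (f : V -> W) : Prop :=
  forall a u v, f (mpolyC n a *: u + v) = mpolyC n a *: f u + f v.

Section RankNullity.
Variables (V W : lmodType (mpoly n R)) (f : V -> W).
Hypothesis fL : const_linear f.

Lemma const_linear0 : f 0 = 0.
Proof.
have := fL 1 0 0; rewrite mpolyC1 !scale1r addr0 => /eqP.
by rewrite -subr_eq0 opprD addNKr oppr_eq0 => /eqP.
Qed.

Lemma const_linear_lcomb (I : finType) (b : I -> V) c :
  f (lcomb b c) = lcomb (f \o b) c.
Proof.
rewrite /lcomb; elim: (index_enum I) => [|i s IH].
  by rewrite !big_nil const_linear0.
by rewrite !big_cons fL IH.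
Qed.

Lemma has_dim_image (S : set V) N : has_dim S N -> exists p, has_dim (f @` S) p.
Proof.
move=> /has_dimP[b _ ->]; have [p] := has_dim_spanned (f \o b); exists p.
rewrite (_ : f @` _ = spanned (f \o b))//; apply/seteqP; split=> w /=.
  by move=> [_ [c ->] <-]; exists c; rewrite const_linear_lcomb.
by move=> [c ->]; exists (lcomb b c); [exists c|rewrite const_linear_lcomb].
Qed.

(** In bases of [S] and of its image, [f] is a matrix [M] of full column rank p, and a row basis of
    its left kernel gives the coordinates of a basis of the kernel of [f]. The bound on [p] guards
    the truncated subtraction. *)
Lemma rank_nullity (S : set V) N p : has_dim S N -> has_dim (f @` S) p ->
  (p <= N)%N /\ has_dim (S `&` [set v | f v = 0]) (N - p).
Proof.
move=> /has_dimP[b b1 SE] /has_dimP[e e1 fSE].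
have : forall i, exists c, f (b i) = lcomb e c.
  move=> i; have : (f @` S) (f (b i)).
    by exists (b i) => //; rewrite SE; exact: spanned_id.
  by rewrite fSE.
move=> /choice[A HA].
pose M : 'M[R]_(N, p) := \matrix_(i, j) A i j.
have fcomb (u : 'rV_N) : f (lcomb b (fun i => u 0 i)) = lcomb e (fun j => (u *m M) 0 j).
  rewrite const_linear_lcomb (_ : f \o b = fun i => lcomb e (A i)); last exact/funext.
  rewrite lcomb_comp; congr lcomb; apply/funext => j.
  by rewrite mxE; apply: eq_bigr => i _; rewrite mxE.
have full : row_full M.
  apply/row_fullP; have : forall j, exists u : 'rV_N, u *m M = delta_mx 0 j.
    move=> j; have : (f @` S) (e j) by rewrite fSE; exact: spanned_id.
    rewrite SE => -[_ [c ->]].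
    pose u : 'rV_N := \row_i c i.
    rewrite (_ : c = fun i => u 0 i); last by apply/funext => i; rewrite mxE.
    rewrite fcomb => H; exists u; apply/rowP => k; rewrite !mxE eqxx andTb.
    have [c' ej] := spanned_id e j.
    have : lcomb e (fun k => (u *m M) 0 k + (-1) * (k == j)%:R) = 0.
      rewrite lcombD H lcombZ mpolyCN mpolyC1 scaleN1r.
      rewrite /lcomb [X in _ - X](bigD1 j)//= eqxx mpolyC1 scale1r big1 ?addr0 ?subrr//.
      by move=> i /negbTE ->; rewrite mpolyC0 scale0r.
    move=> /e1/(_ k); rewrite mulN1r mxE => /eqP; rewrite subr_eq0 => /eqP ->.
    by [].
  move=> /choice[u Hu]; exists (\matrix_j u j); apply/row_matrixP => j.
  by rewrite row_mul rowK Hu row1.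
have rM : \rank M = p by apply/eqP.
split; first by rewrite -{1}rM rank_leq_row.
rewrite -{1}rM -mxrank_ker; apply/has_dimP.
pose K := row_base (kermx M).
exists (fun k => lcomb b (fun i => K k i)).
  move=> c; rewrite lcomb_comp => /b1 H k.
  have : (\row_k c k) *m K = 0.
    apply/rowP => i; rewrite mxE [RHS]mxE -[RHS](H i).
    by apply: eq_bigr => j _; rewrite mxE.
  move=> /eqP; rewrite mulmx_free_eq0 ?row_base_free// => /eqP/rowP/(_ k).
  by rewrite !mxE.
apply/seteqP; split=> v.
  rewrite SE => -[[c ->]] /=; pose u : 'rV_N := \row_i c i.
  rewrite (_ : c = fun i => u 0 i); last by apply/funext => i; rewrite mxE.
  rewrite fcomb => /e1 uM.
  have : (u <= K)%MS.
    rewrite eq_row_base; apply/sub_kermxP/rowP => j; rewrite uM mxE//.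
  move=> /submxP[w ->]; exists (fun k => w 0 k); rewrite lcomb_comp.
  by congr lcomb; apply/funext => i; rewrite mxE.
move=> [c ->]; split; first by rewrite SE lcomb_comp; eexists.
rewrite /= lcomb_comp.
rewrite (_ : (fun j => _) = fun i => ((\row_k c k) *m K) 0 i); last first.
  apply/funext => i; rewrite [RHS]mxE; apply: eq_bigr => k _.
  by rewrite [X in _ = X * _]mxE.
rewrite fcomb -mulmxA.
have -> : K *m M = 0 by apply/sub_kermxP; rewrite eq_row_base.
by rewrite mulmx0 /lcomb big1// => j _; rewrite mxE mpolyC0 scale0r.
Qed.

End RankNullity.

Lemma has_dim0 V : has_dim [set 0 : V] 0.
Proof.
apply/has_dimP; exists (fun=> 0) => [c _ []//|].
apply/seteqP; split=> v /=; first by move=> ->; exists (fun=> 0); rewrite /lcomb big_ord0.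
by move=> [c ->]; rewrite /lcomb big_ord0.
Qed.

End Dimension.

(** * Homogeneous components, Euler's identity and Koszul exactness *)

Section Homogeneous.
Import Order.TTheory GRing.Theory Num.Theory.
Local Open Scope ring_scope.
Variables (R : realType) (n : nat).
Implicit Types (p q : mpoly n R) (m : multinom n).
Local Notation homog s := (ishomog1 s mdeg).

Lemma homog_coeffP s p :
  p \is homog s <-> (forall m, mdeg m != s -> mcoeff m p = 0).
Proof.
split=> [ph m ms|H]; first exact: (dhomog_nemf_coeff ph).
apply/dhomogP => m; rewrite mcoeff_msupp => pm; apply/eqP.
by apply: contraNT pm => /H ->.
Qed.

Lemma mcoeff_pihomog s p m :
  mcoeff m (pihomog mdeg s p) = if mdeg m == s then mcoeff m p else 0.
Proof.
rewrite /pihomog raddf_sum /=; case: ifP => ms; last first.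
  rewrite big1// => m' /eqP m's; rewrite mcoeffZ mcoeffX.
  by rewrite (_ : m' == m = false) ?mulr0//; apply: contraFF ms => /eqP <-; rewrite m's.
rewrite [in RHS](mpolyE p) raddf_sum /= [RHS](bigID (fun m' => mdeg m' == s)) /=.
rewrite [X in _ = _ + X]big1 ?addr0// => m' m's; rewrite mcoeffZ mcoeffX.
by rewrite (_ : m' == m = false) ?mulr0//; apply: contraNF m's => /eqP ->.
Qed.

Lemma mcoeff_mulX p i m :
  mcoeff m (p * mono i) = if m i != 0%N then mcoeff (mnm_sub m (mnm1 i)) p else 0.
Proof.
case: ifP => mi.
  by rewrite -{1}[m](@submK _ (mnm1 i)) ?lep1mP// addmC mcoeffMX.
rewrite mulrC {1}(mpolyE p) mulr_sumr raddf_sum /= big1// => m' _.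
rewrite -scalerAr mcoeffZ -mpolyXD mcoeffX (_ : _ == _ = false) ?mulr0//.
by apply: contraFF mi => /eqP <-; rewrite mnmDE mnm1E eqxx.
Qed.

Lemma pihomog_mulX s p i :
  pihomog mdeg s.+1 (p * mono i) = pihomog mdeg s p * mono i.
Proof.
apply/mpolyP => m; rewrite mcoeff_pihomog !mcoeff_mulX mcoeff_pihomog.
case: ifP => [/eqP ms|ms]; case: ifP => // mi.
  have : mdeg (mnm_sub m (mnm1 i)) = s.
    have := mdegD (mnm_sub m (mnm1 i)) (mnm1 i).
    by rewrite submK ?lep1mP// ms mdeg1 addn1 => -[].
  by move=> ->; rewrite eqxx.
case: ifP => // /eqP h; have := mdegD (mnm_sub m (mnm1 i)) (mnm1 i).
by rewrite submK ?lep1mP// h mdeg1 addn1 => msE; rewrite msE eqxx in ms.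
Qed.

Lemma homog_mulX s p i : p \is homog s -> p * mono i \is homog s.+1.
Proof. by move=> ph; rewrite -addn1; apply: dhomogM => //; rewrite dhomogX; apply/eqP; exact: mdeg1. Qed.

Lemma homog_mderiv s p i : p \is homog s.+1 -> mderiv i p \is homog s.
Proof.
move=> /homog_coeffP H; apply/homog_coeffP => m ms.
by rewrite mcoeff_deriv H ?mul0rn// mdegD mdeg1 addn1 eqSS.
Qed.

Lemma homog0_mderiv p i : p \is homog 0 -> mderiv i p = 0.
Proof.
move=> /homog_coeffP H; apply/mpolyP => m; rewrite mcoeff_deriv H ?mcoeff0 ?mul0rn//.
by rewrite mdegD mdeg1 addn1.
Qed.

Lemma msize_homog s p : p \is homog s -> (msize p <= s.+1)%N.
Proof.
move=> /homog_coeffP H; apply/msize_coeffP => m sm; apply: H.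
by rewrite gtn_eqF.
Qed.

Lemma homog_sum s (J : Type) (r : seq J) (P : pred J) (F : J -> mpoly n R) :
  (forall j, P j -> F j \is homog s) -> \sum_(j <- r | P j) F j \is homog s.
Proof.
move=> H; elim/big_ind : _ => //; first exact: dhomog0.
by move=> p q; exact: dhomogD.
Qed.

(** The operator x . grad; it is diagonal on monomials, with the degree as eigenvalue. *)
Definition euler p : mpoly n R := \sum_j mderiv j p * mono j.

Lemma mcoeff_euler p m : mcoeff m (euler p) = (mdeg m)%:R * mcoeff m p.
Proof.
rewrite /euler raddf_sum mdegE natr_sum mulr_suml /=; apply: eq_bigr => j _.
rewrite mcoeff_mulX; case: (eqVneq (m j) 0%N) => [->|mj /=]; first by rewrite mul0r.
rewrite mcoeff_deriv submK ?lep1mP// mulr_natl; congr (_ *+ _).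
by rewrite mnmBE mnm1E eqxx subn1 prednK// lt0n.
Qed.

Lemma euler_homog s p : p \is homog s -> euler p = s%:R *: p.
Proof.
move=> ph; apply/mpolyP => m; rewrite mcoeff_euler mcoeffZ.
have [->//|ms] := eqVneq (mdeg m) s.
by rewrite (proj1 (homog_coeffP s p) ph _ ms) !mulr0.
Qed.

Definition coordX : 'cV[mpoly n R]_n := coord_vec R n.

Lemma coordXE i : coordX i 0 = mono i.
Proof. by rewrite mxE. Qed.

Lemma mderiv_mono i j : mderiv i (mono j : mpoly n R) = (i == j)%:R.
Proof.
rewrite mderivX mnm1E eq_sym; case: eqP => [->|_]; last by rewrite scale0r.
rewrite scale1r (_ : mnm_sub _ _ = @mnm0 n) ?mpolyX0//.
by apply/mnmP => k; rewrite mnmBE mnm0E subnn.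
Qed.

Lemma mderiv_sum (J : Type) (r : seq J) (P : pred J) i (F : J -> mpoly n R) :
  mderiv i (\sum_(j <- r | P j) F j) = \sum_(j <- r | P j) mderiv i (F j).
Proof. exact: raddf_sum. Qed.

Lemma mderiv_vdot_coordX i (u : 'cV[mpoly n R]_n) :
  mderiv i (vdot u coordX) = \sum_j mderiv i (u j 0) * mono j + u i 0.
Proof.
rewrite mderiv_sum.
under eq_bigr do rewrite mderivM coordXE mderiv_mono.
rewrite big_split /=; congr (_ + _).
rewrite (bigD1 i)//= eqxx mulr1 big1 ?addr0// => j /negbTE ji.
by rewrite eq_sym ji mulr0.
Qed.

(* [N_ij = (d_j u_i - d_i u_j) / (s + 2)], by Euler's identity. *)
Lemma koszul s (u : 'cV[mpoly n R]_n) : (forall i, u i 0 \is homog s.+1) ->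
  vdot u coordX = 0 -> exists2 N, Hskew s N & u = N *m coord_vec R n.
Proof.
move=> uh ux.
pose a : R := (s.+2)%:R^-1.
exists (\matrix_(i, j) (a *: (mderiv j (u i 0) - mderiv i (u j 0)))).
  split=> [i j|]; last first.
    apply/matrixP => i j; rewrite !mxE -scalerN; congr (_ *: _).
    by rewrite opprB.
  by rewrite mxE; apply: dhomogZ; rewrite rpredB// homog_mderiv.
apply/matrixP => i k; rewrite (ord1 k) mxE.
(* Differentiating u . x = 0 gives sum_j x_j d_i u_j = -u_i, and Euler's identity gives sum_j x_j
   d_j u_i = (s + 1) u_i; their difference is (s + 2) u_i. *)
have := mderiv_vdot_coordX i u; rewrite ux mderiv0 => /esym/eqP.
rewrite addrC addr_eq0 => /eqP ui.
rewrite (eq_bigr (fun j => a *: (mderiv j (u i 0) * mono j - mderiv i (u j 0) * mono j))).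
  rewrite -scaler_sumr sumrB -/(euler _) (euler_homog (uh i)).
  rewrite -[X in _ - X]opprK -ui opprK.
  have -> : s.+1%:R *: u i 0 + u i 0 = s.+2%:R *: u i 0.
    by rewrite -[X in _ + X]scale1r -scalerDl natr1.
  by rewrite scalerA mulVf ?scale1r// pnatr_eq0.
by move=> j _; rewrite !mxE -scalerAl mulrBl.
Qed.

Lemma skew_vdot (N : 'M[mpoly n R]_n) (x : 'cV[mpoly n R]_n) :
  N^T = - N -> vdot (N *m x) x = 0.
Proof.
move=> NT; pose q := vdot (N *m x) x.
have E : q = \sum_i \sum_j N i j * x j 0 * x i 0.
  by apply: eq_bigr => i _; rewrite mxE mulr_suml.
have : q = - q.
  rewrite {1}E exchange_big E -sumrN /=; apply: eq_bigr => i _.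
  rewrite -sumrN; apply: eq_bigr => j _.
  have -> : N j i = - N i j by have := congr1 (fun X : 'M[_]_n => X i j) NT; rewrite !mxE.
  ring.
move/eqP; rewrite -addr_eq0 -mulr2n -scaler_nat scaler_eq0 pnatr_eq0 /=.
by move/eqP.
Qed.

(* By Koszul exactness the top-degree part [w] of a field belongs to
   H_s(K) x exactly when [w . x = 0]. *)
Lemma NDspaceE s (u : 'cV[mpoly n R]_n) : NDspace s u <->
  @Pmx R n s.+1 n 1 u /\ pihomog mdeg s.+2 (vdot u coordX) = 0.
Proof.
have pix (w : 'cV[mpoly n R]_n) : pihomog mdeg s.+2 (vdot w coordX) =
    vdot (\col_i pihomog mdeg s.+1 (w i 0)) coordX.
  rewrite /vdot raddf_sum; apply: eq_bigr => j _ /=.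
  by rewrite [in RHS]mxE coordXE pihomog_mulX.
split=> [[p [N [pP NH ->]]]|[uP u0]].
  split.
    move=> i j; rewrite mxE; apply: msizeD_leq.
      by apply: leq_trans (pP i j) _.
    rewrite mxE; apply: msize_homog; apply: homog_sum => k _.
    rewrite (ord1 j) coordXE; apply: homog_mulX; exact: NH.1.
  rewrite vdotC vdotDr [X in _ + X]vdotC skew_vdot ?addr0; last exact: NH.2.
  rewrite vdotC pix /vdot big1// => i _; rewrite mxE.
  rewrite (_ : pihomog _ _ _ = 0) ?mul0r//.
  apply/mpolyP => m; rewrite mcoeff_pihomog mcoeff0; case: ifP => // /eqP ms.
  by move/msize_coeffP : (pP i 0); apply; rewrite ms.
pose w : 'cV[mpoly n R]_n := \col_i pihomog mdeg s.+1 (u i 0).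
have [||N NH wE] := @koszul s w.
- by move=> i; rewrite mxE; exact: pihomogP.
- by rewrite -pix.
exists (u - w), N; split => //; last by rewrite -wE subrK.
move=> i j; rewrite (ord1 j) !mxE; apply/msize_coeffP => m sm.
rewrite mcoeffB mcoeff_pihomog; case: ifP => [_|/eqP/eqP ms]; first by rewrite subrr.
rewrite subr0; move/msize_coeffP : (uP i 0); apply.
by rewrite ltn_neqAle eq_sym ms.
Qed.

End Homogeneous.

Section PolynomialDimensions.
Import Order.TTheory GRing.Theory Num.Theory.
Local Open Scope ring_scope.
Local Open Scope classical_set_scope.

Lemma card_bmultinom n m : #|{: bmultinom n m.+1}| = 'C(m + n, n).
Proof.
rewrite addnC -card_partial_ord_partitions.
pose f (b : bmultinom n m.+1) : n.-tuple 'I_m.+1 :=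
  [tuple inord (bmnm b i) | i < n].
have le_b (b : bmultinom n m.+1) i : (bmnm b i < m.+1)%N.
  apply: leq_ltn_trans (bmdeg b); rewrite mdegE (bigD1 i)//=; exact: leq_addr.
have finj : injective f.
  move=> b b' /(congr1 (fun t : n.-tuple _ => fun i => val (tnth t i))) H.
  apply: val_inj; apply/mnmP => i.
  have := congr1 (fun h => h i) H; rewrite /= !tnth_mktuple !inordK//.
rewrite -(card_imset _ finj); apply: eq_card => t; rewrite inE.
apply/imsetP/idP => [[b _ ->]|tm].
  rewrite big_tuple; under eq_bigr do rewrite tnth_mktuple inordK//.
  by rewrite -mdegE -ltnS; exact: bmdeg.
pose w : multinom n := Multinom [tuple val (tnth t i) | i < n].
have wE i : w i = tnth t i by rewrite multinomE tnth_mktuple.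
have wm : (mdeg w < m.+1)%N.
  rewrite ltnS mdegE; apply: leq_trans tm; rewrite big_tuple.
  by apply: leq_sum => i _; rewrite wE.
exists (BMultinom wm) => //; apply: eq_from_tnth => i.
by rewrite tnth_mktuple /= wE inord_val.
Qed.

Variables (R : realType) (n : nat).

(** One count for scalars, columns and symmetric matrices: if the [e j] are free over the polynomial
    ring, their products with the monomials form a basis over [R]. *)
Lemma has_dim_free (V : lmodType (mpoly n R)) (J : finType) (e : J -> V) m :
  (forall p : J -> mpoly n R, \sum_j p j *: e j = 0 -> forall j, p j = 0) ->
  has_dim [set v | exists p, (forall j, Ppoly m (p j)) /\ v = \sum_j p j *: e j]
    (#|J| * 'C(m + n, n)).
Proof.
move=> e0; rewrite -card_bmultinom -card_prod.
pose b (jk : J * bmultinom n m.+1) := mpolyX R (bmnm jk.2) *: e jk.1.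
have bE c : lcomb b c =
    \sum_j (\sum_(k : bmultinom n m.+1) c (j, k) *: mpolyX R (bmnm k)) *: e j.
  rewrite /lcomb (eq_bigr (fun jk => mpolyC n (c (jk.1, jk.2)) *: b (jk.1, jk.2))).
    rewrite -(pair_bigA _ (fun j k => mpolyC n (c (j, k)) *: b (j, k))) /=.
    apply: eq_bigr => j _; rewrite scaler_suml; apply: eq_bigr => k _.
    by rewrite /b scalerA mul_mpolyC.
  by case.
apply: (@has_dim_fin R n V _ b).
  move=> c; rewrite bE => /e0 H [j k].
  have := congr1 (mcoeff (bmnm k)) (H j); rewrite mcoeff0.
  (* [c (j, _)] extended by 0 beyond the degree bound, since [mcoeff_mpoly] wants a coefficient for
     every exponent. *)
  pose E (m' : multinom n) : R := if @idP (mdeg m' < m.+1)%N is ReflectT h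
    then c (j, BMultinom h) else 0.
  rewrite (eq_bigr (fun k : bmultinom n m.+1 => E (bmnm k) *: mpolyX R (bmnm k))).
    rewrite (mcoeff_mpoly _ (bmdeg k)) /E; case: {-}_ / idP => [h|]; last first.
      by rewrite bmdeg.
    by move=> <-; congr (c (_, _)); apply: val_inj.
  move=> k' _; congr (_ *: _); rewrite /E; case: {-}_ / idP => [h|]; last first.
    by rewrite bmdeg.
  by congr (c (_, _)); apply: val_inj.
apply/seteqP; split=> v /=.
  move=> [p [pm ->]]; exists (fun jk => mcoeff (bmnm jk.2) (p jk.1)); rewrite bE /=.
  by apply: eq_bigr => j _; rewrite {1}(mpolywE (pm j)).
move=> [c ->]; rewrite bE.
exists (fun j => \sum_(k : bmultinom n m.+1) c (j, k) *: mpolyX R (bmnm k)).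
split=> // j; apply: msize_sum_leq => k _; apply: leq_trans (msizeZ_le _ _) _.
by rewrite msizeX; exact: bmdeg.
Qed.

Lemma has_dim_Ppoly m : has_dim (@Ppoly R n m) 'C(m + n, n).
Proof.
have := @has_dim_free (mpoly n R)^o unit (fun=> 1) m.
rewrite card_unit mul1n => H.
rewrite (_ : @Ppoly R n m = [set v | exists p : unit -> mpoly n R,
  (forall j, Ppoly m (p j)) /\ v = \sum_j p j *: (1 : (mpoly n R)^o)]).
  apply: H => p; rewrite (bigD1 tt)//= big1; last by case.
  by rewrite addr0 => H [] ; rewrite -[p tt]mulr1.
have bu (p : unit -> mpoly n R) : \sum_j p j *: (1 : (mpoly n R)^o) = p tt.
  by rewrite (bigD1 tt)//= big1; [rewrite addr0; exact: mulr1|case].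
apply/seteqP; split=> v /=; first by move=> vm; exists (fun=> v); rewrite bu.
by move=> [p [pm ->]]; rewrite bu.
Qed.

Lemma has_dim_Pcol m : has_dim (@Pmx R n m n 1) (n * 'C(m + n, n)).
Proof.
have := @has_dim_free 'cV[mpoly n R]_n 'I_n (fun i => delta_mx i 0) m.
rewrite card_ord => H.
have bu (p : 'I_n -> mpoly n R) : \sum_j p j *: delta_mx j 0 = \col_j p j :> 'cV_n.
  apply/matrixP => i j; rewrite (ord1 j) summxE !mxE (bigD1 i)//= big1.
    by rewrite !mxE !eqxx mulr1 addr0.
  by move=> k /negbTE ki; rewrite !mxE eq_sym ki mulr0.
rewrite (_ : @Pmx R n m n 1 = [set v | exists p : 'I_n -> mpoly n R,
  (forall j, Ppoly m (p j)) /\ v = \sum_j p j *: delta_mx j 0]).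
  by apply: H => p; rewrite bu => /matrixP H j; have := H j 0; rewrite !mxE.
apply/seteqP; split=> v /=.
  move=> vm; exists (fun j => v j 0); rewrite bu; split => [j|]; first exact: vm.
  by apply/matrixP => i j; rewrite mxE (ord1 j).
by move=> [p [pm ->]] i j; rewrite bu mxE.
Qed.

Lemma card_ord_le_pairs r :
  #|[pred ij : 'I_r * 'I_r | (ij.1 <= ij.2)%N]| = 'C(r.+1, 2).
Proof.
rewrite -sum1_card big_mkcond /=.
rewrite -(pair_bigA _ (fun i j : 'I_r => if (i <= j)%N then 1%N else 0%N)) /=.
rewrite exchange_big /= -bin2_sum big_mkord [RHS]big_ord_recl add0n.
apply: eq_bigr => j _; rewrite -big_mkcond /=.
by rewrite (big_ord_narrow (ltn_ord j)) sum1_card card_ord.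
Qed.

Lemma has_dim_Psym m : has_dim (@Psym R n m) ('C(n.+1, 2) * 'C(m + n, n)).
Proof.
pose J := {ij : 'I_n * 'I_n | (ij.1 <= ij.2)%N}.
have cJ : #|{: J}| = 'C(n.+1, 2) by rewrite card_sig card_ord_le_pairs.
(* The independent entries are those with i <= j; [srt] sends any pair of indices to the sorted pair
   that carries its value. *)
have srtP (i j : 'I_n) :
    {u : J | val u = if (i <= j)%N then (i, j) else (j, i)}.
  case: (leqP i j) => ij; first by exists (exist _ (i, j) ij).
  by exists (exist _ (j, i) (ltnW ij)).
pose srt i j : J := sval (srtP i j).
have srtE i j : val (srt i j) = if (i <= j)%N then (i, j) else (j, i).
  by rewrite /srt; case: (srtP i j).
have srtC i j : srt i j = srt j i.
  apply: val_inj; rewrite !srtE; case: (ltngtP i j) => // ij.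
  by rewrite (val_inj ij).
have srt_id (u : J) : srt (val u).1 (val u).2 = u.
  by apply: val_inj; rewrite srtE (valP u); case: (val u).
pose e (u : J) : 'M[mpoly n R]_n := \matrix_(i, j) (u == srt i j)%:R.
have bu (p : J -> mpoly n R) : \sum_u p u *: e u = \matrix_(i, j) p (srt i j).
  apply/matrixP => i j; rewrite summxE !mxE (bigD1 (srt i j))//= big1.
    by rewrite !mxE eqxx mulr1 addr0.
  by move=> u /negbTE us; rewrite !mxE us mulr0.
have := @has_dim_free 'M[mpoly n R]_n J e m; rewrite cJ => H.
rewrite (_ : @Psym R n m = [set v | exists p : J -> mpoly n R,
  (forall j, Ppoly m (p j)) /\ v = \sum_j p j *: e j]).
  apply: H => p; rewrite bu => /matrixP H u.
  by have := H (val u).1 (val u).2; rewrite !mxE srt_id.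
apply/seteqP; split=> v /=.
  move=> [vm vT]; exists (fun u => v (val u).1 (val u).2); rewrite bu.
  split => [u|]; first exact: vm.
  apply/matrixP => i j; rewrite mxE srtE; case: ifP => //= _.
  by rewrite -{1}vT mxE.
move=> [p [pm ->]]; rewrite bu; split; first by move=> i j; rewrite mxE.
by apply/matrixP => i j; rewrite !mxE srtC.
Qed.

Lemma const_linear_pihomog s :
  const_linear (pihomog mdeg s : (mpoly n R)^o -> (mpoly n R)^o).
Proof.
move=> a u v.
rewrite -[LHS]/(pihomog mdeg s (mpolyC n a * (u : mpoly n R) + v)).
rewrite -[RHS]/(mpolyC n a * pihomog mdeg s u + pihomog mdeg s v).
by rewrite !mul_mpolyC linearP.
Qed.

(** Rank-nullity for the component of degree m + 1 on P_{m+1}, whose kernel is P_m. *)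
Lemma has_dim_homog m :
  has_dim ([set p | p \is ishomog1 m.+1 mdeg] : set (mpoly n R)^o)
    ('C(m.+1 + n, n) - 'C(m + n, n)).
Proof.
have fL := const_linear_pihomog m.+1.
have [h Hh] := has_dim_image fL (has_dim_Ppoly m.+1).
have [hle Hk] := rank_nullity fL (has_dim_Ppoly m.+1) Hh.
have imE : (pihomog mdeg m.+1 : (mpoly n R)^o -> (mpoly n R)^o) @` @Ppoly R n m.+1 =
    [set p | p \is ishomog1 m.+1 mdeg].
  apply/seteqP; split=> p /=; first by move=> [q _ <-]; exact: pihomogP.
  by move=> ph; exists p; [exact: msize_homog|exact: pihomog_dE].
have kE : @Ppoly R n m.+1 `&` [set p | pihomog mdeg m.+1 p = 0] = @Ppoly R n m.
  apply/seteqP; split=> p /=.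
    move=> [/msize_coeffP pm p0]; apply/msize_coeffP => k mk.
    have := congr1 (mcoeff k) p0; rewrite mcoeff_pihomog mcoeff0.
    case: ifP => // /negbT/eqP km _; apply: pm.
    by move: mk km; case: (ltngtP m.+1 (mdeg k)) => // ->.
  move=> pm; split; first exact: leq_trans pm _.
  apply/mpolyP => k; rewrite mcoeff_pihomog mcoeff0; case: ifP => // /eqP km.
  by move/msize_coeffP : pm; apply; rewrite km.
rewrite kE in Hk; have E := has_dim_inj Hk (has_dim_Ppoly m).
by rewrite imE in Hh; rewrite -E subKn.
Qed.

(** By [NDspaceE], ND_m is the kernel of the top-degree part of u . x on vector fields of degree m +
    1. That map is onto the homogeneous polynomials of degree m + 2, since p = grad p . x / (m + 2)
    for such p. *)
Lemma has_dim_ND m : has_dim (@NDspace R n m)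
  (n * 'C(m.+1 + n, n) - ('C(m.+2 + n, n) - 'C(m.+1 + n, n))).
Proof.
pose f : 'cV[mpoly n R]_n -> (mpoly n R)^o :=
  fun u => pihomog mdeg m.+2 (vdot u (coordX R n)).
have fL : const_linear f.
  move=> a u v; rewrite /f vdotC vdotDr vdotZr ![vdot (coordX R n) _]vdotC.
  exact: const_linear_pihomog.
have imE : f @` @Pmx R n m.+1 n 1 = [set p | p \is ishomog1 m.+2 mdeg].
  apply/seteqP; split=> p /=; first by move=> [q _ <-]; exact: pihomogP.
  move=> ph; exists (\col_i ((m.+2)%:R^-1 *: mderiv i p)).
    move=> i j; rewrite mxE; apply: msize_homog; apply: dhomogZ.
    exact: homog_mderiv.
  rewrite /f -[RHS](pihomog_dE ph); congr pihomog.
  transitivity ((m.+2)%:R^-1 *: euler p).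
    rewrite scaler_sumr; apply: eq_bigr => i _.
    by rewrite mxE coordXE scalerAl.
  by rewrite (euler_homog ph) scalerA mulVf ?scale1r// pnatr_eq0.
have Hh : has_dim (f @` @Pmx R n m.+1 n 1) ('C(m.+2 + n, n) - 'C(m.+1 + n, n)).
  by rewrite imE; exact: has_dim_homog.
have [_] := rank_nullity fL (has_dim_Pcol m.+1) Hh.
rewrite (_ : _ `&` _ = @NDspace R n m)//.
by apply/seteqP; split=> u /NDspaceE.
Qed.

End PolynomialDimensions.

(** * The symmetric gradient, rigid motions and the kernel of q |-> q x *)

Section SymmetricGradient.
Import Order.TTheory GRing.Theory Num.Theory.
Local Open Scope ring_scope.
Local Open Scope classical_set_scope.
Variables (R : realType) (n : nat).
Implicit Types (u : 'cV[mpoly n R]_n) (q : 'M[mpoly n R]_n).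
Local Notation X := (coord_vec R n).
Local Notation homog s := (ishomog1 s mdeg).

Definition jac u : 'M[mpoly n R]_n := \matrix_(i, j) mderiv j (u i 0).

(* Twice the symmetric gradient. *)
Definition eps u : 'M[mpoly n R]_n := jac u + (jac u)^T.

Lemma epsE u i j : eps u i j = mderiv j (u i 0) + mderiv i (u j 0).
Proof. by rewrite !mxE. Qed.

Lemma eps_mulX u i :
  (eps u *m X) i 0 = euler (u i 0) + (mderiv i (vdot u X) - u i 0).
Proof.
rewrite mxE (mderiv_vdot_coordX i u) addrK -big_split; apply: eq_bigr => j _.
by rewrite epsE /= coordXE mulrDl.
Qed.

Lemma eulerM_mono (p : mpoly n R) i : euler (p * mono i) = euler p * mono i + p * mono i.
Proof.
apply/mpolyP => m; rewrite mcoeff_euler mcoeffD !mcoeff_mulX.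
case: ifP => mi; last by rewrite mulr0 addr0.
rewrite mcoeff_euler -[X in _ = _ + X]mul1r -mulrDl; congr (_ * _).
have := mdegD (mnm_sub m (mnm1 i)) (mnm1 i).
by rewrite submK ?lep1mP// mdeg1 addn1 natr1 => ->.
Qed.

(** Let E be the Euler operator and phi = u . x. Multiplying E u_i + d_i phi - u_i = 0 by x_i and
    summing gives 2 (E phi - phi) = 0, so phi is homogeneous of degree one. Then d_i phi is
    constant, and (E - 1) u_i = - d_i phi leaves no component of degree at least two in u_i. *)
Lemma msize_of_eps_mulX u : eps u *m X = 0 -> forall i, (msize (u i 0)%R <= 2)%N.
Proof.
move=> H.
have Hi i : euler (u i 0) + (mderiv i (vdot u X) - u i 0) = 0.
  by rewrite -eps_mulX H mxE.
pose phi := vdot u X.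
have ephi : euler phi = \sum_i euler (u i 0) * mono i + phi.
  rewrite {1}/phi /vdot /euler.
  under eq_bigr do rewrite mderiv_sum mulr_suml.
  rewrite exchange_big /=; under eq_bigr do rewrite coordXE -/(euler _) eulerM_mono.
  rewrite big_split /=; congr (_ + _); apply: eq_bigr => i _; by rewrite coordXE.
have phi1 : euler phi - phi = 0.
  have : \sum_i (euler (u i 0) + (mderiv i phi - u i 0)) * mono i = 0.
    by rewrite big1// => i _; rewrite Hi mul0r.
  under eq_bigr do rewrite mulrDl mulrBl.
  rewrite big_split sumrB /= -/(euler phi).
  have -> : \sum_i u i 0 * mono i = phi.
    by apply: eq_bigr => i _; rewrite coordXE.
  have -> : \sum_i euler (u i 0) * mono i = euler phi - phi by rewrite ephi addrK.
  move/eqP; rewrite -mulr2n -scaler_nat scaler_eq0 pnatr_eq0 /=.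
  by move/eqP.
have phi_m m : mdeg m != 1%N -> mcoeff m phi = 0.
  move=> m1; have := congr1 (mcoeff m) phi1.
  rewrite mcoeffB mcoeff_euler mcoeff0 -[X in _ - X]mul1r -mulrBl => /eqP.
  rewrite mulf_eq0 subr_eq0 => /orP[|/eqP//].
  by rewrite -[1]/(1%:R) eqr_nat (negbTE m1).
move=> i; apply/msize_coeffP => m m2.
have := congr1 (mcoeff m) (Hi i).
rewrite mcoeffD mcoeffB mcoeff_deriv mcoeff_euler phi_m ?mcoeff0; last first.
  by rewrite mdegD mdeg1 addn1; move: m2; case: (mdeg m).
rewrite mul0rn sub0r -[X in _ - X]mul1r -mulrBl => /eqP.
rewrite mulf_eq0 subr_eq0 => /orP[|/eqP//].
by rewrite -[1]/(1%:R) eqr_nat; move: m2; case: (mdeg m) => [|[]].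
Qed.

Lemma linear_form0 (c : 'I_n -> R) :
  \sum_j mpolyC n (c j) * mono j = 0 -> forall j, c j = 0.
Proof.
move=> H j; have := congr1 (mcoeff (mnm1 j)) H.
rewrite mcoeff0 raddf_sum (bigD1 j)//= big1 => [|k kj].
  by rewrite mcoeffCM mcoeffXU eqxx mulr1 addr0.
by rewrite mcoeffCM mcoeffXU (negbTE kj) mulr0.
Qed.

(** Directness of the splitting: by the degree bound [eps u] is a constant matrix, and a constant
    matrix that annihilates [X] is zero. *)
Lemma eps_mulX_eq0 u : eps u *m X = 0 -> eps u = 0.
Proof.
move=> H; have u2 := msize_of_eps_mulX H.
have epsC i j : eps u i j = mpolyC n (mcoeff (@mnm0 n) (eps u i j)).
  by apply: msize1_polyC; rewrite epsE; apply: msizeD_leq; apply: msize_mderiv.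
apply/matrixP => i j; rewrite [RHS]mxE epsC.
have : (eps u *m X) i 0 = 0 by rewrite H mxE.
rewrite mxE (eq_bigr (fun j => mpolyC n (mcoeff (@mnm0 n) (eps u i j)) * mono j)).
  by move=> /linear_form0 ->; rewrite mpolyC0.
by move=> k _; rewrite coordXE -epsC.
Qed.

(* For [u] homogeneous of degree [S], [eps u x = (S - 1) u + grad (u . x)]; taking
   the product with [x] determines [phi = u . x], and then [u]. *)
Lemma eps_solve_homog s q : (forall i j, q i j \is homog s) -> q^T = q ->
  exists2 u : 'cV[mpoly n R]_n, (forall i, u i 0 \is homog s.+1) & eps u *m X = q *m X.
Proof.
move=> qh qT; pose w := q *m X.
have wE i : w i 0 = \sum_j q i j * mono j.
  by rewrite mxE; apply: eq_bigr => j _; rewrite coordXE.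
have wh i : w i 0 \is homog s.+1.
  by rewrite wE; apply: homog_sum => j _; exact: homog_mulX.
(* For constant [q] the factor S - 1 is zero and the general formula would divide by it; there u = q
   x / 2 works by symmetry of [q]. *)
case: s => [|s] in qh wh *.
  pose u : 'cV[mpoly n R]_n := \col_i (2^-1 *: w i 0).
  have uE i : u i 0 = 2^-1 *: w i 0 by rewrite mxE.
  have uh i : u i 0 \is homog 1 by rewrite uE dhomogZ.
  exists u => //; apply/matrixP => i k; rewrite (ord1 k) eps_mulX.
  rewrite (euler_homog (uh i)) scale1r (mderiv_vdot_coordX i) addrK.
  rewrite (eq_bigr (fun j => 2^-1 *: (q i j * mono j))); last first.
    move=> j _; rewrite uE mderivZ wE mderiv_sum -scalerAl; congr (_ *: (_ * _)).
    rewrite (bigD1 i)//= mderivM homog0_mderiv// mul0r add0r mderiv_mono eqxx mulr1.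
    rewrite big1 ?addr0; first by rewrite -{1}qT mxE.
    move=> l /negbTE li; rewrite mderivM homog0_mderiv// mul0r add0r.
    by rewrite mderiv_mono eq_sym li mulr0.
  rewrite -scaler_sumr -wE uE -scalerDl.
  by rewrite (_ : _ + _ = 1) ?scale1r //; lra.
(* Now S = s + 2, and phi = u . x has degree s + 3; taking the product of w = (s + 1) u + grad phi
   with x gives w . x = (s + 1) phi + (s + 3) phi. *)
pose phi := (2 * s.+2%:R)^-1 *: vdot w X.
have s0 : s.+1%:R != 0 :> R by rewrite pnatr_eq0.
have phih : phi \is homog s.+3.
  apply: dhomogZ; apply: homog_sum => j _; rewrite coordXE; exact: homog_mulX.
have wphi : vdot w X = (2 * s.+2%:R) *: phi.
  by rewrite scalerA divff ?scale1r// mulf_neq0// pnatr_eq0.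
exists (\col_i (s.+1%:R^-1 *: (w i 0 - mderiv i phi))) => [i|].
  by rewrite mxE; apply: dhomogZ; rewrite rpredB// homog_mderiv.
set u := \col_i _.
have uh i : u i 0 \is homog s.+2.
  by rewrite mxE; apply: dhomogZ; rewrite rpredB// homog_mderiv.
have uphi : vdot u X = phi.
  have -> : vdot u X = s.+1%:R^-1 *: (vdot w X - euler phi).
    rewrite -sumrB scaler_sumr; apply: eq_bigr => i _.
    by rewrite [u _ _]mxE coordXE -scalerAl mulrBl.
  rewrite wphi (euler_homog phih) -scalerBl scalerA.
  rewrite (_ : _ * _ = 1) ?scale1r//.
  apply: (mulfI s0); rewrite mulrA divff// mul1r mulr1.
  by rewrite -![_.+1%:R]natr1; ring.
apply/matrixP => i k; rewrite (ord1 k) eps_mulX uphi (euler_homog (uh i)).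
rewrite -/w.
have -> : w i 0 = s.+1%:R *: u i 0 + mderiv i phi.
  by rewrite [u _ _]mxE scalerA divff// scale1r subrK.
rewrite -natr1 scalerDl scale1r.
by rewrite -addrA [u i 0 + _]addrC subrK.
Qed.

Lemma const_linear_eps : const_linear eps.
Proof.
move=> a u v; apply/matrixP => i j; rewrite !mxE !mderivD !mderiv_mulC.
ring.
Qed.

Lemma const_linear_mulX : const_linear (fun q => q *m X).
Proof. by move=> a q q'; rewrite mulmxDl scalemxAl. Qed.

Lemma eps_sum (J : finType) (F : J -> 'cV[mpoly n R]_n) :
  eps (\sum_j F j) = \sum_j eps (F j).
Proof.
have eps0 : eps 0 = 0 := const_linear0 const_linear_eps.
elim/big_rec2 : _ => [//|j a b _ <-].
by have := const_linear_eps 1 (F j) b; rewrite mpolyC1 !scale1r.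
Qed.

(** The other half of the splitting: [q - eps u] lies in the kernel. The equation is solved for each
    homogeneous component of [q]. *)
Lemma eps_solve m q : Psym m q ->
  exists2 u, @Pmx R n m.+1 n 1 u & eps u *m X = q *m X.
Proof.
move=> [qm qT].
have H (s : 'I_m.+1) : exists u : 'cV[mpoly n R]_n, (forall i, u i 0 \is homog s.+1) /\
    eps u *m X = (\matrix_(i, j) pihomog mdeg s (q i j)) *m X.
  have [||u u1 u2] := @eps_solve_homog s (\matrix_(i, j) pihomog mdeg s (q i j)).
  - by move=> i j; rewrite mxE pihomogP.
  - by apply/matrixP => i j; rewrite !mxE -[in LHS]qT mxE.
  by exists u.
have [F HF] := choice H; exists (\sum_s F s).
  move=> i j; rewrite (ord1 j) summxE; apply: msize_sum_leq => s _.
  apply: leq_trans (msize_homog ((HF s).1 i)) _; by rewrite ltnS ltn_ord.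
rewrite eps_sum mulmx_suml (eq_bigr _ (fun s _ => (HF s).2)) -mulmx_suml.
congr (_ *m _); apply/matrixP => i j; rewrite summxE.
rewrite [RHS](pihomog_partitionE (qm i j)); apply: eq_bigr => s _.
by rewrite mxE.
Qed.

Lemma msize_eps m u : @Pmx R n m.+1 n 1 u -> Psym m (eps u).
Proof.
move=> um; split; last by apply/matrixP => i j; rewrite mxE !epsE addrC.
by move=> i j; rewrite epsE; apply: msizeD_leq; apply: msize_mderiv; exact: um.
Qed.

(** If [eps u = 0] then [eps u *m X = 0], which bounds the degree of [u] by one; its linear
    coefficients form [N], skew because [eps u = 0]. Any [m] will do, as rigid motions have degree
    at most one. *)
Lemma RMspaceE m u : @RMspace R n u <-> @Pmx R n m.+1 n 1 u /\ eps u = 0.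
Proof.
split=> [[c [N [NT ->]]]|[um e0]].
  have E i k : (mx_const n c + mx_const n N *m X) i k =
      mpolyC n (c i 0) + \sum_j mpolyC n (N i j) * mono j.
    rewrite (ord1 k) !mxE; congr (_ + _); apply: eq_bigr => j _.
    by rewrite !mxE.
  have dE i j : mderiv j ((mx_const n c + mx_const n N *m X) i 0) = mpolyC n (N i j).
    rewrite E mderivD mderivC add0r mderiv_sum (bigD1 j)//= big1 ?addr0.
      by rewrite mderiv_mulC mderiv_mono eqxx mulr1.
    by move=> k /negbTE kj; rewrite mderiv_mulC mderiv_mono eq_sym kj mulr0.
  split.
    move=> i j; rewrite E; apply: msizeD_leq.
      by rewrite msizeC; case: (_ == _).
    apply: msize_sum_leq => k _; rewrite mul_mpolyC.
    by apply: leq_trans (msizeZ_le _ _) _; rewrite msizeX mdeg1.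
  apply/matrixP => i j; rewrite epsE !dE mxE -mpolyCD.
  have -> : N j i = - N i j by have := congr1 (fun Z : 'M[_]_n => Z i j) NT; rewrite !mxE.
  by rewrite subrr mpolyC0.
have u2 := msize_of_eps_mulX (u := u); rewrite e0 mul0mx in u2.
have {}u2 := u2 erefl.
pose N : 'M[R]_n := \matrix_(i, j) mcoeff (mnm1 j) (u i 0).
have dN i j : mderiv j (u i 0) = mpolyC n (N i j).
  rewrite (@msize1_polyC _ _ (mderiv j (u i 0))) ?msize_mderiv//.
  congr mpolyC; rewrite mcoeff_deriv mnm0E mulr1n mxE.
  by congr mcoeff; apply/mnmP => k; rewrite mnmDE mnm0E add0n.
exists (\col_i mcoeff (@mnm0 n) (u i 0)), N; split.
  apply/matrixP => i j; rewrite [LHS]mxE [RHS]mxE; apply/eqP.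
  rewrite -addr_eq0 -(mpolyC_eq0 n) mpolyCD -!dN addrC.
  by have := congr1 (fun Z : 'M[_]_n => Z i j) e0; rewrite epsE mxE addrC => ->.
apply/matrixP => i k; rewrite (ord1 k) !mxE.
apply/mpolyP => p; rewrite mcoeffD mcoeffC raddf_sum /=.
have [->|p0] := eqVneq p (@mnm0 n).
  rewrite mulr1 big1 ?addr0// => j _.
  by rewrite !mxE mcoeffCM mcoeffX mnm1_eq0 mulr0.
rewrite mulr0 add0r.
have [/eqP p1|p1] := boolP (mdeg p == 1%N).
  have /mdeg1P[j /eqP ->] := introT eqP p1.
  rewrite (bigD1 j)//= big1 => [|l lj].
    by rewrite !mxE mcoeffCM mcoeffXU eqxx mulr1 addr0.
  by rewrite !mxE mcoeffCM mcoeffXU (negbTE lj) mulr0.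
rewrite big1 => [|j _].
  move/msize_coeffP : (u2 i); apply.
  by move: p0 p1; rewrite -mdeg_eq0; case: (mdeg p) => [|[]].
rewrite !mxE mcoeffCM mcoeffX (_ : (_ == p) = false) ?mulr0//.
by apply: contraNF p1 => /eqP <-; rewrite mdeg1.
Qed.

(* [e] is the dimension of the image of [eps], isomorphic to the quotient by RM
   and a complement of the kernel of [q |-> q x]. *)
Lemma dim_RM_kernel m : exists e w,
  [/\ has_dim (@RMspace R n) w, (n * 'C(m.+1 + n, n) - w = e)%N,
     (e <= 'C(n.+1, 2) * 'C(m + n, n))%N &
     has_dim ([set q | q *m X = 0] `&` Psym m) ('C(n.+1, 2) * 'C(m + n, n) - e)].
Proof.
have HP := has_dim_Pcol R n m.+1; have HS := has_dim_Psym R n m.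
have [e He] := has_dim_image const_linear_eps HP.
have [eP Hw] := rank_nullity const_linear_eps HP He.
exists e, (n * 'C(m.+1 + n, n) - e)%N.
(* Multiplication by [X] has the same image on the symmetric gradients as on all of P_m(S), and it
   is injective on the former; so its rank on P_m(S) is [e]. *)
have imE : (fun q => q *m X) @` (eps @` @Pmx R n m.+1 n 1) =
    (fun q => q *m X) @` Psym m.
  apply/seteqP; split=> w /=.
    by move=> [_ [u um <-] <-]; exists (eps u) => //; exact: msize_eps.
  move=> [q qm <-]; have [u um uq] := eps_solve qm.
  by exists (eps u) => //; exists u.
have [i Hi] := has_dim_image const_linear_mulX He.
have [ie Hk] := rank_nullity const_linear_mulX He Hi.
have k0 : eps @` @Pmx R n m.+1 n 1 `&` [set q | q *m X = 0] = [set 0].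
  apply/seteqP; split=> q /=; first by move=> [[u _ <-] /eps_mulX_eq0].
  move=> ->; split; last by rewrite mul0mx.
  exists 0; last exact: const_linear0 const_linear_eps.
  by move=> a b; rewrite mxE /Ppoly /= msize0.
rewrite k0 in Hk; have := has_dim_inj Hk (has_dim0 _) => /eqP.
rewrite subn_eq0 => ei; have {ie ei} iE : i = e by apply/eqP; rewrite eqn_leq ie.
rewrite imE iE in Hi.
have [eS HK] := rank_nullity const_linear_mulX HS Hi.
split => //.
- rewrite (_ : @RMspace R n = @Pmx R n m.+1 n 1 `&` [set v | eps v = 0])//.
  by apply/seteqP; split=> u /(RMspaceE m).
- exact: subKn.
- by rewrite setIC.
Qed.

End SymmetricGradient.

(** * Faces and frames *)

Section Faces.
Import Order.TTheory GRing.Theory Num.Theory.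
Local Open Scope ring_scope.
Local Open Scope classical_set_scope.
Variables (R : realType) (d : nat) (a : 'I_d.+1 -> 'cV[R]_d).

Lemma vdotE (S : comNzRingType) n (u w : 'cV[S]_n) : vdot u w = (u^T *m w) 0 0.
Proof. by rewrite mxE; apply: eq_bigr => j _; rewrite mxE. Qed.

Lemma vdot_mulmx (S : comNzRingType) n m (A : 'M[S]_(n, m)) u w :
  vdot u (A *m w) = vdot (A^T *m u) w.
Proof. by rewrite !vdotE trmx_mul trmxK mulmxA. Qed.

Lemma sum_setT (V : nmodType) (f : 'I_d.+1 -> V) :
  \sum_(i in [set: 'I_d.+1]%SET) f i = \sum_i f i.
Proof. by apply: eq_bigl => i; rewrite inE. Qed.

(** Nondegeneracy says that the matrix with rows (1, a_i^T) is invertible; the columns of its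
    inverse are the pairs (c_i, g_i). *)
Lemma barycentric_exists : nondegenerate_simplex a ->
  exists c g, barycentric [set: 'I_d.+1]%SET c g a.
Proof.
move=> nd; pose B : 'M[R]_(d.+1, 1 + d) := \matrix_i row_mx 1%:M (a i)^T.
have lB (u : 'rV[R]_d.+1) :
    u *m B = row_mx (\sum_i u 0 i)%:M (\sum_i u 0 i *: a i)^T.
  rewrite mulmx_sum_row; under eq_bigr do rewrite rowK scale_row_mx.
  rewrite -[LHS]hsubmxK; congr row_mx.
    rewrite (@linear_sum _ _ _ _ lsubmx) /=.
    under eq_bigr do rewrite row_mxKl scale_scalar_mx mulr1.
    by rewrite -raddf_sum.
  rewrite (@linear_sum _ _ _ _ rsubmx) /= linear_sum /=; apply: eq_bigr => i _.
  by rewrite row_mxKr linearZ.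
have Bu : B \in unitmx.
  rewrite -row_free_unit -kermx_eq0; apply/eqP/row_matrixP => i.
  rewrite row0; apply/rowP => j; rewrite [RHS]mxE.
  have : row i (kermx B) *m B = 0 by rewrite -row_mul mulmx_ker row0.
  rewrite lB => H; apply: (nd (fun j => row i (kermx B) 0 j)).
    have := congr1 lsubmx H; rewrite row_mxKl linear0 => /matrixP/(_ 0 0).
    by rewrite !mxE eqxx mulr1n.
  have := congr1 rsubmx H; rewrite row_mxKr linear0 => /(congr1 trmx).
  by rewrite trmxK trmx0.
pose C : 'M[R]_(1 + d, d.+1) := invmx B.
pose c i : R := usubmx C 0 i.
pose g i : 'cV[R]_d := \col_j dsubmx C j i.
have evE (x : 'cV[R]_d) i : ev x (aff (c i) (g i)) = (row_mx 1%:M x^T *m C) 0 i.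
  rewrite ev_aff -[in RHS](vsubmxK C) mul_row_col mul1mx mxE; congr (_ + _).
  by rewrite mxE; apply: eq_bigr => j _; rewrite !mxE mulrC.
have pt (x : 'cV[R]_d) : row_mx (\sum_i ev x (aff (c i) (g i)))%:M
    (\sum_i ev x (aff (c i) (g i)) *: a i)^T = row_mx 1%:M x^T.
  have := lB (row_mx 1%:M x^T *m C); rewrite mulmxKV// => ->.
  by congr (row_mx _%:M _^T); apply: eq_bigr => i _; rewrite evE.
exists c, g; split.
- apply/eqP; rewrite -subr_eq0; apply/eqP/ev_eq0 => x; rewrite mevalB meval1 raddf_sum.
  have [/matrixP/(_ 0 0)] := eq_row_mx (pt x); rewrite !mxE eqxx !mulr1n.
  by rewrite sum_setT => ->; rewrite subrr.
- move=> i j _ _; rewrite evE.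
  have -> : row_mx 1%:M (a j)^T = row j B by rewrite rowK.
  by rewrite -row_mul mulmxV// !mxE eq_sym.
- move=> x; have [_ /trmx_inj H] := eq_row_mx (pt x).
  by rewrite -[LHS]H; apply: eq_bigl => i; rewrite inE.
Qed.

Variables (c : 'I_d.+1 -> R) (g : 'I_d.+1 -> 'cV[R]_d).
Hypothesis bK : barycentric [set: 'I_d.+1]%SET c g a.
Local Notation l i := (aff (c i) (g i)).
Implicit Types (F : {set 'I_d.+1}) (x : 'cV[R]_d).

Lemma sum_face (V : nmodType) F (f : 'I_d.+1 -> V) : (forall i, i \notin F -> f i = 0) ->
  \sum_(i in F) f i = \sum_i f i.
Proof.
move=> f0; rewrite [RHS](bigID (mem F)) /= [X in _ = _ + X]big1 ?addr0//.
Qed.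

Lemma ev_bary_sumT x : \sum_i ev x (l i) = 1.
Proof. by rewrite -sum_setT (ev_bary_sum bK). Qed.

Lemma bary_pointT x : x = \sum_i ev x (l i) *: a i.
Proof. by rewrite -sum_setT -(bary_point bK). Qed.

Lemma face_coords F (m : 'I_d.+1 -> R) i : \sum_(j in F) m j = 1 ->
  ev (\sum_(j in F) m j *: a j) (l i) = if i \in F then m i else 0.
Proof.
move=> m1; pose m' j := if j \in F then m j else 0.
have -> : \sum_(j in F) m j *: a j = \sum_(j in [set: 'I_d.+1]%SET) m' j *: a j.
  rewrite sum_setT -(@sum_face _ F) => [|j jF]; last by rewrite /m' (negbTE jF) scale0r.
  by apply: eq_bigr => j jF; rewrite /m' jF.
rewrite (bary_coord_uniq bK)//.
rewrite sum_setT -(@sum_face _ F) => [|j jF]; last by rewrite /m' (negbTE jF).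
by rewrite -m1; apply: eq_bigr => j jF; rewrite /m' jF.
Qed.

Lemma face_affE F x : face_aff a F x <-> (forall i, i \notin F -> ev x (l i) = 0).
Proof.
split=> [[m [m1 ->]] i iF|H]; first by rewrite face_coords// (negbTE iF).
exists (fun i => ev x (l i)); split; first by rewrite sum_face ?ev_bary_sumT.
by rewrite sum_face -?bary_pointT// => i /H ->; rewrite scale0r.
Qed.

Lemma face_hullE F x : face_hull a F x <->
  face_aff a F x /\ (forall i, i \in F -> 0 <= ev x (l i)).
Proof.
split=> [[m [m0 m1 xE]]|[/face_affE H H']].
  split; first by exists m.
  by move=> i iF; rewrite xE face_coords// iF.
exists (fun i => ev x (l i)); split.
- by move=> i; have [/H'//|/H ->] := boolP (i \in F).
- by rewrite sum_face ?ev_bary_sumT.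
- by rewrite sum_face -?bary_pointT// => i /H ->; rewrite scale0r.
Qed.

Lemma face_tangentE F x :
  face_tangent a F x <-> (forall i, i \notin F -> vdot (g i) x = 0).
Proof.
split=> [[m [m0 ->]] i iF|H].
  rewrite vdot_sumr (eq_bigr (fun j => - c i * m j)); last first.
    move=> j jF; rewrite vdotZr (bary_vdot_vertex bK) ?inE//.
    rewrite (_ : (i == j) = false) ?sub0r 1?mulrC//.
    by apply: contraNF iF => /eqP ->.
  by rewrite -mulr_sumr m0 mulr0.
exists (fun i => vdot (g i) x); split.
  rewrite sum_face//; under eq_bigr do rewrite vdotC.
  rewrite -vdot_sumr -(sum_setT g) (bary_sum_grad bK) vdot0r//.
rewrite sum_face => [|i /H ->]; last by rewrite scale0r.
by rewrite {1}(bary_vec bK x) sum_setT.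
Qed.

Lemma simplexE : simplex a = bary_simplex [set: 'I_d.+1]%SET c g.
Proof.
apply/seteqP; split=> x; first by move=> /face_hullE[_ H] i; exact: H.
move=> H; apply/face_hullE; split; last exact: H.
by apply/face_affE => i; rewrite inE.
Qed.

Section Frame.
Variables (r : nat) (F : {set 'I_d.+1}) (f : face_frame R d r).
Hypothesis fF : frame_of a F f.
Let T := tangents f.
Let o := origin f.

(** Data of the affine form l_i composed with xi |-> o + T xi: its constant term, its gradient, and
    the vertex a_i in the coordinates of the face. *)
Definition frame_c i : R := ev o (l i).
Definition frame_g i : 'cV[R]_(d - r) := T^T *m g i.
Definition frame_v i : 'cV[R]_(d - r) := T^T *m (a i - o).

Lemma ev_frame (xi : 'cV[R]_(d - r)) i :
  ev xi (aff (frame_c i) (frame_g i)) = ev (frame_point f xi) (l i).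
Proof. by rewrite ev_aff /frame_point ev_affD vdot_mulmx. Qed.

Lemma frame_face_aff xi : face_aff a F (frame_point f xi).
Proof. by case: fF => _ _ _ H; apply/H; exists xi. Qed.

Lemma frame_pointK xi : T^T *m (frame_point f xi - o) = xi.
Proof.
case: fF => _ _ TT _.
by rewrite /frame_point addrC addKr mulmxA TT mul1mx.
Qed.

Lemma frame_point_onto x : face_aff a F x -> frame_point f (T^T *m (x - o)) = x.
Proof. by case: (fF) => _ _ _ H /H[xi ->]; rewrite frame_pointK. Qed.

(** The l_i with i outside [F] vanish on the face, so those with i in [F] already sum to one there.
    All results on simplices thus apply to the face in its own coordinates. *)
Lemma frame_barycentric : barycentric F frame_c frame_g frame_v.
Proof.
have out xi i : i \notin F -> ev (frame_point f xi) (l i) = 0.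
  by move=> iF; apply/face_affE: i iF; exact: frame_face_aff.
split.
- apply/eqP; rewrite -subr_eq0; apply/eqP/ev_eq0 => x; rewrite mevalB meval1 raddf_sum /=.
  under eq_bigr do rewrite ev_frame.
  by rewrite sum_face ?ev_bary_sumT ?subrr// => i; exact: out.
- move=> i j iF jF; rewrite ev_frame frame_point_onto ?(bary_delta bK) ?inE//.
  apply/face_affE => k kF; rewrite (bary_delta bK) ?inE//.
  by rewrite (_ : (k == j) = false)//; apply: contraNF kF => /eqP ->.
- move=> xi; rewrite -[LHS]frame_pointK.
  under eq_bigr do rewrite ev_frame /frame_v scalemxAr.
  rewrite -mulmx_sumr; congr (_ *m _).
  under eq_bigr do rewrite scalerBr.
  rewrite sumrB -scaler_suml !sum_face; last 2 first.
  - by move=> i; exact: out.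
  - by move=> i /out ->; rewrite scale0r.
  by rewrite ev_bary_sumT scale1r -bary_pointT.
Qed.

Lemma frame_simplex : [set xi | face_hull a F (frame_point f xi)] =
  bary_simplex F frame_c frame_g.
Proof.
apply/seteqP; split=> xi /=.
  by move=> /face_hullE[_ H] i /H; rewrite ev_frame.
move=> H; apply/face_hullE; split; first exact: frame_face_aff.
by move=> i /H; rewrite ev_frame.
Qed.

Definition frame_sub (p : mpoly d R) : mpoly (d - r) R :=
  psub (fun i => aff (o i 0) (row i T)^T) p.

Lemma ev_frame_sub xi p : ev xi (frame_sub p) = ev (frame_point f xi) p.
Proof.
rewrite ev_psub; apply: meval_eq => i; rewrite ev_aff mxE; congr (_ + _).
by rewrite mxE; apply: eq_bigr => j _; rewrite !mxE.
Qed.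

Lemma msize_frame_sub p : (msize (frame_sub p) <= msize p)%N.
Proof. by apply: msize_psub => i; exact: msize_aff. Qed.

Lemma tangentsP t : face_tangent a F t -> exists xi, t = T *m xi.
Proof.
case: fF => _ _ _ H tF.
have [x0 x0E] : exists x, x = frame_point f 0 by eexists.
have F0 := frame_face_aff 0.
(* A tangent vector is the difference of two points of the affine hull, both of which the frame
   reaches. *)
have : face_aff a F (frame_point f 0 + t).
  apply/face_affE => i iF; rewrite ev_affD; move/face_affE : F0 => ->//.
  by move/face_tangentE : tF => ->//; rewrite addr0.
move=> /H[xi E]; exists xi; move: E; rewrite /frame_point mulmx0 addr0.
by move=> /addrI.
Qed.

Lemma tangents_tangent xi : face_tangent a F (T *m xi).
Proof.
apply/face_tangentE => i iF; have /face_affE/(_ i iF) := frame_face_aff xi.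
have /face_affE/(_ i iF) := frame_face_aff 0.
by rewrite /frame_point mulmx0 addr0 ev_affD => ->; rewrite add0r.
Qed.

End Frame.

End Faces.

(** * Vanishing degrees of freedom *)

Section Unisolvence.
Import Order.TTheory GRing.Theory Num.Theory.
Local Open Scope ring_scope.
Local Open Scope classical_set_scope.

Section Eval.
Variables (R : realType) (n : nat).
Implicit Types (x : 'cV[R]_n).

Lemma mx_evalM x b c e (A : 'M[mpoly n R]_(b, c)) (B : 'M[mpoly n R]_(c, e)) :
  mx_eval x (A *m B) = mx_eval x A *m mx_eval x B.
Proof. exact: map_mxM. Qed.

Lemma mx_eval_const x b c (A : 'M[R]_(b, c)) : mx_eval x (mx_const n A) = A.
Proof. by apply/matrixP => i j; rewrite !mxE mevalC. Qed.

Lemma ev_vdot x (u w : 'cV[mpoly n R]_n) :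
  ev x (vdot u w) = vdot (mx_eval x u) (mx_eval x w).
Proof.
by rewrite raddf_sum; apply: eq_bigr => j _; rewrite /= mevalM !mxE.
Qed.

Lemma aff_vdot c (g : 'cV[R]_n) : aff c g = mpolyC n c + vdot (mx_const n g) (coordX R n).
Proof.
by congr (_ + _); apply: eq_bigr => j _; rewrite coordXE !mxE mul_mpolyC.
Qed.

Definition frob b c (A B : 'M[mpoly n R]_(b, c)) : mpoly n R :=
  \sum_i \sum_j A i j * B i j.

Lemma ip_simplexE (a : 'I_n.+1 -> 'cV[R]_n) b c (A B : 'M[mpoly n R]_(b, c)) :
  ip_simplex a A B = poly_int (simplex a) (frob A B).
Proof.
congr (int_Rn _ _); apply/funext => x; rewrite /mxdot /mxtrace raddf_sum /=.
under [RHS]eq_bigr do rewrite raddf_sum /=.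
rewrite [RHS]exchange_big /=; apply: eq_bigr => j _.
by rewrite mxE; apply: eq_bigr => i _; rewrite !mxE mevalM.
Qed.

Lemma frob_col (A B : 'cV[mpoly n R]_n) : frob A B = vdot A B.
Proof. by apply: eq_bigr => i _; rewrite big_ord_recl big_ord0 addr0. Qed.

End Eval.

Variables (R : realType) (d k : nat) (a : 'I_d.+1 -> 'cV[R]_d).
Variables (fr : forall r, {set 'I_d.+1} -> face_frame R d r).
Hypotheses (d2 : (2 <= d)%N) (kd : (d.+1 <= k)%N).
Hypothesis frP : forall r F, (1 <= r <= d.-1)%N -> is_face r F ->
  frame_of a F (fr r F).
Variables (c : 'I_d.+1 -> R) (g : 'I_d.+1 -> 'cV[R]_d).
Hypothesis bK : barycentric [set: 'I_d.+1]%SET c g a.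
Local Notation l i := (aff (c i) (g i)).
Variable tau : 'M[mpoly d R]_d.
Hypothesis tauP : Psym k tau.
Hypothesis tau_vertex : dof_vanish (dof_vertex a) tau.
Hypothesis tau_normal : dof_vanish (dof_normal a k fr) tau.
Hypothesis tau_tangential : dof_vanish (dof_tangential a k fr) tau.
Implicit Types (F : {set 'I_d.+1}) (x : 'cV[R]_d).

Lemma int_face_poly r F (f : face_frame R d r) h (p : mpoly (d - r) R) :
  frame_of a F f -> (forall xi, h (frame_point f xi) xi = ev xi p) ->
  int_face a F f h = poly_int (bary_simplex F (frame_c c g f) (frame_g g f)) p.
Proof.
move=> fF hp; rewrite /int_face (frame_simplex bK fF).
by congr (int_Rn _ _); apply/funext => xi.
Qed.

Lemma mx_eval_frame r F (f : face_frame R d r) b e (A : 'M[mpoly d R]_(b, e)) xi :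
  mx_eval xi (map_mx (frame_sub f) A) = mx_eval (frame_point f xi) A.
Proof. by apply/matrixP => i j; rewrite !mxE ev_frame_sub. Qed.

Definition face_normal F (m : 'cV[R]_d) : Prop :=
  forall t, face_tangent a F t -> m^T *m t = 0.

Lemma face_tangentS F F' t : F' \subset F -> face_tangent a F' t -> face_tangent a F t.
Proof.
move=> FF /(face_tangentE bK) H; apply/(face_tangentE bK) => i iF; apply: H.
by apply: contraNN iF; exact: (fintype.subsetP FF).
Qed.

Lemma face_normalS F F' m : F' \subset F -> face_normal F m -> face_normal F' m.
Proof. by move=> FF H t /(face_tangentS FF)/H. Qed.

Definition bil (m m' : 'cV[R]_d) : mpoly d R :=
  ((mx_const d m)^T *m tau *m mx_const d m') 0 0.

Lemma ev_bil x m m' : ev x (bil m m') = (m^T *m mx_eval x tau *m m') 0 0.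
Proof.
have T : mx_eval x (mx_const d m)^T = m^T.
  by apply/matrixP => i j; rewrite !mxE mevalC.
by rewrite -T -[in RHS](mx_eval_const x m') -!mx_evalM [RHS]mxE.
Qed.

Lemma msize_bil m m' : (msize (bil m m') <= k.+1)%N.
Proof.
rewrite /bil mxE; apply: msize_sum_leq => j _; rewrite mulrC.
rewrite [X in X * _]mxE mul_mpolyC; apply: leq_trans (msizeZ_le _ _) _.
rewrite mxE; apply: msize_sum_leq => i _; rewrite !mxE mul_mpolyC.
by apply: leq_trans (msizeZ_le _ _) _; exact: tauP.1.
Qed.

(** Quantifying over all normal vectors lets the induction descend: a normal vector of [F] is also
    normal to every facet of [F], whereas the chosen frames need not be related. The induction
    starts at the vertices, from (1). *)
Lemma normal_vanish F m m' x : (0 < #|F| <= d)%N ->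
  face_normal F m -> face_normal F m' -> face_aff a F x ->
  (m^T *m mx_eval x tau *m m') 0 0 = 0.
Proof.
have [s] := ubnP #|F|; elim: s F m m' x => // s IH F m m' x; rewrite ltnS => Fs.
move=> /andP[F0 Fd] mF m'F xF.
have [F1|F1] := leqP #|F| 1.
  have /cards1P[i FE] : #|F| == 1%N by rewrite eqn_leq F1.
  case: xF => w [w1 xE]; move: w1 xE; rewrite FE !big_set1 => -> ->.
  by rewrite scale1r tau_vertex mulmx0 mul0mx mxE.
pose r := (d.+1 - #|F|)%N.
have r1 : (1 <= r <= d.-1)%N by rewrite /r; lia.
have Fr : is_face r F by rewrite /is_face /r; apply/eqP; lia.
have fF := frP r1 Fr; set f := fr r F in fF.
have bF := frame_barycentric bK fF.
have Gcol (i j : 'I_r) : frame_sub f (bil (col i (normals f)) (col j (normals f))) = 0.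
  set p := bil _ _; set G := frame_sub f p.
  have nF (h : 'I_r) : face_normal F (col h (normals f)).
    move=> t tF; case: fF => _ H _ _; apply/(proj2 (H _)) => //.
    by exists (delta_mx h 0); rewrite colE.
  have G0 u (xi : 'cV[R]_(d - r)) : u \in enum F ->
      ev xi (aff (frame_c c g f u) (frame_g g f u)) = 0 -> ev xi G = 0.
    rewrite mem_enum (ev_frame c g f) => uF xu; rewrite /G ev_frame_sub ev_bil.
    have sF : F :\ u \subset F by apply: subsetDl.
    have cF : #|F| = #|F :\ u|.+1 by rewrite (cardsD1 u F) uF.
    apply: (IH (F :\ u)).
    - by rewrite -cF.
    - by apply/andP; split; lia.
    - exact: face_normalS sF (nF i).
    - exact: face_normalS sF (nF j).
    - apply/(face_affE bK) => h; rewrite !inE negb_and negbK => /orP[/eqP ->//|].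
      have /(face_affE bK) H := frame_face_aff fF xi; exact: H.
  have GN : (msize G <= (k.+1 - #|F|) + size (enum F))%N.
    rewrite -cardE; apply: leq_trans (msize_frame_sub f p) _.
    apply: leq_trans (msize_bil _ _) _; lia.
  have subF : {subset enum F <= F} by move=> h; rewrite mem_enum.
  have [q [Gq qs]] := bary_prod_div bF (enum_uniq _) subF F1 G0 GN.
  (* [msize] is the degree plus one, and k + 1 - #|F| = k + r - d. *)
  have qP : Ppoly (k + r - d - 1) q.
    by rewrite /Ppoly /=; apply: leq_trans qs _; rewrite /r; lia.
  have := tau_normal r1 Fr i j qP.
  rewrite (int_face_poly (p := G * q) fF) => [|xi]; last first.
    by rewrite mevalM /G ev_frame_sub ev_bil.
  rewrite Gq -mulrA -expr2 => I0.
  have q0 := poly_int_sqr bF (J := unit)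
    (w := fun=> \prod_(h <- enum F) aff (frame_c c g f h) (frame_g g f h))
    (u := fun=> q).
  rewrite (q0 _ _ _ tt) ?mulr0//.
  - move=> _ y Dy; rewrite rmorph_prod big_seq; apply: prodr_ge0 => h.
    by rewrite mem_enum => hF; exact: Dy.
  - move=> _; rewrite prodf_seq_neq0; apply/allP => h; rewrite mem_enum => hF.
    exact: (bary_neq0 bF).
  - by rewrite (bigD1 tt)//= [X in _ + X]big1 ?addr0//; case.
have [w mE] : exists w, m = normals f *m w.
  by case: fF => _ H _ _; apply/H => t /mF.
have [w' m'E] : exists w, m' = normals f *m w.
  by case: fF => _ H _ _; apply/H => t /m'F.
rewrite mE m'E trmx_mul.
have -> : w^T *m (normals f)^T *m mx_eval x tau *m (normals f *m w') =
   w^T *m ((normals f)^T *m mx_eval x tau *m normals f) *m w'.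
  by rewrite !mulmxA.
have -> : (normals f)^T *m mx_eval x tau *m normals f = 0.
  apply/matrixP => i j; rewrite [RHS]mxE.
  have := congr1 (meval (fun h => ((tangents f)^T *m (x - origin f)) h 0)) (Gcol i j).
  rewrite meval0 ev_frame_sub (frame_point_onto fF xF) ev_bil => H.
  have E (M : 'M[R]_r) : M i j = ((delta_mx 0 i : 'rV_r) *m M *m (delta_mx j 0 : 'cV_r)) 0 0.
    by rewrite -rowE -colE !mxE.
  by rewrite -[RHS]H E tr_col rowE colE !mulmxA.
by rewrite mulmx0 mul0mx mxE.
Qed.

Lemma mxdot_cV n (u w : 'cV[R]_n) : mxdot u w = vdot u w.
Proof. by rewrite /mxdot vdotE /mxtrace big_ord_recl big_ord0 addr0. Qed.

(** On the facet opposite to vertex [i0], [g i0] is a multiple of the unit normal n. The tangential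
    part of tau n vanishes by (3), its normal part by [normal_vanish]. *)
Lemma face_kill i0 x : ev x (l i0) = 0 -> mx_eval x tau *m g i0 = 0.
Proof.
move=> xi0; pose F := (~: [set i0])%SET.
have cF : #|F| = d by rewrite cardsC1 card_ord.
have r1 : (1 <= 1 <= d.-1)%N by move: d2; case: (d) => [|[]].
have F1 : is_face 1 F by rewrite /is_face cF; apply/eqP; lia.
have fF := frP r1 F1; set f := fr 1 F in fF.
have bF := frame_barycentric bK fF.
pose n := normals f; pose T := tangents f.
pose cc := frame_c c g f; pose gg := frame_g g f.
have nF : face_normal F n.
  move=> t tF; case: fF => _ H _ _; apply/(proj2 (H _)) => //.
  by exists 1%:M; rewrite mulmx1.
have gn i : i \notin F -> face_normal F (g i).
  move=> iF t /(face_tangentE bK)/(_ i iF) H; apply/matrixP => p q.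
  by rewrite (ord1 p) (ord1 q) -vdotE H mxE.
have nT (xi : 'cV[R]_(d - 1)) : n^T *m (T *m xi) = 0.
  by apply: nF; exact: (tangents_tangent bK fF).
pose w : 'cV[mpoly (d - 1) R]_(d - 1) :=
  mx_const (d - 1) T^T *m map_mx (frame_sub f) tau *m mx_const (d - 1) n.
have ev_w xi : mx_eval xi w = T^T *m mx_eval (frame_point f xi) tau *m n.
  by rewrite !mx_evalM !mx_eval_const mx_eval_frame.
pose G i := vdot (mx_const (d - 1) (gg i)) w.
have ev_G xi i : ev xi (G i) = vdot (gg i) (mx_eval xi w).
  by rewrite ev_vdot mx_eval_const.
have G0 i xi : i \in F -> ev xi (aff (cc i) (gg i)) = 0 -> ev xi (G i) = 0.
  move=> iF; rewrite (ev_frame c g f) => xl; rewrite ev_G ev_w.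
  rewrite vdotE !mulmxA -[_^T *m T^T]trmx_mul.
  have sF : F :\ i \subset F by apply: subsetDl.
  have cF' : #|F| = #|F :\ i|.+1 by rewrite (cardsD1 i F) iF.
  apply: (normal_vanish (F := F :\ i)).
  (* The vector T gg_i is the tangential part of g_i; paired with tangent vectors of the ridge
     [F :\ i] it gives the same values as g_i, namely zero. So it is a normal vector of the
     ridge. *)
  - have := cF'; rewrite cF; move: #|F :\ i| => N dN.
    by move: d2; rewrite dN; lia.
  - move=> t tF; have [xi' tE] := tangentsP bK fF (face_tangentS sF tF).
    have TT : T^T *m (T *m xi') = xi'.
      by case: fF => _ _ TT _; rewrite mulmxA TT mul1mx.
    rewrite tE trmx_mul -mulmxA TT /gg /frame_g trmx_mul trmxK -mulmxA -tE.
    apply/matrixP => p q; rewrite (ord1 p) (ord1 q) [RHS]mxE -vdotE; move/(face_tangentE bK) : tF; apply.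
    by rewrite !inE eqxx.
  - exact: face_normalS sF nF.
  - apply/(face_affE bK) => h; rewrite !inE negb_and negbK => /orP[/eqP ->//|hF].
    by have /(face_affE bK) H := frame_face_aff fF xi; apply: H; rewrite !inE.
have wk j : (msize (w j 0)%R <= k.+1)%N.
  rewrite mxE; apply: msize_sum_leq => p _; rewrite mulrC [X in X * _]mxE mul_mpolyC.
  apply: leq_trans (msizeZ_le _ _) _; rewrite mxE.
  apply: msize_sum_leq => q _; rewrite [X in X * _]mxE mul_mpolyC.
  apply: leq_trans (msizeZ_le _ _) _; rewrite mxE.
  by apply: leq_trans (msize_frame_sub f _) _; exact: tauP.1.
have Gk i : (msize (G i) <= k.+1)%N.
  apply: msize_sum_leq => j _; rewrite [X in X * _]mxE mul_mpolyC.
  exact: leq_trans (msizeZ_le _ _) _.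
have : forall i, exists p, [/\ (msize p <= k)%N, i \in F -> G i = aff (cc i) (gg i) * p
    & i \notin F -> p = 0].
  move=> i; have [iF|iF] := boolP (i \in F); last by exists 0; rewrite msize0.
  have F2 : (1 < #|F|)%N by rewrite cF.
  have [e ge] := bary_dir bF F2 iF.
  have [p [pE ps]] := vanish_div ge (fun xi => @G0 i xi iF) (Gk i).
  by exists p; split => //.
move=> /choice[psi psiP].
pose q : 'cV[mpoly (d - 1) R]_(d - 1) := \sum_(i in F) psi i *: mx_const (d - 1) (gg i).
have sumG : \sum_(i in F) G i = 0.
  rewrite /G; under eq_bigr do rewrite vdotC.
  rewrite -vdot_sumr (_ : \sum_(i in F) _ = 0) ?vdot0r//.
  apply/matrixP => p p'; rewrite (ord1 p') summxE [RHS]mxE.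
  have H := congr1 (fun v : 'cV[R]_(d - 1) => v p 0) (bary_sum_grad bF).
  rewrite summxE mxE in H.
  under eq_bigr do rewrite mxE.
  by rewrite -raddf_sum /= H mpolyC0.
have sumlp : \sum_(i in F) aff (cc i) (gg i) * psi i = 0.
  by rewrite -[RHS]sumG; apply: eq_bigr => i iF; case: (psiP i) => _ ->.
have k2 : (k - 2).+2 = k by lia.
have qND : NDspace (k - 2) q.
  apply/NDspaceE; rewrite k2; split.
    move=> p p'; rewrite summxE /Ppoly /=; have -> : (k - 2).+2 = k by lia.
    apply: msize_sum_leq => i _; rewrite !mxE mulrC mul_mpolyC.
    by apply: leq_trans (msizeZ_le _ _) _; case: (psiP i).
  (* q . x = sum_i psi_i (l_i - c_i), and sum_i l_i psi_i = 0. What remains has degree at most k -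
     1, so the part of degree k vanishes, as [NDspaceE] demands. *)
  have -> : vdot q (coordX R (d - 1)) = - \sum_(i in F) psi i * mpolyC (d - 1) (cc i).
    rewrite -[RHS]add0r -[X in X - _]sumlp vdotC vdot_sumr -sumrB.
    apply: eq_bigr => i _; rewrite vdotZr aff_vdot [in LHS]vdotC; ring.
  apply/mpolyP => m; rewrite mcoeff_pihomog mcoeff0; case: ifP => // /eqP mk.
  rewrite mcoeffN raddf_sum big1 ?oppr0// => i _ /=.
  rewrite mulrC mcoeffCM; case: (psiP i) => /msize_coeffP -> //; rewrite ?mulr0//.
  by rewrite mk.
have := tau_tangential F1 qND.
(* The projection disappears under [T^T], because T^T n = 0. *)
rewrite (int_face_poly (p := vdot w q) fF) => [I0|xi]; last first.
  rewrite /= mxdot_cV /proj_face ev_vdot ev_w vdot_mulmx -/f -/n -/T.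
  congr vdot; rewrite mulmxA mulmxBr mulmx1 -!mulmxA.
  rewrite (_ : T^T *m (n *m _) = 0) ?subr0// mulmxA.
  rewrite (_ : T^T *m n = 0) ?mul0mx//.
  apply: trmx_inj; rewrite trmx_mul trmxK trmx0; apply/matrixP => p p'.
  have := nT (delta_mx p' 0); rewrite mulmxA -colE => /matrixP/(_ p 0).
  by rewrite !mxE.
have psi0 : forall i, psi i = 0.
  (* Outside [F] the weight is 1 and [psi] is 0, which lets the sum run over the whole index
     type. *)
  have := poly_int_sqr bF (w := fun i => if i \in F then aff (cc i) (gg i) else 1)
    (u := psi); apply.
  - move=> i xi Dx; case: ifP => iF; last by rewrite meval1.
    exact: Dx.
  - by move=> i; case: ifP => iF; [exact: (bary_neq0 bF)|exact: oner_neq0].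
  - rewrite -[RHS]I0; congr (poly_int _ _).
    rewrite vdot_sumr [RHS]big_mkcond /=; apply: eq_bigr => i _.
    case: (psiP i) => _ H1 H2; case: ifP => iF; last first.
      by rewrite H2 ?iF// expr0n mulr0.
    by rewrite vdotZr vdotC -/(G i) H1// mulrCA.
have w0 xi : mx_eval xi w = 0.
  rewrite (bary_vec bF (mx_eval xi w)) big1// => i iF.
  by rewrite -ev_G; case: (psiP i) => _ -> // _; rewrite psi0 mulr0 meval0 scale0r.
have xF : face_aff a F x.
  by apply/(face_affE bK) => i; rewrite !inE negbK => /eqP ->.
(* Since [w] vanishes, tau n is orthogonal to the face, hence a multiple of n; its product with n is
   zero by [normal_vanish]. *)
pose z := mx_eval x tau *m n.
have zn : face_normal F z.
  move=> t tF; have [xi' ->] := tangentsP bK fF tF.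
  have := w0 (T^T *m (x - origin f)).
  rewrite ev_w (frame_point_onto fF xF) -mulmxA -/z => H.
  by rewrite mulmxA -[z^T *m _]trmxK trmx_mul trmxK H trmx0 mul0mx.
have z0 : z = 0.
  have [b zE] : exists b, z = n *m b by case: fF => _ H _ _; apply/H.
  have nn : n^T *m n = 1%:M by case: fF.
  have : n^T *m z = 0.
    apply/matrixP => p q'; rewrite (ord1 p) (ord1 q') [RHS]mxE /z mulmxA.
    by apply: (normal_vanish (F := F)) => //; rewrite cF leqnn andbT; move: d2; lia.
  by rewrite zE mulmxA nn mul1mx => ->; rewrite mulmx0.
have [b gE] : exists b, g i0 = n *m b.
  case: fF => _ H _ _; apply/H; apply: gn; by rewrite !inE eqxx.
by rewrite gE mulmxA -/z z0 mul0mx.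
Qed.

Lemma mpoly_evalP n (p q : mpoly n R) :
  (forall x : 'cV[R]_n, ev x p = ev x q) -> p = q.
Proof.
by move=> H; apply/eqP; rewrite -subr_eq0; apply/eqP/ev_eq0 => x; rewrite mevalB H subrr.
Qed.

Lemma bilC m m' : bil m m' = bil m' m.
Proof.
apply: mpoly_evalP => x; rewrite !ev_bil.
have tT : (mx_eval x tau)^T = mx_eval x tau.
  by rewrite -{2}tauP.2; apply/matrixP => i j; rewrite !mxE.
have E (A : 'M[R]_1) : A 0 0 = A^T 0 0 by rewrite mxE.
by rewrite [LHS]E !trmx_mul tT trmxK mulmxA.
Qed.

(** By [face_kill] and the symmetry of tau, an off-diagonal entry vanishes on both facets l_i = 0
    and l_j = 0. Setting [psi i i = 0] lets later sums range over all pairs. *)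
Lemma bil_div : exists psi : 'I_d.+1 -> 'I_d.+1 -> mpoly d R, forall i j,
  [/\ (msize (psi i j) <= k.-1)%N, i != j -> bil (g i) (g j) = l i * l j * psi i j
    & i = j -> psi i j = 0].
Proof.
have : forall ij : 'I_d.+1 * 'I_d.+1, exists p : mpoly d R, [/\ (msize p <= k.-1)%N,
    ij.1 != ij.2 -> bil (g ij.1) (g ij.2) = l ij.1 * l ij.2 * p & ij.1 = ij.2 -> p = 0].
  move=> [i j] /=; have [<-|ij] := eqVneq i j; first by exists 0; rewrite msize0.
  have T1 : (1 < #|[set: 'I_d.+1]%SET|)%N by rewrite cardsT card_ord; lia.
  have u2 : uniq [:: i; j] by rewrite /= inE ij.
  have sT : {subset [:: i; j] <= [set: 'I_d.+1]%SET} by move=> h _; rewrite inE.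
  have bs : (msize (bil (g i) (g j)) <= k.-1 + size [:: i; j])%N.
    by apply: leq_trans (msize_bil _ _) _; rewrite /=; lia.
  have b0 h x : h \in [:: i; j] -> ev x (l h) = 0 -> ev x (bil (g i) (g j)) = 0.
    rewrite !inE => /orP[] /eqP -> /face_kill H; last first.
      by rewrite ev_bil -mulmxA H mulmx0 mxE.
    by rewrite bilC ev_bil -mulmxA H mulmx0 mxE.
  have [p [pE ps]] := bary_prod_div bK u2 sT T1 b0 bs.
  exists p; split => // [_|/eqP]; last by rewrite (negbTE ij).
  by rewrite pE big_cons big_seq1.
by move=> /choice[psi H]; exists (fun i j => psi (i, j)) => i j; exact: H (i, j).
Qed.

Lemma bil_row_sum i : \sum_j bil (g i) (g j) = 0.
Proof.
apply: mpoly_evalP => x; rewrite meval0 raddf_sum /=.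
under eq_bigr do rewrite ev_bil.
by rewrite -summxE -mulmx_sumr -(sum_setT g) (bary_sum_grad bK) mulmx0 mxE.
Qed.

(** Insert sum_i a_i g_i^T = I, the matrix form of [bary_vec], on both sides of tau. *)
Lemma tau_expand p q :
  tau p q = \sum_i \sum_j (a i p 0 * a j q 0) *: bil (g i) (g j).
Proof.
apply: mpoly_evalP => x; rewrite raddf_sum /=.
under [RHS]eq_bigr do rewrite raddf_sum /=.
have A1 : \sum_i a i *m (g i)^T = 1%:M.
  apply/matrixP => s t.
  have := congr1 (fun v : 'cV[R]_d => v s 0) (bary_vec bK (delta_mx t 0)).
  rewrite sum_setT mxE eqxx andbT => H; rewrite [RHS]mxE H !summxE.
  apply: eq_bigr => i _; rewrite !mxE big_ord_recl big_ord0 addr0 mulrC mxE.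
  by congr (_ * _); rewrite /vdot (bigD1 t)//= !mxE !eqxx mulr1 big1 ?addr0// => s' /negbTE st;
    rewrite !mxE st mulr0.
have -> : ev x (tau p q) = mx_eval x tau p q by rewrite mxE.
rewrite -[mx_eval x tau]mul1mx -[mx_eval x tau]mulmx1 -{1}A1 -trmx1 -A1.
rewrite mulmx_suml summxE; apply: eq_bigr => i _.
rewrite linear_sum /= !mulmx_sumr summxE; apply: eq_bigr => j _.
rewrite mevalZ ev_bil trmx_mul trmxK.
have -> : a i *m (g i)^T *m (mx_eval x tau *m (g j *m (a j)^T)) =
    a i *m ((g i)^T *m mx_eval x tau *m g j) *m (a j)^T by rewrite !mulmxA.
rewrite [LHS]mxE big_ord_recl big_ord0 addr0 [(a j)^T _ _]mxE.
rewrite [X in X * _]mxE big_ord_recl big_ord0 addr0; ring.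
Qed.

Lemma frob_outer (u w : 'cV[R]_d) : frob tau (mx_const d u *m (mx_const d w)^T) = bil u w.
Proof.
rewrite /bil mxE /frob [LHS]exchange_big /=; apply: eq_bigr => j _.
rewrite mxE mulr_suml; apply: eq_bigr => i _.
by rewrite !mxE big_ord_recl big_ord0 addr0 !mxE; ring.
Qed.

Lemma frobD b e (A B C : 'M[mpoly d R]_(b, e)) : frob A (B + C) = frob A B + frob A C.
Proof.
rewrite -big_split; apply: eq_bigr => i _; rewrite -big_split; apply: eq_bigr => j _.
by rewrite mxE mulrDr.
Qed.

Lemma frobZ b e (A B : 'M[mpoly d R]_(b, e)) p : frob A (p *: B) = p * frob A B.
Proof.
rewrite mulr_sumr; apply: eq_bigr => i _; rewrite mulr_sumr; apply: eq_bigr => j _.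
by rewrite mxE mulrCA.
Qed.

Lemma frob_sumr (J : finType) b e (A : 'M[mpoly d R]_(b, e)) (B : J -> 'M[mpoly d R]_(b, e)) :
  frob A (\sum_j B j) = \sum_j frob A (B j).
Proof.
elim/big_rec2 : _ => [|j x y _ <-]; last by rewrite frobD.
by rewrite /frob big1// => i _; rewrite big1// => j _; rewrite mxE mulr0.
Qed.

Lemma interior_eq0 : dof_vanish (dof_interior a k) tau -> tau = 0.
Proof.
move=> tauI; have [psi psiP] := bil_div.
pose S i j : 'M[mpoly d R]_d := mx_const d (g i) *m (mx_const d (g j))^T.
pose q : 'M[mpoly d R]_d := \sum_(ij : 'I_d.+1 * 'I_d.+1)
   psi ij.1 ij.2 *: (S ij.1 ij.2 + S ij.2 ij.1).
have ST i j : (S i j)^T = S j i by rewrite trmx_mul trmxK.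
have qP : Psym (k - 2) q.
  split; last first.
    rewrite linear_sum /=; apply: eq_bigr => ij _.
    by rewrite linearZ linearD /= !ST [in LHS]addrC.
  move=> p s; rewrite summxE; apply: msize_sum_leq => ij _; rewrite !mxE !big_ord_recl.
  rewrite !big_ord0 !mxE !addr0 -!mpolyCM -mpolyCD mulrC mul_mpolyC.
  apply: leq_trans (msizeZ_le _ _) _.
  by case: (psiP ij.1 ij.2) => H _ _; apply: leq_trans H _; lia.
have := tauI q qP; rewrite ip_simplexE (simplexE bK) => I0.
have psi0 : forall ij : 'I_d.+1 * 'I_d.+1, psi ij.1 ij.2 = 0.
  (* The factor 2 appears because both halves of the symmetrized dyad pair with tau to the same
     value. *)
  have := poly_int_sqr bK (w := fun ij : 'I_d.+1 * 'I_d.+1 => 2%:R *: (l ij.1 * l ij.2))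
    (u := fun ij => psi ij.1 ij.2); apply.
  - by move=> ij x Dx; rewrite mevalZ mulr_ge0// mevalM mulr_ge0// Dx// inE.
  - by move=> ij; rewrite scaler_eq0 pnatr_eq0 /= mulf_neq0// (bary_neq0 bK)// inE.
  rewrite -[RHS]I0; congr (poly_int _ _); rewrite frob_sumr; apply: eq_bigr => ij _.
  rewrite frobZ frobD !frob_outer [bil (g ij.2) _]bilC.
  case: (psiP ij.1 ij.2) => _ H1 H2.
  have [e|ne] := eqVneq ij.1 ij.2; first by rewrite H2// expr0n mulr0 mul0r.
  by rewrite H1// scaler_nat; ring.
have offdiag i j : i != j -> bil (g i) (g j) = 0.
  by move=> ij; case: (psiP i j) => _ -> // _; rewrite (psi0 (i, j)) mulr0.
(* Zero row sums carry the vanishing over to the diagonal. *)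
have all0 i j : bil (g i) (g j) = 0.
  have [<-|] := eqVneq i j; last exact: offdiag.
  rewrite -[RHS](bil_row_sum i) (bigD1 i)//= big1 ?addr0// => h hi.
  by rewrite offdiag// eq_sym.
apply/matrixP => p s; rewrite tau_expand mxE big1// => i _; rewrite big1// => j _.
by rewrite all0 scaler0.
Qed.

(** Expand (a_j - a_i)(a_j - a_i)^T: the two squares vanish because rows and columns of the entries
    sum to zero, and each cross term contributes -tau by [tau_expand]. *)
Lemma tau_tangents p q : (- 2) *: tau p q =
  \sum_i \sum_j ((a j - a i) p 0 * (a j - a i) q 0) *: bil (g i) (g j).
Proof.
pose M i j := bil (g i) (g j).
have rs i : \sum_j M i j = 0 := bil_row_sum i.
have cs j : \sum_i M i j = 0.
  by rewrite -[RHS](bil_row_sum j); apply: eq_bigr => i _; exact: bilC.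
have E i j : ((a j - a i) p 0 * (a j - a i) q 0) *: M i j =
    ((a j p 0 * a j q 0) *: M i j + (a i p 0 * a i q 0) *: M i j) -
    ((a j p 0 * a i q 0) *: M i j + (a i p 0 * a j q 0) *: M i j).
  rewrite -!scalerDl -scalerBl; congr (_ *: _); rewrite !mxE; ring.
rewrite -/M.
under eq_bigr do under eq_bigr do rewrite E.
under eq_bigr do rewrite sumrB !big_split /=.
rewrite sumrB !big_split /=.
have -> : \sum_i \sum_j (a j p 0 * a j q 0) *: M i j = 0.
  by rewrite exchange_big big1// => j _; rewrite -scaler_sumr cs scaler0.
have -> : \sum_i \sum_j (a i p 0 * a i q 0) *: M i j = 0.
  by rewrite big1// => i _; rewrite -scaler_sumr rs scaler0.
have -> : \sum_i \sum_j (a j p 0 * a i q 0) *: M i j = tau p q.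
  rewrite tau_expand exchange_big; apply: eq_bigr => j _; apply: eq_bigr => i _.
  by rewrite /M bilC.
by rewrite -tau_expand addr0 sub0r scaleNr scaler_nat mulr2n.
Qed.

Lemma frob_symmetric_eps u : frob tau (eps u) = 2%:R *: frob tau (jac u).
Proof.
rewrite /eps frobD scaler_nat mulr2n; congr (_ + _).
rewrite /frob exchange_big; apply: eq_bigr => i _; apply: eq_bigr => j _ /=.
by rewrite [(jac u)^T _ _]mxE -[in LHS]tauP.2 mxE.
Qed.

Lemma divergence_product u : vdot (mx_div tau) u + frob tau (jac u) =
  \sum_q mderiv q (\sum_p tau p q * u p 0).
Proof.
under [RHS]eq_bigr do rewrite mderiv_sum.
rewrite exchange_big -big_split; apply: eq_bigr => p _ /=.
under [RHS]eq_bigr do rewrite mderivM.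
rewrite big_split /=; congr (_ + _); first by rewrite mxE mulr_suml.
by apply: eq_bigr => q _; rewrite mxE.
Qed.

(** The integrand is 2 div(tau u). By [tau_tangents] it is minus a sum of derivatives of l_i l_j
    psi_ij (t_ij . u) along t_ij, and each of them integrates to zero. *)
Lemma green u : poly_int (simplex a) (2%:R *: vdot (mx_div tau) u + frob tau (eps u)) = 0.
Proof.
rewrite frob_symmetric_eps -scalerDr divergence_product (simplexE bK).
have [psi psiP] := bil_div.
pose t i j := a j - a i.
pose tu i j := vdot (mx_const d (t i j)) u.
have E : (2%:R : R) *: (\sum_q mderiv q (\sum_p tau p q * u p 0)) =
    - \sum_i \sum_j ddir (t i j) (bil (g i) (g j) * tu i j).
  have Eq q : - ((2%:R : R) *: (\sum_p tau p q * u p 0)) =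
      \sum_i \sum_j (t i j q 0) *: (bil (g i) (g j) * tu i j).
    rewrite -scaleNr scaler_sumr.
    under eq_bigr do rewrite scalerAl tau_tangents mulr_suml.
    rewrite exchange_big; apply: eq_bigr => i _ /=.
    under eq_bigr do rewrite mulr_suml.
    rewrite exchange_big; apply: eq_bigr => j _ /=.
    rewrite /tu mulr_sumr scaler_sumr; apply: eq_bigr => p _.
    by rewrite [mx_const _ _ _ _]mxE mulrCA mul_mpolyC scalerA -scalerAl [X in X *: _]mulrC.
  rewrite -[LHS]opprK; congr (- _); rewrite scaler_sumr -sumrN.
  have -> : \sum_q - ((2%:R : R) *: mderiv q (\sum_p tau p q * u p 0)) =
     \sum_q mderiv q (\sum_i \sum_j (t i j q 0) *: (bil (g i) (g j) * tu i j)).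
    by apply: eq_bigr => q _; rewrite -Eq mderivN mderivZ.
  under eq_bigr do rewrite mderiv_sum.
  rewrite exchange_big; apply: eq_bigr => i _ /=.
  under eq_bigr do rewrite mderiv_sum.
  rewrite exchange_big; apply: eq_bigr => j _ /=.
  by apply: eq_bigr => q _; rewrite mderivZ.
rewrite E -scaleN1r (poly_intZ bK) (poly_int_sum bK) big1 ?mulr0// => i _.
rewrite (poly_int_sum bK) big1// => j _; case: (psiP i j) => _ H _.
have [<-|ij] := eqVneq i j.
  rewrite /t subrr (_ : ddir _ _ = 0) ?(poly_int0 bK)//.
  by rewrite /ddir big1// => q _; rewrite mxE scale0r.
by rewrite H// -[_ * _ * tu i j]mulrA (bary_edge_green bK) ?inE.
Qed.

Lemma div_ker_interior : dof_vanish (dof_div a k) tau ->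
  dof_vanish (dof_ker a k) tau -> dof_vanish (dof_interior a k) tau.
Proof.
move=> tauD tauK.
have k1 : (k - 1)%N = (k - 2).+1 by lia.
have IE u : poly_int (simplex a) (frob tau (eps u)) =
    - (2%:R * poly_int (simplex a) (vdot (mx_div tau) u)).
  have := green u; rewrite (simplexE bK) (poly_intD bK) (poly_intZ bK).
  by move/eqP; rewrite addrC addr_eq0 => /eqP.
(* By Green's formula [mx_div tau] is orthogonal to the rigid motions, so it is itself an admissible
   test field in (5). *)
have div0 : mx_div tau = 0.
  have : ip_simplex a (mx_div tau) (mx_div tau) = 0.
    apply: tauD; split.
      move=> i j; rewrite mxE; apply: msize_sum_leq => h _.
      by rewrite k1; apply: msize_mderiv; apply: leq_trans (tauP.1 i h) _; lia.
    move=> B /(RMspaceE 0)[_ B0]; rewrite ip_simplexE frob_col.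
    have := IE B; rewrite B0 (_ : frob tau 0 = 0); last first.
      by rewrite /frob big1// => i _; rewrite big1// => j _; rewrite mxE mulr0.
    rewrite (simplexE bK) (poly_int0 bK) => /esym/eqP.
    by rewrite oppr_eq0 mulf_eq0 pnatr_eq0 /= => /eqP.
  rewrite ip_simplexE frob_col (simplexE bK) => I0.
  have := poly_int_sqr bK (w := fun=> 1) (u := fun i => mx_div tau i 0).
  move=> H; apply/matrixP => i j; rewrite (ord1 j) [RHS]mxE; apply: H.
  - by move=> _ x _; rewrite meval1.
  - by move=> _; exact: oner_neq0.
  - by rewrite -[RHS]I0; congr poly_int; apply: eq_bigr => h _; rewrite mul1r expr2.
move=> q qP /=.
have [u um uq] := eps_solve qP.
(* The first summand is handled by (6), the second by Green's formula and [div0]. *)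
have -> : q = (q - eps u) + eps u by rewrite subrK.
rewrite ip_simplexE frobD (simplexE bK) (poly_intD bK) -(simplexE bK).
rewrite IE div0 vdotC vdot0r -ip_simplexE (tauK (q - eps u)); last first.
  split; first by rewrite /ker_coord /= mulmxBl uq subrr.
  have [e1 e2] := msize_eps um; split; last by rewrite linearB /= e2 qP.2.
  by move=> i j; rewrite !mxE -epsE; apply: msizeB_leq; [exact: qP.1|exact: e1].
by rewrite (simplexE bK) (poly_int0 bK) mulr0 oppr0 addr0.
Qed.

End Unisolvence.

(** * Counting degrees of freedom *)

Section Counting.
Import Order.TTheory GRing.Theory Num.Theory.
Local Open Scope ring_scope.
Local Open Scope classical_set_scope.

(* The Gram matrix of a basis of [W] is invertible, so testing against [W] maps
   [S] onto the constant vectors. *)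
Lemma has_dim_orthogonal (R : realType) n (V : lmodType (mpoly n R))
    (ip : V -> V -> R) (S W : set V) N w :
  (forall a u v z, ip (mpolyC n a *: u + v) z = a * ip u z + ip v z) ->
  (forall u v, ip u v = ip v u) -> (forall u, ip u u = 0 -> u = 0) ->
  has_dim S N -> has_dim W w -> W `<=` S ->
  has_dim [set v | S v /\ forall z, W z -> ip v z = 0] (N - w).
Proof.
move=> ipL ipC ip0 HS /has_dimP[b b1 WE] WS.
have ip0l z : ip 0 z = 0.
  have := ipL 1 0 0 z; rewrite mpolyC1 scale1r addr0 mul1r => /eqP.
  by rewrite -subr_eq0 opprD addNKr oppr_eq0 => /eqP.
have ip_lcomb (c : 'I_w -> R) z : ip (lcomb b c) z = \sum_k c k * ip (b k) z.
  rewrite /lcomb; elim: (index_enum _) => [|i s IH]; first by rewrite !big_nil ip0l.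
  by rewrite !big_cons ipL IH.
pose f v : 'cV[mpoly n R]_w := \col_k mpolyC n (ip v (b k)).
have fL : const_linear f.
  by move=> e u v; apply/matrixP => i j; rewrite !mxE ipL mpolyCD mpolyCM.
pose G : 'M[R]_w := \matrix_(i, j) ip (b i) (b j).
have Gu : G \in unitmx.
  rewrite -row_free_unit -kermx_eq0; apply/eqP/row_matrixP => i.
  rewrite row0; set u := row i _.
  have uG : u *m G = 0 by rewrite /u -row_mul mulmx_ker row0.
  have : ip (lcomb b (u 0)) (lcomb b (u 0)) = 0.
    rewrite ip_lcomb big1// => k _; rewrite ipC ip_lcomb.
    have := congr1 (fun v : 'rV[R]_w => v 0 k) uG; rewrite mxE [RHS]mxE => H.
    rewrite (eq_bigr (fun j => u 0 j * G j k)) ?H ?mulr0// => j _.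
    by rewrite [G _ _]mxE.
  by move=> /ip0/b1 H; apply/rowP => j; rewrite H mxE.
have imE : f @` S = spanned (fun k : 'I_w => delta_mx k 0 : 'cV[mpoly n R]_w).
  have de c : lcomb (fun k : 'I_w => delta_mx k 0 : 'cV[mpoly n R]_w) c =
      \col_k mpolyC n (c k).
    apply/matrixP => i j; rewrite (ord1 j) summxE mxE (bigD1 i)//= big1.
      by rewrite !mxE !eqxx mulr1 addr0.
    by move=> h /negbTE hi; rewrite !mxE eq_sym hi mulr0.
  apply/seteqP; split=> y /=.
    by move=> [v _ <-]; exists (fun k => ip v (b k)); rewrite de.
  move=> [c ->]; pose u : 'rV[R]_w := (\row_k c k) *m invmx G.
  exists (lcomb b (u 0)); first by apply: WS; rewrite WE; exists (u 0).
  rewrite de; apply/matrixP => i j; rewrite !mxE ip_lcomb; congr mpolyC.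
  have := congr1 (fun v : 'rV[R]_w => v 0 i) (mulmxKV Gu (\row_k c k)).
  rewrite [RHS]mxE => <-; rewrite [RHS]mxE; apply: eq_bigr => h _.
  by rewrite [G _ _]mxE.
have Him : has_dim (f @` S) w.
  rewrite imE -[X in has_dim _ X]card_ord; apply: has_dim_fin => // c H i.
  have := congr1 (fun v : 'cV[mpoly n R]_w => v i 0) H.
  rewrite summxE mxE (bigD1 i)//= big1 => [|h /negbTE hi].
    by rewrite !mxE !eqxx mulr1 addr0 => /eqP; rewrite mpolyC_eq0 => /eqP.
  by rewrite !mxE eq_sym hi mulr0.
have [_] := rank_nullity fL HS Him.
rewrite (_ : _ `&` _ = [set v | S v /\ forall z, W z -> ip v z = 0])//.
apply/seteqP; split=> v /= [Sv H]; split => //.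
  move=> z; rewrite WE => -[c ->]; rewrite ipC ip_lcomb big1// => k _.
  have := congr1 (fun v : 'cV[mpoly n R]_w => v k 0) H; rewrite !mxE => /eqP.
  by rewrite mpolyC_eq0 ipC => /eqP ->; rewrite mulr0.
apply/matrixP => i j; rewrite !mxE H ?mpolyC0// WE; exact: spanned_id.
Qed.

(** Both sides count the pairs of disjoint subsets of sizes b and c in a set of p elements. *)
Lemma mul_bin_swap p b c : ('C(p, b) * 'C(p - b, c) = 'C(p, c) * 'C(p - c, b))%N.
Proof.
have [bc|bc] := leqP (b + c) p; last first.
  have z m m' : (p < m + m')%N -> ('C(p, m) * 'C(p - m, m') = 0)%N.
    move=> pm; have [pm'|mp] := ltnP p m; first by rewrite bin_small.
    by rewrite ['C(p - m, m')]bin_small ?muln0//; lia.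
  by rewrite !z// addnC.
apply/eqP; rewrite -(eqn_pmul2r (fact_gt0 b)) -(eqn_pmul2r (fact_gt0 c)).
rewrite -(eqn_pmul2r (fact_gt0 (p - b - c))); apply/eqP.
have b1 : (b <= p)%N by lia.
have c1 : (c <= p)%N by lia.
have b2 : (b <= p - c)%N by lia.
have c2 : (c <= p - b)%N by lia.
have B1 := bin_fact b1; have B2 := bin_fact c2.
have C1 := bin_fact c1; have C2 := bin_fact b2.
rewrite (_ : (p - c - b = p - b - c)%N) in C2; last by lia.
transitivity (p`!).
  by rewrite -B1 -B2; lia.
by rewrite -C1 -C2; lia.
Qed.

(** The usual convolution after the reflection C(p, s + 1) = C(p, p - 1 - s). *)
Lemma Vandermonde_shift p q N : (0 < p)%N -> (p <= N)%N ->
  (\sum_(s < N) 'C(p, s.+1) * 'C(q, s) = 'C(q + p, p.-1))%N.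
Proof.
case: p => // p _ pN; rewrite /= -binomial.Vandermonde.
rewrite (big_ord_widen _ (fun s => 'C(q, s) * 'C(p.+1, p - s))%N pN).
rewrite [RHS]big_mkcond; apply: eq_bigr => s _; case: ifP => sp.
  by rewrite mulnC -(@bin_sub p.+1 s.+1)// subSS.
by rewrite [X in (X * _)%N]bin_small//; lia.
Qed.

Lemma card_faces d m : #|[pred F : {set 'I_d} | #|F| == m]| = 'C(d, m).
Proof.
rewrite -[in RHS](card_ord d) -card_draws -sum1dep_card -sum1_card.
by apply: eq_bigl => F; rewrite !inE.
Qed.

Lemma dof_count_identity d k (S : nat) : (2 <= d)%N -> (d.+1 <= k)%N ->
  S = (\sum_(1 <= r < d) 'C(d.+1, (d - r).+1) * ('C(r.+1, 2) * 'C(k.-1, d - r)))%N ->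
  (d.+1 * 'C(d.+1, 2) + (S + ('C(d.+1, d) *
    ((d - 1) * 'C((k - 2).+1 + (d - 1), d - 1) -
      ('C((k - 2).+2 + (d - 1), d - 1) - 'C((k - 2).+1 + (d - 1), d - 1))) +
    'C(d.+1, 2) * 'C(k - 2 + d, d))) = 'C(d.+1, 2) * 'C(k + d, d))%N.
Proof.
move=> d2 kd SE; pose K := (k + d - 2)%N.
(* Indexed by the dimension s = d - r of the faces, the vertex count is the missing term s = 0. *)
have T : (d.+1 * 'C(d.+1, 2) + S =
    \sum_(s < d) 'C(d.+1, s.+1) * ('C((d - s).+1, 2) * 'C(k.-1, s)))%N.
  rewrite SE -(big_mkord xpredT (fun s => 'C(d.+1, s.+1) * ('C((d - s).+1, 2) * 'C(k.-1, s)))%N).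
  rewrite [RHS]big_ltn; last by lia.
  rewrite bin1 bin0 muln1 subn0; congr (_ + _)%N.
  rewrite [RHS]big_nat_rev /=; apply: eq_big_nat => r /andP[r1 rd].
  have -> : (1 + d - r.+1 = d - r)%N by lia.
  by have -> : (d - (d - r) = r)%N by lia.
(* Pascal's rule on the second binomial, then [mul_bin_swap] on both terms: s survives in a single
   factor, as Vandermonde requires. *)
have E s : (s < d)%N -> ('C(d.+1, s.+1) * 'C((d - s).+1, 2) =
    'C(d.+1, 2) * 'C(d.-1, s.+1) + d.+1 * 'C(d, s.+1))%N.
  move=> sd; have -> : ('C((d - s).+1, 2) = 'C(d - s, 2) + 'C(d - s, 1))%N by rewrite binS.
  rewrite mulnDr; congr (_ + _)%N.
    have -> : (d - s = d.+1 - s.+1)%N by lia.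
    rewrite mul_bin_swap; congr (_ * 'C(_, _))%N; lia.
  have -> : (d - s = d.+1 - s.+1)%N by lia.
  rewrite mul_bin_swap bin1; congr (_ * 'C(_, _))%N; lia.
have S1 : (\sum_(s < d) 'C(d.-1, s.+1) * 'C(k.-1, s) = 'C(K, d - 2))%N.
  rewrite Vandermonde_shift; [|lia|lia]; congr 'C(_, _); rewrite /K; lia.
have S2 : (\sum_(s < d) 'C(d, s.+1) * 'C(k.-1, s) = 'C(K.+1, d - 1))%N.
  rewrite Vandermonde_shift; [|lia|lia]; congr 'C(_, _); rewrite /K; lia.
have TE : (d.+1 * 'C(d.+1, 2) + S = 'C(d.+1, 2) * 'C(K, d - 2) + d.+1 * 'C(K.+1, d - 1))%N.
  rewrite T -S1 -S2 !big_distrr -big_split; apply: eq_bigr => s _ /=.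
  by rewrite mulnA E// mulnDl !mulnA.
have -> : ((k - 2).+1 + (d - 1) = K)%N by rewrite /K; lia.
have -> : ((k - 2).+2 + (d - 1) = K.+1)%N by rewrite /K; lia.
have -> : (k - 2 + d = K)%N by rewrite /K; lia.
have -> : (k + d = K.+2)%N by rewrite /K; lia.
have -> : 'C(d.+1, d) = d.+1 by rewrite -bin_sub// subSnn bin1.
have dE : ((d - 2).+2 = d)%N by lia.
have dE1 : ((d - 2).+1 = d - 1)%N by lia.
have B1 : 'C(K.+1, d - 1) = ('C(K, d - 1) + 'C(K, d - 2))%N.
  by have := binS K (d - 2); rewrite dE1.
have B2 : 'C(K.+2, d) = ('C(K, d) + ('C(K, d - 1) + 'C(K, d - 1)) + 'C(K, d - 2))%N.
  have := binS K.+1 (d - 2).+1; rewrite dE => ->.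
  have := binS K (d - 2).+1; rewrite dE dE1 => ->.
  by rewrite B1 !addnA.
(* Needed for the subtraction in the dimension of the ND space not to truncate. The ratio of the two
   sides is K - (d - 2) = k. *)
have le : ('C(K, d - 2) <= (d - 1) * 'C(K, d - 1))%N.
  have : (d - 1 <= K)%N by rewrite /K; lia.
  have := mul_bin_left K (d - 2); rewrite (_ : (d - 2).+1 = d - 1)%N; last by lia.
  move=> -> dK; rewrite -[leqLHS]mul1n leq_mul2r; apply/orP; right.
  by rewrite /K; lia.
(* Once all binomials are reduced to level K, the identity amounts to this relation multiplied by
   C(K, d - 1). *)
have Q2 : (2 * 'C(d.+1, 2) = d.+1 * d)%N by rewrite -mul_bin_diag bin1.
rewrite addnA TE B1 B2 addKn.
move: le Q2; set X := 'C(K, d - 2); set Y := 'C(K, d - 1); set Z := 'C(K, d).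
set Q := 'C(d.+1, 2) => le Q2.
have h1 : (d.+1 * ((d - 1) * Y - X) + d.+1 * X = d.+1 * ((d - 1) * Y))%N.
  by rewrite -mulnDr subnK.
have h2 : (d.+1 * ((d - 1) * Y) + d.+1 * Y = Q * Y + Q * Y)%N.
  rewrite -mulnDr -mulSnr (_ : (d - 1).+1 = d)%N; last by lia.
  by rewrite mulnA -Q2 addnn -mul2n mulnA.
rewrite !mulnDr -h2 -h1.
move: (d.+1 * X)%N (d.+1 * (_ - X))%N (d.+1 * Y)%N (Q * Z)%N (Q * X)%N; lia.
Qed.

End Counting.

Section Counts.
Import Order.TTheory GRing.Theory Num.Theory.
Local Open Scope ring_scope.
Local Open Scope classical_set_scope.
Variables (R : realType) (d k : nat) (a : 'I_d.+1 -> 'cV[R]_d).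

Lemma has_dim_div_test m w c g :
  barycentric [set: 'I_d.+1]%SET c g a -> has_dim (@RMspace R d) w ->
  has_dim (L2_compl a (@Pmx R d m.+1 d 1) (@RMspace R d)) (d * 'C(m.+1 + d, d) - w).
Proof.
move=> bK HW.
have K : simplex a = bary_simplex [set: 'I_d.+1]%SET c g := simplexE bK.
apply: has_dim_orthogonal HW _ => //.
- move=> e u v z; rewrite !ip_simplexE !frob_col K -(poly_intZ bK) -(poly_intD bK).
  by congr poly_int; rewrite vdotC vdotDr vdotZr mul_mpolyC ![vdot z _]vdotC.
- by move=> u v; rewrite !ip_simplexE !frob_col vdotC.
- move=> u; rewrite ip_simplexE frob_col K => I0.
  have := poly_int_sqr bK (w := fun=> 1) (u := fun i => u i 0).
  move=> H; apply/matrixP => i j; rewrite (ord1 j) [RHS]mxE; apply: H.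
  + by move=> _ x _; rewrite meval1.
  + by move=> _; exact: oner_neq0.
  + by rewrite -[RHS]I0; congr poly_int; apply: eq_bigr => h _; rewrite mul1r expr2.
- exact: has_dim_Pcol.
- by move=> u /(RMspaceE m)[].
Qed.

Variable fr : forall r, {set 'I_d.+1} -> face_frame R d r.
Hypotheses (d2 : (2 <= d)%N) (kd : (d.+1 <= k)%N).

(** Stated for any last summand of the right size, as (4) and the pair (5), (6) contribute the same
    number. *)
Lemma dof_count_common n : n = ('C(d.+1, 2) * 'C(k - 2 + d, d))%N ->
  (dof_count (dof_vertex a) + (dof_count (dof_normal a k fr) +
     (dof_count (dof_tangential a k fr) + n)))%N = poly_dim (@Psym R d k).
Proof.
move=> ->; rewrite (poly_dimE (has_dim_Psym _ _ _)) -(dof_count_identity d2 kd erefl).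
have face_sum r m : (\sum_(F : {set 'I_d.+1} | is_face r F) m = 'C(d.+1, (d - r).+1) * m)%N.
  by rewrite sum_nat_const card_faces.
congr (_ + (_ + (_ + _)))%N.
- by rewrite /= sum_nat_const card_ord bin2 [(d.+1 * _.-1)%N]mulnC.
- apply: eq_big_nat => r /andP[r1 rd]; rewrite face_sum; congr (_ * (_ * _))%N.
    exact: card_ord_le_pairs.
  rewrite (poly_dimE (has_dim_Ppoly _ _ _)); congr 'C(_, _); lia.
- rewrite /= face_sum (poly_dimE (has_dim_ND _ _ _)); congr ('C(_, _) * _)%N; lia.
Qed.

End Counts.

Theorem theorem4p13 (R : realType) (d k : nat) (a : 'I_d.+1 -> 'cV[R]_d)
    (fr : forall r, {set 'I_d.+1} -> face_frame R d r) :
  (2 <= d)%N -> (d.+1 <= k)%N ->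
  nondegenerate_simplex a ->
  simplex a 0%R ->
  (forall r F, (1 <= r <= d.-1)%N -> is_face r F -> frame_of a F (fr r F)) ->
  unisolvent (@Psym R d k)
    [:: dof_vertex a; dof_normal a k fr; dof_tangential a k fr;
        dof_interior a k] /\
  unisolvent (@Psym R d k)
    [:: dof_vertex a; dof_normal a k fr; dof_tangential a k fr;
        dof_div a k; dof_ker a k].
Proof.
move=> d2 kd nd _ frP; have [c [g bK]] := barycentric_exists nd.
split; split.
- move=> tau tauP /= [t1 [t2 [t3 [t4 _]]]].
  exact: (interior_eq0 d2 kd frP bK tauP t1 t2 t3).
- rewrite !big_cons big_nil addn0; apply: dof_count_common => //.
  exact: (poly_dimE (has_dim_Psym _ _ _)).
- move=> tau tauP /= [t1 [t2 [t3 [t4 [t5 _]]]]].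
  apply: (interior_eq0 d2 kd frP bK tauP t1 t2 t3).
  exact: (div_ker_interior d2 kd frP bK tauP t1 t2 t3).
- rewrite !big_cons big_nil addn0; apply: dof_count_common => //.
  have [e [w [Hw eE eS Hk]]] := dim_RM_kernel R d (k - 2).
  (* With [e] the dimension of the space of symmetric gradients, (5) counts [e] and (6) counts what
     [e] leaves of the number in (4). *)
  have k1 : (k - 1)%N = (k - 2).+1 by lia.
  have Hd := has_dim_div_test (k - 2) bK Hw; rewrite eE -k1 in Hd.
  by rewrite /= (poly_dimE Hd) (poly_dimE Hk) subnKC.
Qed.
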